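(* Let $\bar u$ be an optimal control of $(P_0)$ with optimal state $\bar y$ and adjoint state $\bar\varphi$, and assume $\|\bar y(\cdot,T)-y_\Omega\|_{L^2(0,1)}>0$. Then the following hold. (i) For each $0<\varepsilon<T$, the number of switching points of $\bar u$ in $[0,T-\varepsilon]$ is finite. Therefore the number of switching points of $\bar u$ in $[0,T]$ is at most countable, and switching points can accumulate only at $t=T$. Between two subsequent switching points, $\bar u$ is (almost everywhere) identically constant and equal to one of the values $b$, $a$ or $0$. (ii) If $\bar\varphi(1,T)\neq\mu$ and $\bar\varphi(1,T)\neq-\mu$, then the number of switching points of $\bar u$ is finite, and there is a sufficiently small $\delta>0$ such that for almost all $t\in(T-\delta,T]$: $\bar u(t)=b$ if $\bar\varphi(1,T)<-\mu$; $\bar u(t)=0$ if $-\mu<\bar\varphi(1,T)<\mu$; $\bar u(t)=a$ if $\bar\varphi(1,T)>\mu$. (iii) If $\bar\varphi(1,T)=\mu$, then there is $\delta>0$ such that in $(T-\delta,T]$ the control $\bar u$ takes almost everywhere only the values $a$ and $0$ and switches at most countably many times between them. If $\bar\varphi(1,T)=-\mu$, then there is $\delta>0$ such that in $(T-\delta,T]$ the control $\bar u$ takes almost everywhere only the values $b$ and $0$ and switches at most countably many times between them. (iv) A switch-over of $\bar u$ between $a$ and $b$ cannot happen: there is no switching point $t$ of $\bar u$ such that $\bar u=a$ a.e. on a one-sided neighborhood of $t$ and $\bar u=b$ a.e. on a neighborhood of $t$ on the other side.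
   Context: Fix $T>0$, $\alpha>0$, $\mu>0$, $a<0<b$ and $y_\Omega\in C[0,1]$; $Q=(0,1)\times(0,T)$. Let $U_{ad}=\{u\in L^2(0,T): a\le u(t)\le b \text{ for a.a. } t\in[0,T]\}$. For $u\in U_{ad}$, $y_u\in C(\bar Q)$ denotes the weak solution of $y_t-y_{xx}=0$ in $Q$, $y_x(0,t)=0$, $y_x(1,t)+\alpha y(1,t)=u(t)$ for $t\in(0,T)$, $y(x,0)=0$; and $\varphi_u\in C(\bar Q)$ denotes the weak solution of the adjoint equation $-\varphi_t-\varphi_{xx}=0$ in $Q$, $\varphi_x(0,t)=0$, $\varphi_x(1,t)+\alpha\varphi(1,t)=0$ for $t\in(0,T)$, $\varphi(x,T)=y_u(x,T)-y_\Omega(x)$. Problem $(P_0)$: minimize $F_0(u)=\frac12\int_0^1|y_u(x,T)-y_\Omega(x)|^2\,dx+\mu\int_0^T|u(t)|\,dt$ over $u\in U_{ad}$. It has at least one solution $\bar u$; write $\bar y=y_{\bar u}$, $\bar\varphi=\varphi_{\bar u}$. The optimal state does not depend on the choice of the optimal control. A switching point of $\bar u$ is a point $t\in(0,T)$ at which one of the two functions $t\mapsto\bar\varphi(1,t)-\mu$ and $t\mapsto\bar\varphi(1,t)+\mu$ changes its sign. *)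

(* Defs.v *)
From HB Require Import structures.
From mathcomp Require Import all_boot all_order all_algebra.
From mathcomp Require Import all_classical all_reals all_analysis.

Set Implicit Arguments.
Unset Strict Implicit.
Unset Printing Implicit Defensive.

Import Order.TTheory GRing.Theory Num.Theory.
Import numFieldNormedType.Exports.

Local Open Scope classical_set_scope.
Local Open Scope ring_scope.

Section heat_control.
Context {R : realType}.
Implicit Types (T alpha mu a b : R) (u yOmega : R -> R).
Implicit Types (v g y phi : R * R -> R).

Notation leb1 := (@lebesgue_measure R).
Notation leb2 := (@lebesgue_measure R \x @lebesgue_measure R)%E.

(* A point of the space-time cylinder is z = (x, t). *)
Definition Qopen T : set (R * R) := `]0, 1[ `*` `]0, T[.
Definition Qclosed T : set (R * R) := `[0, 1] `*` `[0, T].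

Definition dx v : R * R -> R := fun z => derive1 (fun x => v (x, z.2)) z.1.
Definition dt v : R * R -> R := fun z => derive1 (fun t => v (z.1, t)) z.2.

(* Restrictions to the closed cylinder of such functions are exactly the
   functions of class C^1 up to the boundary. *)
Definition class_C1 v : Prop :=
  [/\ forall z, derivable (fun x => v (x, z.2)) z.1 1,
      forall z, derivable (fun t => v (z.1, t)) z.2 1,
      continuous v, continuous (dx v) & continuous (dt v)].

(* g is the weak derivative of y with respect to x in Q, and g is in L^2(Q). *)
Definition weak_dx_L2 T y g : Prop :=
  g \_ (Qopen T) \in Lfun leb2 2%:E /\
  forall psi : R * R -> R, class_C1 psi ->
    (exists2 K : set (R * R), compact K /\ K `<=` Qopen T &
      forall z, ~ K z -> psi z = 0) ->
    \int[leb2]_(z in Qopen T) (y z * dx psi z) =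
    - \int[leb2]_(z in Qopen T) (g z * psi z).

(* Continuous weak solution of
     y_t - y_xx = 0 in Q,  y_x(0,t) = 0,
     y_x(1,t) + alpha y(1,t) = u(t),  y(x,0) = 0:
   multiply by a test function v with v(.,T) = 0 and integrate by parts over Q,
   in time for y_t and in space for y_xx. *)
Definition state T alpha u y : Prop :=
  {within Qclosed T, continuous y} /\
  exists2 g : R * R -> R, weak_dx_L2 T y g &
    forall v : R * R -> R, class_C1 v -> (forall x, 0 <= x <= 1 -> v (x, T) = 0) ->
      \int[leb2]_(z in Qopen T) (- y z * dt v z + g z * dx v z)
      + alpha * \int[leb1]_(t in `]0, T[) (y (1, t) * v (1, t))
      = \int[leb1]_(t in `]0, T[) (u t * v (1, t)).

(* Continuous weak solution of the backward equation
     - phi_t - phi_xx = 0 in Q,  phi_x(0,t) = 0,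
     phi_x(1,t) + alpha phi(1,t) = 0,  phi(x,T) = y(x,T) - yOmega(x);
   the test functions vanish at t = 0. *)
Definition adjoint_state T alpha yOmega y phi : Prop :=
  {within Qclosed T, continuous phi} /\
  exists2 g : R * R -> R, weak_dx_L2 T phi g &
    forall v : R * R -> R, class_C1 v -> (forall x, 0 <= x <= 1 -> v (x, 0) = 0) ->
      \int[leb2]_(z in Qopen T) (phi z * dt v z + g z * dx v z)
      + alpha * \int[leb1]_(t in `]0, T[) (phi (1, t) * v (1, t))
      = \int[leb1]_(x in `]0, 1[) ((y (x, T) - yOmega x) * v (x, T)).

Definition Uad T a b u : Prop :=
  u \_ `]0, T[ \in Lfun leb1 2%:E /\
  {ae leb1, forall t, t \in `[0, T] -> a <= u t <= b}.

(* The cost F_0(u), where y is the state belonging to u. *)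
Definition cost T mu yOmega u y : R :=
  2^-1 * \int[leb1]_(x in `]0, 1[) (`|y (x, T) - yOmega x| ^+ 2)
  + mu * \int[leb1]_(t in `]0, T[) `|u t|.

(* u minimizes F_0 over U_ad. States are only determined on the closed
   cylinder, so y_u ranges over all functions representing the state of u. *)
Definition optimal_control T alpha mu a b yOmega u : Prop :=
  Uad T a b u /\
  forall (w : R -> R) (y_u y_w : R * R -> R), Uad T a b w ->
    state T alpha u y_u -> state T alpha w y_w ->
    cost T mu yOmega u y_u <= cost T mu yOmega w y_w.

Definition L2norm01 (f : R -> R) : \bar R :=
  ('N[leb1]_2%:E[EFin \o (f \_ `]0%R, 1%R[)])%E.

(* f takes opposite strict signs on the two sides of t, arbitrarily close
   to t; only arguments in (0, T) are considered. *)
Definition changes_sign T (f : R -> R) (t : R) : Prop :=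
  forall r, 0 < r -> exists s s' : R,
    [/\ s \in `]0, T[, s' \in `]0, T[, t - r < s < t, t < s' < t + r
      & (f s * f s' < 0)].

Definition switching_points T mu phi : set R :=
  [set t | 0 < t < T /\
     (changes_sign T (fun s => phi (1, s) - mu) t \/
      changes_sign T (fun s => phi (1, s) + mu) t)].

Definition ae_eq_cst (I : interval R) u (c : R) : Prop :=
  {ae leb1, forall t, t \in I -> u t = c}.

(* Near t, neither of the values c and d can be discarded by changing u on a
   null set. *)
Definition switches_between u (c d t : R) : Prop :=
  forall r, 0 < r ->
    ~ {ae leb1, forall s, s \in `]t - r, t + r[ -> u s <> c} /\
    ~ {ae leb1, forall s, s \in `]t - r, t + r[ -> u s <> d}.

End heat_control.

(* Main.v *)
(* The trace f = phibar (1, .) is a Dirichlet series: expanding in the Robin eigenfunctions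
   cos (lam_n x), lam_n tan lam_n = alpha, gives f t = sum_n a_n exp (- lam_n^2 (T - t)) with
   bounded a_n. As a function of tau = T - t > 0 the series is analytic and tends to 0 at
   infinity, so it takes a value c <> 0 only finitely often in [eps, T]; with c = mu and
   c = - mu this bounds the sign changes of f - mu and f + mu.

   Linearizing the cost at ubar shows that ubar minimizes w |-> int_0^T (f w + mu |w|). It
   suffices to compare with smooth w vanishing at 0, whose states are explicit eigenfunction
   series; by approximation ubar is at least as good as the pointwise minimizer (b where
   f < - mu, 0 where |f| < mu, a where f > mu), hence equals it almost everywhere. Near a
   point where f = mu the value b is excluded, near a point where f = - mu the value a. *)
Require Import Defs.
From HB Require Import structures.
From mathcomp Require Import all_boot all_order all_algebra.
From mathcomp Require Import all_classical all_reals all_analysis.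
From mathcomp Require Import measurable_realfun ring lra.

Import Order.TTheory GRing.Theory Num.Theory.
Import numFieldNormedType.Exports.

Local Open Scope classical_set_scope.
Local Open Scope ring_scope.

Set Implicit Arguments.
Unset Strict Implicit.
Unset Printing Implicit Defensive.

Local Notation leb := (@lebesgue_measure _).
Local Notation leb2 := (@lebesgue_measure _ \x @lebesgue_measure _)%E.
Local Notation "'I01' f" := (\int[leb]_(x in `]0, 1[) f x) (at level 10, f at level 9).

(** * Integration and calculus *)

(** Several obstacles shape the development. The exponential series for the trace rests on
    completeness of the Robin modes. This is obtained without spectral theory: a function orthogonal
    to all modes has a Rayleigh quotient above every bound given by a Poincare inequality on a grid
    of nodes, so its L^2 norm vanishes. Weak solutions are known only through their integral
    identities, and the weak derivative only against functions supported inside the cylinder.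
    Testing with a mode times a time factor, with cutoffs that restore the boundary terms, turns
    each identity into a scalar ODE for one moment. The adjoint series is summable only before the
    final time, so the duality between control and adjoint trace is proved for t < T and then
    extended by continuity. Finally, minimality says something only about controls that possess a
    state. A state is within reach when the boundary datum w is C^1 with w(0) = 0: subtracting the
    lift w / alpha, which satisfies both boundary conditions, leaves a source -w' / alpha whose
    modes decay fast enough. This is why the comparison starts from smooth controls. *)

Lemma open_prod_measurable (R : realType) (U : set (R * R)) :
  open U -> measurable U.
Proof.
move=> oU.
pose rect (q : (rat * rat) * (rat * rat)) : set (R * R) :=
  `]ratr q.1.1, ratr q.1.2[ `*` `]ratr q.2.1, ratr q.2.2[.
(* The product sigma-algebra is generated by rectangles, so [U] is exhausted by the countably many
   rational rectangles inside it; every other index contributes [set0]. *)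
have -> : U = \bigcup_(q in setT)
    (if pselect (rect q `<=` U) then rect q else set0).
  apply/seteqP; split => [[x y] Uxy|[x y] [q _]]; last first.
    by case: pselect => // qU /qU.
  have /nbhs_ballP[e /= e0 eU] : nbhs (x, y) U by exact: open_nbhs_nbhs.
  have ball_rat (z : R) : exists p : rat * rat,
      (z \in `]ratr p.1, ratr p.2[) /\
      (forall w, (w \in `]ratr p.1, ratr p.2[) -> ball z e w).
    have [p /= pz] : exists q, ratr q \in `]z - e, z[.
      by apply: rat_in_itvoo; lra.
    have [q /= qz] : exists q, ratr q \in `]z, z + e[.
      by apply: rat_in_itvoo; lra.
    move: pz qz; rewrite !in_itv /= => /andP[p1 p2] /andP[q1 q2].
    exists (p, q); rewrite in_itv /= p2 q1; split => // w.
    by rewrite in_itv /= /ball /= => /andP[w1 w2]; rewrite ltr_norml; lra.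
  have [p [px pb]] := ball_rat x; have [q [qy qb]] := ball_rat y.
  exists (p, q) => //; case: pselect => [_ //|]; case=> -[w z] /= [wp zq].
  by apply: eU; split => /=; [exact: pb|exact: qb].
apply: countable_bigcupT_measurable => [|q].
  exact: countableP.
case: pselect => qU /=; last exact: measurable0.
by apply: measurableX; exact: measurable_itv.
Qed.

Lemma continuous2_measurable (R : realType) (F : R * R -> R) :
  continuous F -> measurable_fun setT F.
Proof.
move=> cF; apply: (measurability _ (RGenOInfty.measurableE R)) => //.
move=> _ [_ [a ->] <-]; rewrite setTI.
apply: open_prod_measurable.
by move/continuousP : cF; apply; apply: interval_open.
Qed.

Section integration.
Context {d : measure_display} {X : measurableType d} {R : realType}.
Variables (m : {measure set X -> \bar R}) (D : set X).
Hypothesis mD : measurable D.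
Implicit Types f g p : X -> R.

Lemma Rintegral_dominated_cvg (f_ : nat -> X -> R) f g :
  (forall n, measurable_fun D (f_ n)) ->
  (forall x, D x -> f_ n x @[n --> \oo] --> f x) ->
  m.-integrable D (EFin \o g) ->
  (forall n x, D x -> `|f_ n x| <= g x) ->
  \int[m]_(x in D) f_ n x @[n --> \oo] --> \int[m]_(x in D) f x.
Proof.
move=> mf ff ig fg.
have mfl : measurable_fun D f.
  exact: (measurable_fun_cvg mf).
have ae_cvg : \forall x \ae m, D x -> (EFin \o f_ ^~ x) n @[n --> \oo] --> (f x)%:E.
  by apply: aeW => x Dx; apply: cvg_EFin; [exact: nearW|exact: ff].
have ae_dom : \forall x \ae m, forall n, D x -> (`|(f_ n x)%:E| <= (g x)%:E)%E.
  by apply: aeW => x n Dx /=; rewrite lee_fin fg.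
have mfE n : measurable_fun D (EFin \o f_ n) by exact/measurable_EFinP.
have mflE : measurable_fun D (EFin \o f) by exact/measurable_EFinP.
have [intf _ cvgf] := dominated_convergence mD mfE mflE ae_cvg ig ae_dom.
rewrite /Rintegral; apply: fine_cvg; rewrite fineK//.
exact: integrable_fin_num.
Qed.

Lemma integrable_dom f g : measurable_fun D f ->
  (forall x, D x -> `|f x| <= g x) -> m.-integrable D (EFin \o g) ->
  m.-integrable D (EFin \o f).
Proof.
move=> mf fg; apply: le_integrable => //; first exact/measurable_EFinP.
move=> x Dx /=; rewrite lee_fin; exact: le_trans (fg x Dx) (ler_norm _).
Qed.

Lemma integrable_bounded f (M : R) : (m D < +oo)%E -> measurable_fun D f ->
  (forall x, D x -> `|f x| <= M) -> m.-integrable D (EFin \o f).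
Proof.
move=> mDoo mf fM; apply: measurable_bounded_integrable => //.
exists M; split; first by rewrite num_real.
by move=> N MN x Dx; exact: le_trans (fM x Dx) (ltW MN).
Qed.

Lemma integrable_mul_bounded f p (M : R) :
  m.-integrable D (EFin \o f) -> measurable_fun D p ->
  (forall x, D x -> `|p x| <= M) ->
  m.-integrable D (EFin \o (fun x => f x * p x)).
Proof.
move=> intf mp pM.
have mf : measurable_fun D f by apply/measurable_EFinP; exact: measurable_int intf.
have iM : m.-integrable D (EFin \o (fun x => M * `|f x|)).
  have := integrable_norm intf => /(integrableZl mD M).
  by apply: eq_integrable.
apply: integrable_dom iM; first exact: measurable_funM.
move=> x Dx; rewrite normrM mulrC ler_wpM2r//; exact: pM.
Qed.

Lemma eq_Rint f g : (forall x, D x -> f x = g x) ->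
  \int[m]_(x in D) f x = \int[m]_(x in D) g x.
Proof. by move=> fg; apply: eq_Rintegral => x /set_mem /fg. Qed.

Lemma integrable_lin f g (c1 c2 : R) :
  m.-integrable D (EFin \o f) -> m.-integrable D (EFin \o g) ->
  m.-integrable D (EFin \o (fun x => c1 * f x + c2 * g x)).
Proof.
move=> intf intg; apply: (integrableD mD (integrableZl mD c1 intf) (integrableZl mD c2 intg)).
Qed.

Lemma Rint_lin f g (c1 c2 : R) :
  m.-integrable D (EFin \o f) -> m.-integrable D (EFin \o g) ->
  \int[m]_(x in D) (c1 * f x + c2 * g x) = c1 * \int[m]_(x in D) f x + c2 * \int[m]_(x in D) g x.
Proof.
move=> intf intg; rewrite -!RintegralZl// -RintegralD//.
  exact: (integrableZl mD c1 intf).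
exact: (integrableZl mD c2 intg).
Qed.

End integration.

Section interval_calculus.
Context {R : realType}.
Implicit Types (f g F G : R -> R) (a b c : R).

Lemma itvoo_finite a b : (leb `]a, b[ < +oo)%E.
Proof. by rewrite lebesgue_measure_itv /=; case: ifP => _; rewrite ltry. Qed.

Lemma continuous_itv_bounded a b f : continuous f ->
  exists2 M, 0 <= M & forall x, a <= x <= b -> `|f x| <= M.
Proof.
move=> cf.
have /compact_bounded[M [Mr MP]] : compact (f @` `[a, b]).
  apply: continuous_compact; last exact: segment_compact.
  exact: continuous_subspaceT.
exists (`|M| + 1); first by rewrite addr_ge0.
move=> x xab; apply: (MP (`|M| + 1)).
  by rewrite (le_lt_trans (ler_norm M))// ltrDl.
by exists x => //=; rewrite in_itv.
Qed.

Lemma continuous_integrable a b f : continuous f ->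
  leb.-integrable `]a, b[ (EFin \o f).
Proof.
move=> cf; have [M _ fM] := continuous_itv_bounded a b cf.
apply: (@integrable_bounded _ _ _ _ _ _ _ M) => //.
- exact: itvoo_finite.
- by apply/measurable_funTS; exact: continuous_measurable_fun.
- by move=> x /=; rewrite in_itv /= => /andP[ax xb]; rewrite fM// !ltW.
Qed.

Lemma continuous_integrable_cc a b f : continuous f ->
  leb.-integrable `[a, b] (EFin \o f).
Proof.
move=> cf; apply: continuous_compact_integrable; first exact: segment_compact.
exact: continuous_subspaceT.
Qed.

Lemma Rint_cc f a b : continuous f ->
  \int[leb]_(x in `[a, b]) f x = \int[leb]_(x in `]a, b[) f x.
Proof.
move=> cf; rewrite /Rintegral integral_itv_bndoo//.
by apply/measurable_EFinP/measurable_funTS; exact: continuous_measurable_fun.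
Qed.

Lemma is_derive_continuous F f : (forall x : R, is_derive x 1 F (f x)) -> continuous F.
Proof.
move=> dF x; apply/differentiable_continuous; rewrite -derivable1_diffP.
by case: (dF x).
Qed.

Lemma Rint_FTC F f a b : a <= b -> (forall x : R, is_derive x 1 F (f x)) ->
  continuous f -> \int[leb]_(x in `]a, b[) f x = F b - F a.
Proof.
rewrite le_eqVlt => /predU1P[-> dF cf|ab dF cf].
  by rewrite set_itv_ge ?Rintegral_set0 ?subrr// bnd_simp ltxx.
rewrite -Rint_cc// /Rintegral (@continuous_FTC2 _ f F)//.
- exact: continuous_subspaceT.
- split => [x _||].
  + by case: (dF x).
  + exact/cvg_at_right_filter/(is_derive_continuous dF).
  + exact/cvg_at_left_filter/(is_derive_continuous dF).
- by move=> x _; rewrite derive1E; have [_ ->] := dF x.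
Qed.

Lemma Rint_chasles f a c b : a <= c <= b -> continuous f ->
  \int[leb]_(x in `]a, b[) f x =
  \int[leb]_(x in `]a, c[) f x + \int[leb]_(x in `]c, b[) f x.
Proof.
move=> /andP[ac cb] cf; rewrite -!Rint_cc//.
have := @Rintegral_itvB _ f (BLeft a) (BRight b) c (continuous_integrable_cc a b cf).
rewrite !bnd_simp => /(_ ac cb)/eqP.
rewrite subr_eq addrC => /eqP ->; congr (_ + _).
rewrite Rintegral_itv_obnd_cbnd//.
apply: integrableS (continuous_integrable_cc c b cf) => //.
exact: subset_itv_oc_cc.
Qed.

Lemma continuous_primitive f : continuous f ->
  exists2 F, forall x : R, is_derive x 1 F (f x) & F 0 = 0.
Proof.
move=> cf.
(* On [-n, +oo[ the integral from -n is a primitive; normalised at 0 these agree. *)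
pose P (n : nat) (x : R) : R := \int[leb]_(t in `[- n.+1%:R, x]) f t
                    - \int[leb]_(t in `[- n.+1%:R, 0]) f t.
have PE n k (x : R) : - n.+1%:R <= x -> (n <= k)%N -> P n x = P k x.
  move=> nx nk; rewrite /P !Rint_cc//.
  have kn : - k.+1%:R <= - n.+1%:R :> R by rewrite lerN2 ler_nat.
  have n0 : - n.+1%:R <= 0 :> R by rewrite oppr_le0.
  rewrite (@Rint_chasles f (- k.+1%:R) (- n.+1%:R) x) ?kn//.
  rewrite (@Rint_chasles f (- k.+1%:R) (- n.+1%:R) 0) ?kn//.
  ring.
have dP n (x : R) : - n.+1%:R < x -> is_derive x 1 (P n) (f x).
  move=> nx.
  have [dF FE] := @continuous_FTC1_closed _ f (- n.+1%:R) x (x + 1)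
    ltac:(by rewrite ltrDl) (continuous_integrable_cc _ _ cf) nx (cf x).
  have -> : f x = f x - 0 by rewrite subr0.
  apply: is_deriveB; split => //.
  by rewrite -derive1E.
pose N (x : R) := Num.truncn `|x|.
have Nx (x : R) : - (N x).+1%:R < x.
  have := truncnS_gt `|x|; have := lerNnormlW (lexx `|x|); lra.
exists (fun x => P (N x) x); last by rewrite /P subrr.
move=> x.
have NP (y : R) : - (N x).+1%:R < y -> P (N y) y = P (N x) y.
  move=> xy; have [NN|/ltnW NN] := leqP (N y) (N x); first by apply: PE => //; rewrite ltW.
  by apply/esym/PE => //; rewrite ltW.
apply: (@near_eq_is_derive _ _ _ (P (N x))) (dP _ _ (Nx x)); rewrite ?oner_eq0//.
by near=> y; apply/esym/NP; near: y; exact: lt_nbhsr.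
Unshelve. all: by end_near.
Qed.
End interval_calculus.

Section calculus2.
Context {R : realType}.
Implicit Types (f g : R -> R) (a b c : R) (T : R).

Lemma Rint_parts f g (F G : R -> R) a b : a <= b ->
  (forall x : R, is_derive x 1 F (f x)) -> (forall x : R, is_derive x 1 G (g x)) ->
  continuous f -> continuous g ->
  \int[leb]_(x in `]a, b[) (F x * g x) =
  F b * G b - F a * G a - \int[leb]_(x in `]a, b[) (f x * G x).
Proof.
move=> ab dF dG cf cg.
have cF := is_derive_continuous dF; have cG := is_derive_continuous dG.
have cFg : continuous (fun x => F x * g x) by move=> x; apply: cvgM; [exact: cF|exact: cg].
have cfG : continuous (fun x => f x * G x) by move=> x; apply: cvgM; [exact: cf|exact: cG].
have dFG (x : R) : is_derive x 1 (fun x => F x * G x) (F x * g x + f x * G x).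
  have /is_derive_eq := @is_deriveM _ _ _ _ _ _ _ _ (dF x) (dG x).
  by apply; rewrite /GRing.scale /= [G x * _]mulrC.
have cs : continuous (fun x => F x * g x + f x * G x).
  by move=> x; apply: cvgD; [exact: cFg|exact: cfG].
have := Rint_FTC ab dFG cs.
rewrite RintegralD//; [|exact: continuous_integrable..].
by move=> <-; rewrite addrK.
Qed.

Lemma derive_locally_constant F f a b c : (forall x : R, is_derive x 1 F (f x)) ->
  (forall x, a < x < b -> F x = c) -> forall x, a < x < b -> f x = 0.
Proof.
move=> dF Fc x /andP[ax xb]; have : is_derive x 1 F 0.
  apply: (@near_eq_is_derive _ _ _ (cst c)).
  near=> y; rewrite /= Fc//; apply/andP; split; near: y.
    exact: lt_nbhsr.
  exact: lt_nbhsl.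
by move=> [_ <-]; case: (dF x).
Unshelve. all: by end_near. Qed.

(** Integrals over initial pieces are squeezed to 0, so a primitive of [f] is constant on the
    interval and its derivative vanishes. *)
Lemma Rint_eq0 f a b : continuous f -> (forall x, a < x < b -> 0 <= f x) ->
  \int[leb]_(x in `]a, b[) f x = 0 -> forall x, a < x < b -> f x = 0.
Proof.
move=> cf f0 If.
have ge0 c d : a <= c -> d <= b -> 0 <= \int[leb]_(x in `]c, d[) f x.
  move=> ac db; apply: Rintegral_ge0 => y /=; rewrite in_itv /= => /andP[cy yd].
  by apply: f0; rewrite (le_lt_trans ac cy) (lt_le_trans yd db).
have I0 y : a < y < b -> \int[leb]_(x in `]a, y[) f x = 0.
  move=> /andP[ay yb]; move: If; rewrite (@Rint_chasles _ f a y b) ?ltW// => If.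
  have A := ge0 a y (lexx _) (ltW yb); have B := ge0 y b (ltW ay) (lexx _).
  by move/eqP : If; rewrite paddr_eq0// => /andP[/eqP].
have [F dF _] := continuous_primitive cf.
apply: (derive_locally_constant (c := F a) dF) => y yab.
have := I0 y yab; rewrite (Rint_FTC _ dF)//; last by move: yab => /andP[/ltW].
by move/eqP; rewrite subr_eq0 => /eqP.
Qed.

Lemma continuous2_bounded (F : R * R -> R) a b c (d : R) : continuous F ->
  exists2 M, 0 <= M &
    forall x t, a <= x <= b -> c <= t <= d -> `|F (x, t)| <= M.
Proof.
move=> cF.
have /compact_bounded[M [Mr MP]] : compact (F @` (`[a, b] `*` `[c, d])).
  apply: continuous_compact; last by apply: compact_setX; exact: segment_compact.
  exact: continuous_subspaceT.
exists (`|M| + 1); first by rewrite addr_ge0.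
move=> x t xab tcd; apply: (MP (`|M| + 1)).
  by rewrite (le_lt_trans (ler_norm M))// ltrDl.
by exists (x, t) => //=; rewrite !in_itv.
Qed.

Lemma continuous_slice1 (F : R * R -> R) (t : R) :
  continuous F -> continuous (fun x => F (x, t)).
Proof.
move=> cF x; apply: (@continuous_comp _ _ _ (fun x => (x, t)) F); last exact: cF.
exact: (cvg_pair cvg_id (cvg_cst _)).
Qed.

Lemma continuous_slice2 (F : R * R -> R) (x : R) :
  continuous F -> continuous (fun t => F (x, t)).
Proof.
move=> cF t; apply: (@continuous_comp _ _ _ (fun t => (x, t)) F); last exact: cF.
exact: (cvg_pair (cvg_cst _) cvg_id).
Qed.

Lemma Qopen_measurable T : measurable (Qopen T : set (R * R)).
Proof. by apply: measurableX; exact: measurable_itv. Qed.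

Lemma Qopen_finite T : (leb2 (Qopen T) < +oo)%E.
Proof.
rewrite /Qopen product_measure1E; [|exact: measurable_itv..].
by rewrite lte_mul_pinfty// ?itvoo_finite// ge0_fin_numE// itvoo_finite.
Qed.

Lemma continuous2_integrable T (F : R * R -> R) : continuous F ->
  leb2.-integrable (Qopen T) (EFin \o F).
Proof.
move=> cF; have [M _ FM] := continuous2_bounded 0 1 0 T cF.
apply: (@integrable_bounded _ _ _ _ _ _ _ M).
- exact: Qopen_measurable.
- exact: Qopen_finite.
- by apply/measurable_funTS; exact: continuous2_measurable.
- by move=> -[x t] /= [] /=; rewrite !in_itv /= => /andP[? ?] /andP[? ?]; rewrite FM// !ltW.
Qed.

Lemma Qopen_restrict T (F : R * R -> R) x t :
  ((EFin \o F) \_ (Qopen T)) (x, t) =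
  ((fun x => ((fun t => (F (x, t))%:E) \_ `]0, T[) t) \_ `]0, 1[) x.
Proof.
rewrite !patchE; case: ifPn => [|].
  by rewrite inE => -[/= x1 t1]; rewrite !mem_set.
rewrite notin_setE => /= xt.
case: ifPn => // /set_mem x1; case: ifPn => // /set_mem t1.
by exfalso; apply: xt.
Qed.

Lemma fubini_xt T (F : R * R -> R) : continuous F ->
  \int[leb2]_(z in Qopen T) F z =
  \int[leb]_(x in `]0, 1[) \int[leb]_(t in `]0, T[) F (x, t).
Proof.
move=> cF; rewrite /Rintegral; congr fine.
rewrite integral_mkcond -integral12_prod_meas1; last first.
  apply/integrable_restrict => //; first exact: Qopen_measurable.
  by rewrite setTI; exact: continuous2_integrable.
rewrite [RHS]integral_mkcond; apply: eq_integral => x _.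
rewrite /fubini_F; under eq_integral do rewrite Qopen_restrict patchE.
rewrite patchE; case: ifPn => _; last by rewrite integral0.
rewrite fineK -?integral_mkcond//.
by apply: integrable_fin_num => //; exact/continuous_integrable/continuous_slice2.
Qed.

Lemma fubini_tx T (F : R * R -> R) : continuous F ->
  \int[leb2]_(z in Qopen T) F z =
  \int[leb]_(t in `]0, T[) \int[leb]_(x in `]0, 1[) F (x, t).
Proof.
move=> cF; rewrite /Rintegral; congr fine.
rewrite integral_mkcond -integral21_prod_meas1; last first.
  apply/integrable_restrict => //; first exact: Qopen_measurable.
  by rewrite setTI; exact: continuous2_integrable.
rewrite [RHS]integral_mkcond; apply: eq_integral => t _.
rewrite /fubini_G; under eq_integral do rewrite Qopen_restrict.
rewrite patchE; case: ifPn => tT; last first.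
  by rewrite [LHS]integral0_eq// => x _; rewrite !patchE (negbTE tT); case: ifP.
rewrite fineK; last first.
  by apply: integrable_fin_num => //; exact/continuous_integrable/continuous_slice1.
rewrite [RHS]integral_mkcond; apply: eq_integral => x _.
by rewrite !patchE tT.
Qed.

Lemma continuous_Rint_param (F : R * R -> R) a b : continuous F ->
  continuous (fun t => \int[leb]_(x in `]a, b[) F (x, t)).
Proof.
move=> cF t; have [M _ FM] := continuous2_bounded a b (t - 1) (t + 1) cF.
apply: (@continuity_under_integral _ _ _ leb (fun t x => F (x, t)) `]a, b[ _
  (t - 1) (t + 1) _ _ (cst M)).
- by [].
- by move=> s _; exact/continuous_integrable/continuous_slice1.
- by apply: aeW => x _ s _; exact: continuous_slice2.
- exact/continuous_integrable/cst_continuous.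
- move=> s /=; rewrite in_itv /= => /andP[s1 s2]; apply: aeW => x /=.
  by rewrite in_itv /= => /andP[x1 x2]; rewrite FM// !ltW.
- by rewrite inE /= in_itv /=; apply/andP; split; lra.
Qed.

Lemma continuous_swap (F : R * R -> R) : continuous F ->
  continuous (fun z : R * R => F (z.2, z.1)).
Proof.
move=> cF z; apply: (@continuous_comp _ _ _ (fun z : R * R => (z.2, z.1)) F); last exact: cF.
exact: (cvg_pair cvg_snd cvg_fst).
Qed.

Lemma continuous_Rint_param' (F : R * R -> R) a b : continuous F ->
  continuous (fun x => \int[leb]_(t in `]a, b[) F (x, t)).
Proof. by move=> /continuous_swap /continuous_Rint_param; apply. Qed.

End calculus2.

Section rules.
Context {R : realType} {X : topologicalType}.
Implicit Types f g : X -> R.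
Lemma cont_add f g : continuous f -> continuous g -> continuous (fun x => f x + g x).
Proof. by move=> cf cg x; apply: cvgD; [exact: cf|exact: cg]. Qed.
Lemma cont_opp f : continuous f -> continuous (fun x => - f x).
Proof. by move=> cf x; apply: cvgN; exact: cf. Qed.
Lemma cont_mul f g : continuous f -> continuous g -> continuous (fun x => f x * g x).
Proof. by move=> cf cg x; apply: cvgM; [exact: cf|exact: cg]. Qed.
Lemma cont_exp f n : continuous f -> continuous (fun x => f x ^+ n).
Proof. by move=> cf x; apply: (@continuous_comp _ _ _ f (fun y => y ^+ n) x (cf x)); exact: exprn_continuous. Qed.
Lemma cont_cst (c : R) : continuous (fun _ : X => c).
Proof. by move=> x; exact: cvg_cst. Qed.
Lemma cont_comp (Y : topologicalType) (h : R -> Y) f : continuous h ->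
  continuous f -> continuous (fun x => h (f x)).
Proof. by move=> ch cf x; apply: (continuous_comp (cf x)); exact: ch. Qed.
Lemma cont_sum n (F : nat -> X -> R) : (forall i, continuous (F i)) ->
  continuous (fun x => \sum_(i < n) F i x).
Proof.
move=> cF; elim: n => [|n IH].
  by under eq_fun do rewrite big_ord0; exact: cont_cst.
by under eq_fun do rewrite big_ord_recr /=; apply: cont_add.
Qed.

Lemma cont_series (F : nat -> X -> R) N : (forall n, continuous (F n)) ->
  continuous (fun x => series (F^~ x) N).
Proof. by move=> cF; under eq_fun do rewrite /series /= big_mkord; exact: cont_sum. Qed.
End rules.
Lemma cont_id (R : realType) : continuous (fun x : R => x).
Proof. by move=> x; exact: cvg_id. Qed.
Lemma cont_fst (R : realType) : continuous (fun z : R * R => z.1).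
Proof. by move=> z; exact: cvg_fst. Qed.
Lemma cont_snd (R : realType) : continuous (fun z : R * R => z.2).
Proof. by move=> z; exact: cvg_snd. Qed.

Ltac cont1 := match goal with
  | H : continuous ?f |- continuous ?f => exact: H
  | |- continuous (fun x => x) => exact: cont_id
  | |- continuous (fun _ => ?c) => exact: cont_cst
  | |- continuous (fun z => z.1) => exact: cont_fst
  | |- continuous (fun z => z.2) => exact: cont_snd
  | |- continuous (fun z => (@?f z + @?g z)%R) => apply: (@cont_add _ _ f g)
  | |- continuous (fun z => (- @?f z)%R) => apply: (@cont_opp _ _ f)
  | |- continuous (fun z => (@?f z * @?g z)%R) => apply: (@cont_mul _ _ f g)
  | |- continuous (fun z => (@?f z ^+ ?n)%R) => apply: (@cont_exp _ _ f n)
  | |- continuous (fun z => sin (@?f z)) => apply: (@cont_comp _ _ _ sin f (@continuous_sin _))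
  | |- continuous (fun z => cos (@?f z)) => apply: (@cont_comp _ _ _ cos f (@continuous_cos _))
  | |- continuous (fun z => expR (@?f z)) =>
      apply: (@cont_comp _ _ _ expR f (@continuous_expR _))
  | |- continuous (fun z => series (fun n => @?F n z) ?N) =>
      apply: (@cont_series _ _ F N) => ?
  | H : continuous ?f |- continuous (fun x => ?f (x, ?t)) => exact: (continuous_slice1 (t := t) H)
  | H : continuous ?f |- continuous (fun t => ?f (?x, t)) => exact: (continuous_slice2 (x := x) H)
  | H : continuous ?f |- continuous (fun z => ?f (@?a z)) => apply: (@cont_comp _ _ _ f a H)
  | H : forall n : nat, continuous (?f n) |- continuous (?f ?n) => exact: H
  | H : forall n : nat, continuous (?f n) |- continuous (fun t => ?f ?n (?x, t)) =>
      exact: (continuous_slice2 (x := x) (H n))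
  | H : forall n : nat, continuous (?f n) |- continuous (fun z => ?f ?n (@?a z)) =>
      apply: (@cont_comp _ _ _ (f n) a (H n))
  | |- continuous _ => solve [auto 2]
  end.
Ltac cont := repeat cont1.
Ltac cint := first [apply: continuous_integrable | apply: continuous2_integrable]; cont.

(* Typeclass inference computes the derivative; what is left is an equation between values. *)
Ltac der := apply: is_derive_eq; rewrite /GRing.scale /=; try ring.

(** * Robin frequencies and a Poincare inequality *)

Section robin_roots.
Context {R : realType}.

Lemma sin_cos_npi n : sin (n%:R * pi) = 0 :> R /\ cos (n%:R * pi) = (- 1) ^+ n :> R.
Proof.
elim: n => [|n [IHs IHc]]; first by rewrite mul0r sin0 cos0 expr0.
have -> : n.+1%:R * pi = n%:R * pi + pi :> R by rewrite -natr1 mulrDl mul1r.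
by rewrite (sinD (_ * pi)) (cosD (_ * pi)) sinpi cospi IHs IHc !mulr0 mul0r subr0 addr0 mulrN1 exprS mulN1r.
Qed.

Lemma robin_root (alpha : R) n : 0 < alpha -> exists l : R,
  n%:R * pi < l < n%:R * pi + pi / 2 /\ l * sin l = alpha * cos l.
Proof.
move=> a0; have [sn cn] := sin_cos_npi n.
have p0 : 0 < pi :> R := pi_gt0 R.
(* The factor (-1)^n removes the alternating signs of sine and cosine: [h] equals -alpha < 0 at the
   left end and the positive abscissa itself at the right end. *)
pose u := n%:R * pi : R; pose h x := (- 1) ^+ n * (x * sin x - alpha * cos x) : R.
have u0 : 0 <= u by rewrite mulr_ge0// ltW.
have sgn2 : (- 1) ^+ n * (- 1) ^+ n = 1 :> R by rewrite -exprD -signr_odd addnn odd_double.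
have hu : h u = - alpha.
  by rewrite /h /u sn cn mulr0 sub0r mulrN mulrCA sgn2 mulr1.
have hv : h (u + pi / 2) = u + pi / 2.
  by rewrite /h sinDpihalf cosDpihalf /u sn cn oppr0 mulr0 subr0 mulrCA sgn2 mulr1.
have ch : continuous h by rewrite /h; cont.
have [|||l] := @IVT _ h u (u + pi / 2) 0; rewrite ?hu ?hv.
- by rewrite lerDl; lra.
- exact: continuous_subspaceT.
- by rewrite ge_min le_max; apply/andP; split; apply/orP; [left|right]; lra.
rewrite in_itv /= => /andP[ul lv] hl; exists l.
have lu : l != u by apply: contra_eq_neq hl => ->; rewrite hu; lra.
have lv' : l != u + pi / 2 by apply: contra_eq_neq hl => ->; rewrite hv; lra.
split; first by rewrite !lt_neqAle ul lv lv' eq_sym lu.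
apply/eqP; rewrite -subr_eq0; apply/eqP.
by move: hl => /(congr1 (fun x => (- 1) ^+ n * x)); rewrite /h mulrA sgn2 mul1r mulr0.
Qed.

End robin_roots.

Section poincare.
Context {R : realType}.
Implicit Types (g : R -> R).

(* Picone's identity with the comparison function cos (omega (x - m)):
   g'^2 - omega^2 g^2 + (omega g^2 tan (omega (x - m)))' = (g' + omega g tan (omega (x - m)))^2. *)
Lemma picone_piece g (g' P : R -> R) (omega m c d : R) : c <= d ->
  (forall x : R, is_derive x 1 g (g' x)) ->
  (forall x : R, is_derive x 1 P (g' x ^+ 2 - omega ^+ 2 * g x ^+ 2)) ->
  (forall x, c <= x <= d -> - (pi / 2) < omega * (x - m) < pi / 2) ->
  g c = 0 \/ m = c -> g d = 0 \/ m = d -> P c <= P d.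
Proof.
move=> cd dg dP small bc bd.
(* [D] is nondecreasing by the identity and agrees with [P] at both ends, where either [g] or the
   tangent vanishes. *)
pose D x := P x + omega * g x ^+ 2 * tan (omega * (x - m)).
have cos0 x : c <= x <= d -> cos (omega * (x - m)) != 0.
  by move=> /small /cos_gt0_pihalf; rewrite lt0r => /andP[].
pose D' x := (g' x + omega * g x * tan (omega * (x - m))) ^+ 2.
have dD (x : R) : c <= x <= d -> is_derive x 1 D (D' x).
  move=> /cos0 c0.
  have dt := is_derive_tan c0.
  have dl : is_derive x 1 (fun x : R => omega * (x - m)) omega by der.
  have dtan : is_derive x 1 (fun x : R => tan (omega * (x - m)))
      (cos (omega * (x - m)) ^- 2 * omega).
    exact: (@is_derive1_comp _ tan (fun x : R => omega * (x - m)) x _ _ dt dl).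
  rewrite /D /D'; apply: is_derive_eq; rewrite /GRing.scale /= /tan.
  set C := cos _ in c0 *; set S := sin _.
  have E : C ^- 2 = 1 + (S / C) ^+ 2.
    have SC : S ^+ 2 + C ^+ 2 = 1 by rewrite addrC cos2Dsin2.
    have -> : 1 + (S / C) ^+ 2 = (S ^+ 2 + C ^+ 2) * C ^- 2 by field.
    by rewrite SC mul1r.
  by rewrite E; ring.
have Dcd : D c <= D d.
  apply: (@ger0_derive1_ndecr _ D c d _ _ _ c d (lexx c) cd (lexx d)) => [x|x|].
  - rewrite in_itv /= => /andP[cx xd].
    by have [] : is_derive x 1 D (D' x) by apply: dD; rewrite !ltW.
  - rewrite in_itv /= => /andP[cx xd].
    by rewrite derive1E; have [_ ->] := dD x ltac:(by rewrite !ltW); exact: sqr_ge0.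
  - apply: derivable_within_continuous => x; rewrite in_itv /= => xcd.
    by have [] := dD x xcd.
have tan0' : tan (omega * 0) = 0 :> R by rewrite mulr0 tan0.
have Dc : D c = P c.
  by rewrite /D; case: bc => [->|->]; rewrite ?subrr ?tan0' ?expr0n /= ?mulr0 ?mul0r addr0.
have Dd : D d = P d.
  by rewrite /D; case: bd => [->|->]; rewrite ?subrr ?tan0' ?expr0n /= ?mulr0 ?mul0r addr0.
by rewrite -Dc -Dd.
Qed.

(* The nodes (2j+1)/(2N), N = k+1, are the zeros of cos (N pi x); each half cell has a node at
   one end. *)
Lemma poincare_nodes g (g' : R -> R) (k : nat) :
  (forall x : R, is_derive x 1 g (g' x)) -> continuous g' ->
  (forall j, (j < k.+1)%N -> g (j.*2.+1%:R / k.+1.*2%:R) = 0) ->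
  ((k%:R + 2^-1) * pi) ^+ 2 * \int[leb]_(x in `]0, 1[) (g x ^+ 2) <=
  \int[leb]_(x in `]0, 1[) (g' x ^+ 2).
Proof.
move=> dg cg' g0; set omega := (k%:R + 2^-1) * pi.
have cg := is_derive_continuous dg.
have [P dP _] : exists2 P : R -> R, (forall x : R, is_derive x 1 P (g' x ^+ 2 - omega ^+ 2 * g x ^+ 2))
    & P 0 = 0 by apply: continuous_primitive; cont.
have L0 : 0 < k.+1.*2%:R :> R by rewrite ltr0n.
have p0 : 0 < pi :> R := pi_gt0 R.
have k0 : 0 <= k%:R :> R by [].
have kL : k.+1.*2%:R = 2 * k%:R + 2 :> R by rewrite -muln2 natrM -natr1; ring.
have step i : (i < k.+1.*2)%N -> P (i%:R / k.+1.*2%:R) <= P (i.+1%:R / k.+1.*2%:R).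
  move=> ik; set c := _ / _; set d := _ / _.
  have dc : d - c = k.+1.*2%:R^-1 by rewrite /d /c -natr1; field; rewrite gt_eqF.
  have cd : c <= d by rewrite -subr_ge0 dc invr_ge0 ltW.
  (* A half cell has length 1 / (2k+2), and (k + 1/2) pi / (2k+2) < pi / 2 keeps the cosine
     positive. With k + 1 in place of k + 1/2 the inequality would no longer be strict. *)
  have om x : 0 <= x -> x <= d - c -> omega * x < pi / 2.
    move=> x0 xd; rewrite (@le_lt_trans _ _ (omega * (d - c)))//.
      by rewrite ler_wpM2l// mulr_ge0//; lra.
    rewrite dc -/(omega / _) ltr_pdivrMr// kL /omega; nra.
  have om0 x : 0 <= x -> 0 <= omega * x.
    by move=> x0; rewrite mulr_ge0// mulr_ge0//; lra.
  (* The nodes are the odd multiples of the step. The comparison cosine is centred at the other end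
     of the half cell, where its tangent is 0. *)
  have [io|ie] := boolP (odd i).
    apply: (@picone_piece g g' P omega d) => //.
    - move=> x /andP[cx xd].
      have A := om (d - x) ltac:(lra) ltac:(lra).
      have B := om0 (d - x) ltac:(lra).
      have -> : omega * (x - d) = - (omega * (d - x)) by ring.
      lra.
    - left; rewrite /c -(odd_double_half i) io add1n; apply: g0.
      by rewrite -ltn_double; apply: leq_trans ik; rewrite -{2}(odd_double_half i) io add1n ltnS.
    - by right.
  apply: (@picone_piece g g' P omega c) => //.
  - move=> x /andP[cx xd].
    have A := om (x - c) ltac:(lra) ltac:(lra).
    have B := om0 (x - c) ltac:(lra).
    lra.
  - by right.
  - left; rewrite /d -(odd_double_half i) (negbTE ie) add0n; apply: g0.
    by rewrite -ltn_double; apply: leq_ltn_trans ik; rewrite -{2}(odd_double_half i) (negbTE ie) add0n.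
have P01 : P 0 <= P 1.
  have mono i : (i <= k.+1.*2)%N -> P 0 <= P (i%:R / k.+1.*2%:R).
    elim: i => [|i IH] ik; first by rewrite mul0r.
    by rewrite (le_trans (IH (ltnW ik)))// step.
  by have := mono _ (leqnn _); rewrite divff// gt_eqF.
have c2 : continuous (fun x => g' x ^+ 2 - omega ^+ 2 * g x ^+ 2) by cont.
have := Rint_FTC ler01 dP c2.
rewrite RintegralB//; [|by cint..].
rewrite RintegralZl//; last by cint.
by move=> E; rewrite -subr_ge0 E subr_ge0.
Qed.

End poincare.

(** * Convergence of integrals and of series of functions *)

Section dct.
Context {R : realType}.

Lemma measurable_cont (D : set R) (f : R -> R) : continuous f -> measurable_fun D f.
Proof. by move=> cf; apply/measurable_funTS; exact: continuous_measurable_fun. Qed.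

Lemma Rint_cvg (a b M : R) (f_ : nat -> R -> R) (f : R -> R) :
  (forall n, continuous (f_ n)) ->
  (forall x, a < x < b -> f_ n x @[n --> \oo] --> f x) ->
  (forall n x, a < x < b -> `|f_ n x| <= M) ->
  \int[leb]_(x in `]a, b[) f_ n x @[n --> \oo] --> \int[leb]_(x in `]a, b[) f x.
Proof.
move=> cf ff fM; apply: (@Rintegral_dominated_cvg _ _ _ _ _ _ _ _ (cst M)).
- exact: measurable_itv.
- by move=> n; exact: measurable_cont.
- by move=> x /=; rewrite in_itv /=; exact: ff.
- exact/continuous_integrable/cont_cst.
- by move=> n x /=; rewrite in_itv /=; exact: fM.
Qed.
End dct.

Lemma series_bound {R : realType} (B F : nat -> R) N : cvgn (series B) ->
  (forall n, `|F n| <= B n) -> `|series F N| <= limn (series B).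
Proof.
move=> cB FB; apply: (@le_trans _ _ (series B N)).
  by rewrite (le_trans (ler_norm_sum _ _ _))// ler_sum.
apply: nondecreasing_cvgn_le cB N; apply/nondecreasing_seqP => n.
by rewrite seriesSr lerDl (le_trans _ (FB n)).
Qed.

Section weierstrass_mtest.
Context {R : realType} {X : topologicalType}.

Lemma weierstrass_mtest (F : nat -> X -> R) (B : nat -> R) :
  (forall n, continuous (F n)) -> (forall n x, `|F n x| <= B n) ->
  cvgn (series B) ->
  exists S : X -> R, [/\ continuous S,
    forall x, series (F^~ x) n @[n --> \oo] --> S x
  & forall N x, `|S x - series (F^~ x) N| <= limn (series B) - series B N].
Proof.
move=> cF FB cB.
have cvgF x : cvgn (series (F^~ x)).
  apply: normed_cvg; apply: series_le_cvg cB => n //=.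
  exact: le_trans (FB n x).
pose S x := limn (series (F^~ x)).
have SF x : series (F^~ x) n @[n --> \oo] --> S x := cvgF x.
have tail N x : `|S x - series (F^~ x) N| <= limn (series B) - series B N.
  have c1 : `|series (F^~ x) n - series (F^~ x) N| @[n --> \oo] --> `|S x - series (F^~ x) N|.
    by apply: cvg_norm; apply: cvgB; [exact: SF|exact: cvg_cst].
  have c2 : series B n - series B N @[n --> \oo] --> limn (series B) - series B N.
    by apply: cvgB; [exact: cB|exact: cvg_cst].
  apply: (ler_cvg_to c1 c2).
  near=> n; have Nn : (N <= n)%N by near: n; exact: nbhs_infty_ge.
  rewrite !sub_series_geq// (le_trans (ler_norm_sum _ _ _))//.
  exact: ler_sum.
exists S; split => // x; apply/cvgrPdist_lt => e e0.
have [N _ NB] : \forall N \near \oo, limn (series B) - series B N < e / 3.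
  move/cvgrPdist_lt : cB => /(_ (e / 3)); rewrite divr_gt0// => /(_ isT).
  by apply: filterS => N; apply: le_lt_trans; exact: ler_norm.
have tN := NB N (leqnn N).
have cS := cont_series (N := N) cF.
have /cvgrPdist_lt/(_ (e / 3)) := cS x; rewrite divr_gt0// => /(_ isT).
apply: filterS => y xy.
have tx := tail N x; have ty := tail N y.
have -> : S x - S y = (S x - series (F^~ x) N) + (series (F^~ x) N - series (F^~ y) N)
   - (S y - series (F^~ y) N) by ring.
rewrite (le_lt_trans (ler_normB _ _))// (le_lt_trans (lerD (ler_normD _ _) (lexx _)))//.
lra.
Unshelve. all: by end_near. Qed.
End weierstrass_mtest.

(** Trades exponential decay for the reciprocal, so that summability of 1 / lam_n^2 controls all
    exponential series. *)
Lemma expRN_le {R : realType} (x : R) : 0 < x -> expR (- x) <= x^-1.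
Proof.
move=> x0; rewrite expRN lef_pV2 ?posrE ?expR_gt0//.
by apply: le_trans (expR_ge1Dx x); rewrite lerDr.
Qed.

(** * Continuous extensions and smooth cutoffs *)

Section clamp.
Context {R : realType}.
Implicit Types (a b x : R).

(** The retraction of the line onto [a, b]. Precomposition with it extends functions continuously;
    [clamp 0 B (k * x)] serves later as a continuous approximation of a jump. *)
Definition clamp a b x : R := Num.max a (Num.min b x).

Lemma clamp_continuous a b : continuous (clamp a b).
Proof.
move=> x; apply: (@continuous_max R R (fun _ => a) (fun y => Num.min b y)).
  exact: cvg_cst.
by apply: (@continuous_min R R (fun _ => b) (fun y => y)); [exact: cvg_cst|exact: cvg_id].
Qed.

Lemma clamp_itv a b x : a <= b -> a <= clamp a b x <= b.
Proof. by move=> ab; rewrite /clamp le_max lexx ge_max ab ge_min lexx. Qed.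

Lemma clamp_id a b x : a <= x <= b -> clamp a b x = x.
Proof. by move=> /andP[ax xb]; rewrite /clamp min_r// max_r. Qed.

Lemma continuous_extension1 a b (f : R -> R) : a <= b ->
  {within `[a, b], continuous f} ->
  exists2 F : R -> R, continuous F & forall x, a <= x <= b -> F x = f x.
Proof.
move=> ab /subspace_continuousP cf; exists (fun x => f (clamp a b x)); last first.
  by move=> x /clamp_id ->.
move=> x; have xab : clamp a b x \in `[a, b] by rewrite in_itv; exact: clamp_itv.
move=> A fA; have := @clamp_continuous a b x _ (cf _ xab A fA).
rewrite !nbhs_simpl /=; apply: filterS => w; apply.
by rewrite /= in_itv; exact: clamp_itv.
Qed.

Lemma continuous_extension2 T (y : R * R -> R) : 0 <= T ->
  {within Qclosed T, continuous y} ->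
  exists2 Y : R * R -> R, continuous Y &
    forall x t, 0 <= x <= 1 -> 0 <= t <= T -> Y (x, t) = y (x, t).
Proof.
move=> T0 /subspace_continuousP cy.
pose c (z : R * R) := (clamp 0 1 z.1, clamp 0 T z.2).
have cc : continuous c.
  move=> z; exact: (cvg_pair (cont_comp (@clamp_continuous 0 1) (@cont_fst R) (x := z))
    (cont_comp (@clamp_continuous 0 T) (@cont_snd R) (x := z))).
exists (fun z => y (c z)); last by move=> x t x01 tT; rewrite /c /= !clamp_id.
have cQ z : Qclosed T (c z).
  by split; rewrite /= in_itv; [exact: (clamp_itv _ ler01)|exact: clamp_itv].
move=> z A fA; have := @cc z _ (cy _ (cQ z) A fA).
by rewrite !nbhs_simpl /=; apply: filterS => w; apply; exact: cQ.
Qed.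
End clamp.

Section smoothstep.
Context {R : realType}.

(** Test functions are of class C^1, so the normalised primitive of the positive part of x (1 - x)
    is smooth enough for all cutoffs. *)
Lemma smoothstep : exists s r : R -> R, [/\ forall x : R, is_derive x 1 s (r x),
  continuous r, forall x, 0 <= r x,
  (forall x y, x <= y -> s x <= s y) /\ (forall x, 0 <= s x <= 1)
& (forall x, x <= 0 -> s x = 0 /\ r x = 0) /\ (forall x, 1 <= x -> s x = 1 /\ r x = 0)].
Proof.
pose q (x : R) := Num.max 0 (x * (1 - x)).
have cq : continuous q.
  move=> x; apply: (@continuous_max R R (fun _ => 0) (fun y => y * (1 - y))).
    exact: cvg_cst.
  have cy : continuous (fun y : R => y * (1 - y)) by cont.
  exact: cy.
have q0 x : 0 <= q x by rewrite /q le_max lexx.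
have qout x : x <= 0 \/ 1 <= x -> q x = 0.
  move=> x01; apply/max_idPl; case: x01 => x01; first by rewrite mulr_le0_ge0// subr_ge0; lra.
  by rewrite mulr_ge0_le0// ?subr_le0//; lra.
have [P dP P0] := continuous_primitive cq.
have Ple x : x <= 0 -> P x = 0.
  move=> x0; have := Rint_FTC x0 dP cq; rewrite P0 sub0r.
  rewrite (_ : Rintegral _ _ _ = 0); first by move=> /eqP; rewrite eq_sym oppr_eq0 => /eqP.
  rewrite (@eq_Rint _ _ _ _ _ _ (fun _ => 0)); first by rewrite Rintegral_cst// mul0r.
  by move=> y /=; rewrite in_itv /= => /andP[_ y0]; apply: qout; left; exact: ltW.
have Pge x : 1 <= x -> P x = P 1.
  move=> x0; have := Rint_FTC x0 dP cq.
  rewrite (_ : Rintegral _ _ _ = 0); first by move=> /eqP; rewrite eq_sym subr_eq0 => /eqP.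
  rewrite (@eq_Rint _ _ _ _ _ _ (fun _ => 0)); first by rewrite Rintegral_cst// mul0r.
  by move=> y /=; rewrite in_itv /= => /andP[y0 _]; apply: qout; right; exact: ltW.
have P1 : 0 < P 1.
  have E := Rint_FTC ler01 dP cq; rewrite P0 subr0 in E.
  rewrite lt0r -E Rintegral_ge0// andbT; apply/negP => /eqP I0.
  have /(_ 2^-1) := Rint_eq0 cq (fun x _ => q0 x) I0.
  have -> : (0 < (2^-1 : R) < 1) by lra.
  move=> /(_ isT); rewrite /q => /max_idPl; lra.
have mono x y : x <= y -> P x <= P y.
  by move=> xy; rewrite -subr_ge0 -(Rint_FTC xy dP cq); exact: Rintegral_ge0.
exists (fun x => P x / P 1), (fun x => q x / P 1); split.
- by move=> x; der.
- by cont.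
- by move=> x; rewrite divr_ge0// ltW.
- split=> [x y xy|x]; first by rewrite ler_pM2r ?invr_gt0// mono.
  rewrite ler_pdivrMr// mul1r; apply/andP; split.
    by rewrite divr_ge0 ?(ltW P1)//; have [/Ple->//|/ltW/mono] := leP x 0; rewrite P0.
  by have [/Pge->//|/ltW/mono] := leP 1 x.
split=> x x01; first by rewrite Ple// qout ?mul0r//; left.
by rewrite Pge// qout ?mul0r ?divff ?gt_eqF//; right.
Qed.

(** An approximate identity whose mass is measured on the interval only, so that [c] may be an end
    point; the cutoffs concentrate their derivatives there. *)
Lemma delta_cvg (a b c : R) (K : nat -> R -> R) (h : R -> R) :
  (forall k, continuous (K k)) -> (forall k x, 0 <= K k x) ->
  (\forall k \near \oo, \int[leb]_(x in `]a, b[) K k x = 1) ->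
  (forall e, 0 < e -> \forall k \near \oo, forall x, e <= `|x - c| -> K k x = 0) ->
  continuous h ->
  \int[leb]_(x in `]a, b[) (h x * K k x) @[k --> \oo] --> h c.
Proof.
move=> cK K0 K1 Kc ch; apply/cvgrPdist_le => e e0.
have /cvgrPdist_lt/(_ e e0) := ch c; rewrite -nbhs_ballE => -[d /= d0 dP].
near=> k.
have Kk1 : \int[leb]_(x in `]a, b[) K k x = 1 by near: k; exact: K1.
have Kkc : forall x, d <= `|x - c| -> K k x = 0 by near: k; exact: Kc.
have cKk := cK k.
have -> : h c - \int[leb]_(x in `]a, b[) (h x * K k x) =
    \int[leb]_(x in `]a, b[) ((h c - h x) * K k x).
  rewrite [X in X - _](_ : h c = \int[leb]_(x in `]a, b[) (h c * K k x)); last first.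
    by rewrite RintegralZl ?Kk1 ?mulr1//; exact: continuous_integrable.
  rewrite -RintegralB//; [|by cint..].
  by apply: eq_Rint => x _; rewrite mulrBl.
have ci : continuous (fun x => (h c - h x) * K k x) by cont.
apply: le_trans (le_normr_Rintegral _ (continuous_integrable _ _ ci)) _ => //.
rewrite -[leRHS]mulr1 -Kk1 -RintegralZl//; last exact: continuous_integrable.
apply: le_Rintegral => //.
- by apply: continuous_integrable => x; apply: cvg_norm; exact: ci.
- by cint.
move=> x _; rewrite normrM (ger0_norm (K0 _ _)).
have [xc|xc] := leP d `|x - c|; first by rewrite Kkc// !mulr0.
by rewrite ler_wpM2r// ltW//; apply: dP; rewrite /ball /= distrC.
Unshelve. all: by end_near. Qed.

End smoothstep.

Section cutoff.
Context {R : realType}.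

Lemma near_scale (K0 : nat) (M e : R) : 0 < e ->
  \forall k \near \oo, M <= (k + K0)%:R * e.
Proof.
move=> e0; near=> k.
rewrite natrD mulrDl -[leLHS]addr0 lerD//; last by rewrite mulr_ge0// ltW.
by rewrite -ler_pdivrMr//; near: k; exact: nbhs_infty_ger.
Unshelve. all: by end_near. Qed.

(** A steep rise immediately to the right of [t]: its derivative acts as a Dirac mass at [t], which
    turns identities integrated in time into pointwise ones. *)
Lemma ramp (T t : R) : 0 <= t < T -> exists th th' : nat -> R -> R,
  [/\ forall k (x : R), is_derive x 1 (th k) (th' k x), forall k, continuous (th' k),
      forall k x, 0 <= th k x <= 1,
      (forall k x, x <= t -> th k x = 0) /\
      (forall k x, T <= x -> th k x = 1)
  & (forall x, t < x -> th k x @[k --> \oo] --> (1 : R)) /\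
    forall h : R -> R, continuous h ->
      \int[leb]_(x in `]0, T[) (h x * th' k x) @[k --> \oo] --> h t].
Proof.
move=> /andP[t0 tT]; have [s [r [ds cr r0 [sm s01] [sr0 sr1]]]] := @smoothstep R.
have Tt : 0 < T - t by rewrite subr_gt0.
(* The shift by [K0] makes the rise end before [T] for every k, not just eventually. *)
pose K0 := (Num.truncn ((T - t)^-1)).+1.
pose kap k : R := (k + K0)%:R.
have kap0 k : 0 < kap k by rewrite ltr0n addn_gt0 orbT.
have kap1 k : 1 <= kap k * (T - t).
  rewrite -ler_pdivrMr// div1r (le_trans (ltW (truncnS_gt _)))// ler_nat.
  exact: leq_addl.
pose th k x := s (kap k * (x - t)); pose th' k x := kap k * r (kap k * (x - t)).
have dth k (x : R) : is_derive x 1 (th k) (th' k x) by rewrite /th /th'; der.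
have cth' k : continuous (th' k) by rewrite /th'; cont.
have th0 k x : x <= t -> th k x = 0.
  by move=> xt; rewrite /th (sr0 _ _).1// mulr_ge0_le0 ?subr_le0// ltW.
have th1 k x : T <= x -> th k x = 1.
  move=> xt; rewrite /th (sr1 _ _).1//; apply: le_trans (kap1 k) _.
  by rewrite ler_wpM2l ?(ltW (kap0 k))//; lra.
exists th, th'; split => //.
- by move=> k x; exact: s01.
split.
- move=> x tx; apply: cvg_near_cst; near=> k; rewrite /th (sr1 _ _).1//.
  by near: k; apply: near_scale; rewrite subr_gt0.
move=> h ch; apply: delta_cvg => //.
- by move=> k x; rewrite mulr_ge0// ltW.
- apply: nearW => k; rewrite (Rint_FTC _ (dth k) (cth' k)) ?(le_trans t0 (ltW tT))//.
  by rewrite th1// th0// subr0.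
- move=> e e0; near=> k => x xe; rewrite /th'.
  have ke : 1 <= kap k * e by near: k; exact: near_scale.
  have [xt|xt] := leP x t.
    by rewrite (sr0 _ _).2 ?mulr0// mulr_ge0_le0 ?subr_le0// ltW.
  rewrite (sr1 _ _).2 ?mulr0// (le_trans ke)// ler_wpM2l ?(ltW (kap0 k))//.
  by move: xe; rewrite ger0_norm ?subr_ge0 ?(ltW xt).
Unshelve. all: by end_near. Qed.

(** The derivative tends to a Dirac mass at 0 minus one at [L]; these limits supply the boundary
    terms in an integration by parts. *)
Lemma cutoff (L : R) : 0 < L -> exists chi chi' : nat -> R -> R,
  [/\ forall k (x : R), is_derive x 1 (chi k) (chi' k x), forall k, continuous (chi' k),
      forall k x, 0 <= chi k x <= 1,
      forall k, exists a b, [/\ 0 < a, b < L & forall x, ~ (a <= x <= b) -> chi k x = 0]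
  & (forall x, 0 < x < L -> chi k x @[k --> \oo] --> (1 : R)) /\
    forall h : R -> R, continuous h ->
      \int[leb]_(x in `]0, L[) (h x * chi' k x) @[k --> \oo] --> h 0 - h L].
Proof.
move=> L0; have [s [r [ds cr r0 [sm s01] [sr0 sr1]]]] := @smoothstep R.
(* With scale kappa, [c1] rises on [1/kappa, 2/kappa] and [c2] on [L - 2/kappa, L - 1/kappa]. The
   condition kappa L >= 4 keeps the first rise to the left of the second. *)
pose K0 := (Num.truncn (4 / L)).+1.
pose kap k : R := (k + K0)%:R.
have kap0 k : 0 < kap k by rewrite ltr0n addn_gt0 orbT.
have kap4 k : 4 <= kap k * L.
  rewrite -ler_pdivrMr// (le_trans (ltW (truncnS_gt _)))// ler_nat.
  exact: leq_addl.
pose c1 k x := s (kap k * x - 1); pose c1' k x := kap k * r (kap k * x - 1).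
pose c2 k x := s (kap k * (x - L) + 2); pose c2' k x := kap k * r (kap k * (x - L) + 2).
have dc1 k (x : R) : is_derive x 1 (c1 k) (c1' k x) by rewrite /c1 /c1'; der.
have dc2 k (x : R) : is_derive x 1 (c2 k) (c2' k x) by rewrite /c2 /c2'; der.
have cc1' k : continuous (c1' k) by rewrite /c1'; cont.
have cc2' k : continuous (c2' k) by rewrite /c2'; cont.
exists (fun k x => c1 k x - c2 k x), (fun k x => c1' k x - c2' k x); split.
- by move=> k x; have d1 := dc1 k; have d2 := dc2 k; der.
- by move=> k; cont.
- move=> k x; have /andP[a1 a2] := s01 (kap k * x - 1).
  have /andP[b1 b2] := s01 (kap k * (x - L) + 2).
  have : s (kap k * (x - L) + 2) <= s (kap k * x - 1) by apply: sm; have := kap4 k; lra.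
  rewrite /c1 /c2; lra.
- move=> k; exists (kap k)^-1, (L - (kap k)^-1); split.
  + by rewrite invr_gt0.
  + by rewrite ltrBlDr ltrDl invr_gt0.
  move=> x /negP; rewrite negb_and -!ltNge /c1 /c2; have k4 := kap4 k; have kp := kap0 k.
  have kV : kap k * (kap k)^-1 = 1 by rewrite mulfV// gt_eqF.
  case/orP => xk.
    have : kap k * x <= 1 by rewrite -kV ler_wpM2l ?ltW.
    by move=> kx; rewrite !(sr0 _ _).1 ?subr0//; lra.
  have : kap k * (L - (kap k)^-1) <= kap k * x by rewrite ler_wpM2l ?ltW.
  by move=> kx; rewrite !(sr1 _ _).1 ?subrr//; lra.
split.
- move=> x /andP[x0 xL]; apply: cvg_near_cst; near=> k; rewrite /c1 /c2.
  have kx : 2 <= kap k * x by near: k; exact: near_scale.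
  have kL : 2 <= kap k * (L - x) by near: k; apply: near_scale; rewrite subr_gt0.
  by rewrite (sr1 _ _).1 ?(sr0 _ _).1 ?subr0//; lra.
move=> h ch.
have -> : (fun k => \int[leb]_(x in `]0, L[) (h x * (c1' k x - c2' k x))) =
    (fun k => \int[leb]_(x in `]0, L[) (h x * c1' k x) - \int[leb]_(x in `]0, L[) (h x * c2' k x)).
  apply/funext => k.
  rewrite -RintegralB//; [|by cint..].
  by apply: eq_Rint => x _; rewrite mulrBr.
apply: cvgB.
  apply: delta_cvg => //.
  - by move=> k x; rewrite mulr_ge0// ltW.
  - apply: nearW => k; rewrite (Rint_FTC (ltW L0) (dc1 k) (cc1' k)) /c1.
    by rewrite (sr1 _ _).1 ?(sr0 _ _).1 ?subr0//; have := kap4 k; lra.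
  - move=> e e0; near=> k => x; rewrite subr0 /c1' => xe.
    have ke : 2 <= kap k * e by near: k; exact: near_scale.
    have [x0|x0] := leP x 0.
      rewrite (sr0 _ _).2 ?mulr0//.
      have : kap k * x <= 0 by rewrite mulr_ge0_le0// ltW.
      lra.
    rewrite ger0_norm ?(ltW x0)// in xe.
    have : kap k * e <= kap k * x by rewrite ler_wpM2l ?(ltW (kap0 k)).
    by move=> kex; rewrite (sr1 _ _).2 ?mulr0//; lra.
apply: delta_cvg => //.
- by move=> k x; rewrite mulr_ge0// ltW.
- apply: nearW => k; rewrite (Rint_FTC (ltW L0) (dc2 k) (cc2' k)) /c2.
  by rewrite (sr1 _ _).1 ?(sr0 _ _).1 ?subr0//; have := kap4 k; lra.
- move=> e e0; near=> k => x; rewrite /c2' => xe.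
  have ke : 2 <= kap k * e by near: k; exact: near_scale.
  have [x0|x0] := leP x L.
    rewrite ler0_norm ?subr_le0// in xe.
    have : kap k * e <= kap k * - (x - L) by rewrite ler_wpM2l ?(ltW (kap0 k)).
    by move=> kex; rewrite (sr0 _ _).2 ?mulr0//; lra.
  have : 0 <= kap k * (x - L) by rewrite mulr_ge0 ?subr_ge0 ?ltW.
  by move=> kex; rewrite (sr1 _ _).2 ?mulr0//; lra.
Unshelve. all: by end_near. Qed.

End cutoff.

(** On a set of finite measure, |g| <= 1 + g^2. *)
Lemma Lfun2_integrable_on d (X : measurableType d) (R : realType)
    (m : {measure set X -> \bar R}) (D : set X) (g : X -> R) :
  measurable D -> (m D < +oo)%E -> g \_ D \in Lfun m 2%:E -> m.-integrable D (EFin \o g).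
Proof.
move=> mD mDoo g2.
have mgD : measurable_fun setT (g \_ D) by move: g2 => /sub_Lfun_mfun; rewrite inE.
have ig2 := Lfun2_integrable_sqr g2.
have gE z : D z -> (g \_ D) z = g z by move=> Dz; rewrite patchE mem_set.
apply: (@integrable_dom _ _ _ m D mD g (fun z => 1 + (g \_ D) z ^+ 2)).
- apply: (eq_measurable_fun (g \_ D)); first by move=> z /set_mem; exact: gE.
  exact: measurable_funTS.
- move=> z Dz; rewrite gE//; have := sqr_ge0 (`|g z| - 1); rewrite -(real_normK (num_real (g z))); nra.
- apply: (@integrableD _ _ _ m D mD (EFin \o cst 1) (EFin \o (fun z => (g \_ D) z ^+ 2))).
  + apply: (@integrable_bounded _ _ _ m D mD (cst 1) 1) => // z _; by rewrite /= normr1.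
  + exact: (@integrableS _ _ _ m setT D) ig2.
Qed.

(** * Integrals over the cylinder and the weak derivative *)

Section cylinder_integrals.
Context {R : realType} (T : R).
Notation Q := (Qopen T).
Implicit Types (g psi : R * R -> R).

Lemma Qopen_bound psi : continuous psi ->
  exists2 M, 0 <= M & forall z, Q z -> `|psi z| <= M.
Proof.
move=> cpsi; have [M M0 psiM] := continuous2_bounded 0 1 0 T cpsi.
exists M => // -[x t] [] /=; rewrite !in_itv /= => /andP[x0 x1] /andP[t0 t1].
by apply: psiM; rewrite !ltW.
Qed.

Lemma measurable_cont2 (D : set (R * R)) psi : continuous psi -> measurable_fun D psi.
Proof. by move=> cpsi; apply/measurable_funTS; exact: continuous2_measurable. Qed.

Lemma Qint_integrable g psi : leb2.-integrable Q (EFin \o g) -> continuous psi ->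
  leb2.-integrable Q (EFin \o (fun z => g z * psi z)).
Proof.
move=> ig cpsi; have [M _ psiM] := Qopen_bound cpsi.
apply: integrable_mul_bounded.
- exact: Qopen_measurable.
- exact: ig.
- exact: measurable_cont2.
- exact: psiM.
Qed.

Lemma Qint_cvg g (psi_ : nat -> R * R -> R) psi (M : R) :
  leb2.-integrable Q (EFin \o g) -> (forall n, continuous (psi_ n)) ->
  (forall z, Q z -> psi_ n z @[n --> \oo] --> psi z) ->
  (forall n z, Q z -> `|psi_ n z| <= M) ->
  \int[leb2]_(z in Q) (g z * psi_ n z) @[n --> \oo] --> \int[leb2]_(z in Q) (g z * psi z).
Proof.
move=> ig cpsi psiQ psiM.
have mg : measurable_fun Q g by apply/measurable_EFinP; exact: measurable_int ig.
apply: (@Rintegral_dominated_cvg _ _ _ leb2 Q _ (fun n z => g z * psi_ n z)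
  (fun z => g z * psi z) (fun z => M * `|g z|)).
- exact: Qopen_measurable.
- by move=> n; apply: measurable_funM => //; exact: measurable_cont2.
- by move=> z Qz; apply: cvgM; [exact: cvg_cst|exact: psiQ].
- apply: (integrableZl _ M (integrable_norm ig)).
  exact: Qopen_measurable.
- by move=> n z Qz; rewrite normrM mulrC ler_wpM2r//; exact: psiM.
Qed.

Lemma Lfun2_Qopen_integrable g : g \_ Q \in Lfun leb2 2%:E -> leb2.-integrable Q (EFin \o g).
Proof.
by move=> g2; apply: (@Lfun2_integrable_on _ _ _ leb2 Q g) => //; [exact: Qopen_measurable|exact: Qopen_finite].
Qed.

(** Separated products are the test functions through which moments are extracted from the weak
    identities. *)
Lemma class_C1_prod (p p' eta eta' : R -> R) :
  (forall x : R, is_derive x 1 p (p' x)) -> continuous p' ->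
  (forall x : R, is_derive x 1 eta (eta' x)) -> continuous eta' ->
  let v z := p z.1 * eta z.2 in
  [/\ class_C1 v, forall z, dx v z = p' z.1 * eta z.2
    & forall z, dt v z = p z.1 * eta' z.2].
Proof.
move=> dp cp' deta ceta' v.
have cp := is_derive_continuous dp; have ceta := is_derive_continuous deta.
have dvx (z : R * R) : is_derive z.1 1 (fun x => v (x, z.2)) (p' z.1 * eta z.2).
  by rewrite /v /=; der.
have dvt (z : R * R) : is_derive z.2 1 (fun t => v (z.1, t)) (p z.1 * eta' z.2).
  by rewrite /v /=; der.
have dxE (z : R * R) : dx v z = p' z.1 * eta z.2.
  by rewrite /dx derive1E; have [_ ->] := dvx z.
have dtE (z : R * R) : dt v z = p z.1 * eta' z.2.
  by rewrite /dt derive1E; have [_ ->] := dvt z.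
split => //; split.
- by move=> z; case: (dvx z).
- by move=> z; case: (dvt z).
- by rewrite /v; cont.
- by rewrite (_ : dx v = fun z => p' z.1 * eta z.2); [cont|exact/funext].
- by rewrite (_ : dt v = fun z => p z.1 * eta' z.2); [cont|exact/funext].
Qed.

Lemma Qint_add g psi : leb2.-integrable Q (EFin \o g) -> leb2.-integrable Q (EFin \o psi) ->
  \int[leb2]_(z in Q) (g z + psi z) = \int[leb2]_(z in Q) g z + \int[leb2]_(z in Q) psi z.
Proof. by move=> ig ipsi; rewrite RintegralD//; exact: Qopen_measurable. Qed.

Lemma Qint_scale (c : R) g : leb2.-integrable Q (EFin \o g) ->
  \int[leb2]_(z in Q) (c * g z) = c * \int[leb2]_(z in Q) g z.
Proof. by move=> ig; rewrite RintegralZl//; exact: Qopen_measurable. Qed.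

Lemma Qint_sub g psi : continuous g -> continuous psi ->
  \int[leb2]_(z in Q) (g z - psi z) = \int[leb2]_(z in Q) g z - \int[leb2]_(z in Q) psi z.
Proof.
by move=> cg cpsi; rewrite RintegralB//; [exact: Qopen_measurable|exact: continuous2_integrable..].
Qed.

(** The identity inside [state] with the weak derivative as an explicit argument. The datum [h] is
    arbitrary because differences of controls occur as well. *)
Definition weak_state alpha (h : R -> R) (y g : R * R -> R) :=
  forall v, class_C1 v -> (forall x, 0 <= x <= 1 -> v (x, T) = 0) ->
    \int[leb2]_(z in Q) (- y z * dt v z + g z * dx v z)
    + alpha * \int[leb]_(t in `]0, T[) (y (1, t) * v (1, t))
    = \int[leb]_(t in `]0, T[) (h t * v (1, t)).

Definition weak_adjoint alpha (d : R -> R) (phi g : R * R -> R) :=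
  forall v, class_C1 v -> (forall x, 0 <= x <= 1 -> v (x, 0) = 0) ->
    \int[leb2]_(z in Q) (phi z * dt v z + g z * dx v z)
    + alpha * \int[leb]_(t in `]0, T[) (phi (1, t) * v (1, t))
    = \int[leb]_(x in `]0, 1[) (d x * v (x, T)).

Lemma Qint_prod (y : R * R -> R) (p eta : R -> R) : continuous y -> continuous p -> continuous eta ->
  \int[leb2]_(z in Q) (y z * (p z.1 * eta z.2)) =
  \int[leb]_(t in `]0, T[) (eta t * \int[leb]_(x in `]0, 1[) (y (x, t) * p x)).
Proof.
move=> cy cp ceta; rewrite fubini_tx; last by cont.
apply: eq_Rint => t _.
rewrite -RintegralZl//; last by cint.
by apply: eq_Rint => x _ /=; ring.
Qed.

Lemma Qint_prod' (y : R * R -> R) (p eta : R -> R) : continuous y -> continuous p -> continuous eta ->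
  \int[leb2]_(z in Q) (y z * (p z.1 * eta z.2)) =
  \int[leb]_(x in `]0, 1[) (p x * \int[leb]_(t in `]0, T[) (y (x, t) * eta t)).
Proof.
move=> cy cp ceta; rewrite fubini_xt; last by cont.
apply: eq_Rint => x _.
rewrite -RintegralZl//; last by cint.
by apply: eq_Rint => t _ /=; ring.
Qed.

(* The weak derivative is only tested against functions supported inside the cylinder;
   cutoffs in x produce the boundary terms. *)
Lemma weak_dx_parts (y g : R * R -> R) (p p' eta eta' : R -> R) : 0 < T ->
  continuous y -> weak_dx_L2 T y g ->
  (forall x : R, is_derive x 1 p (p' x)) -> continuous p' ->
  (forall x : R, is_derive x 1 eta (eta' x)) -> continuous eta' ->
  \int[leb2]_(z in Q) (g z * (p z.1 * eta z.2)) =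
  \int[leb]_(t in `]0, T[) (eta t * (y (1, t) * p 1 - y (0, t) * p 0))
  - \int[leb2]_(z in Q) (y z * (p' z.1 * eta z.2)).
Proof.
move=> T0 cy [g2 wg] dp cp' deta ceta'.
have ig := Lfun2_Qopen_integrable g2.
have cp := is_derive_continuous dp; have ceta := is_derive_continuous deta.
have iy := continuous2_integrable T cy.
have [chi [chi' [dchi cchi' chi01 chiK [chi1 chiI]]]] := @cutoff R 1 ltr01.
have cchi k := is_derive_continuous (dchi k).
(* An admissible test function must have compact support in time as well. The given [eta] is reached
   afterwards through the time cutoffs [th k]. *)
have compact_eta (e e' : R -> R) : (forall x : R, is_derive x 1 e (e' x)) -> continuous e' ->
    (exists a b, [/\ 0 < a, b < T & forall x, ~ (a <= x <= b) -> e x = 0]) ->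
    \int[leb2]_(z in Q) (g z * (p z.1 * e z.2)) =
    \int[leb]_(t in `]0, T[) (e t * (y (1, t) * p 1 - y (0, t) * p 0))
    - \int[leb2]_(z in Q) (y z * (p' z.1 * e z.2)).
  move=> de ce' [ta [tb [ta0 tbT eK]]].
  have ce := is_derive_continuous de.
  pose pk k x := chi k x * p x; pose pk' k x := chi' k x * p x + chi k x * p' x.
  have dpk k (x : R) : is_derive x 1 (pk k) (pk' k x).
    by have dk := dchi k; rewrite /pk /pk'; der.
  have cpk' k : continuous (pk' k).
    by rewrite /pk'; cont.
  have wk k : \int[leb2]_(z in Q) (y z * (pk' k z.1 * e z.2)) =
      - \int[leb2]_(z in Q) (g z * (pk k z.1 * e z.2)).
    have [vC1 vx _] := class_C1_prod (dpk k) (@cpk' k) de ce'.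
    rewrite -wg//.
      by apply: eq_Rint => z _; rewrite vx.
    have [xa [xb [xa0 xb1 xK]]] := chiK k.
    exists (`[xa, xb] `*` `[ta, tb]).
      split; first by apply: compact_setX; exact: segment_compact.
      move=> -[x t] [] /=; rewrite !in_itv /= => /andP[x0 x1] /andP[t0 t1].
      split; rewrite /= in_itv /=; apply/andP; split.
      + exact: lt_le_trans x0.
      + exact: le_lt_trans xb1.
      + exact: lt_le_trans t0.
      + exact: le_lt_trans tbT.
    move=> -[x t] /= xt; have [x01|x01] := pselect (xa <= x <= xb); last first.
      by rewrite /pk xK// !mul0r.
    rewrite eK ?mulr0// => t01; apply: xt; by split; rewrite /= in_itv.
  have Mb (q : R -> R) : continuous q -> exists2 M, 0 <= M & forall k z, Q z ->
      `|chi k z.1 * q z.1 * e z.2| <= M.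
    move=> cq; have cqe : continuous (fun z : R * R => q z.1 * e z.2) by cont.
    have [M M0 qM] := Qopen_bound cqe; exists M => // k z Qz.
    have /andP[k0 k1] := chi01 k z.1.
    by rewrite -mulrA normrM (ger0_norm k0) (le_trans _ (qM z Qz))// ler_piMl.
  have lim_q (q : R -> R) z : Q z -> chi k z.1 * q z.1 * e z.2 @[k --> \oo] --> q z.1 * e z.2.
    case: z => x t [] /=; rewrite in_itv /= => x01 _.
    have H : chi k x * q x * e t @[k --> \oo] --> 1 * q x * e t.
      by apply: cvgM; [apply: cvgM; [exact: chi1|exact: cvg_cst]|exact: cvg_cst].
    by rewrite mul1r in H.
  have lim1 : \int[leb2]_(z in Q) (g z * (pk k z.1 * e z.2)) @[k --> \oo] -->
      \int[leb2]_(z in Q) (g z * (p z.1 * e z.2)).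
    have [M M0 pM] := Mb p cp.
    apply: (@Qint_cvg _ (fun k z => pk k z.1 * e z.2) _ M) => //.
    - by move=> k; rewrite /pk; cont.
    - exact: lim_q.
  have lim2 : \int[leb2]_(z in Q) (y z * (chi k z.1 * p' z.1 * e z.2)) @[k --> \oo] -->
      \int[leb2]_(z in Q) (y z * (p' z.1 * e z.2)).
    have [M M0 pM] := Mb p' cp'.
    apply: (@Qint_cvg _ (fun k z => chi k z.1 * p' z.1 * e z.2) _ M) => //.
    - by move=> k; cont.
    - exact: lim_q.
  (* By Fubini the term containing [chi' k] becomes an integral in x of [p * W * chi' k], and its
     limit is p(0) W(0) - p(1) W(1). *)
  pose W x := \int[leb]_(t in `]0, T[) (y (x, t) * e t).
  have cW : continuous W.
    by apply: (@continuous_Rint_param' R (fun z => y z * e z.2)); cont.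
  have cpW : continuous (fun x => p x * W x) by cont.
  have lim3 := chiI _ cpW.
  have split_k k : \int[leb2]_(z in Q) (g z * (pk k z.1 * e z.2)) =
      - (\int[leb]_(x in `]0, 1[) (p x * W x * chi' k x))
      - \int[leb2]_(z in Q) (y z * (chi k z.1 * p' z.1 * e z.2)).
    rewrite -[LHS]opprK -wk.
    rewrite (_ : \int[leb]_(x in _) _ = \int[leb2]_(z in Q) (y z * (chi' k z.1 * p z.1 * e z.2))); last first.
      rewrite (Qint_prod' cy (_ : continuous (fun x => chi' k x * p x)) ce); last by cont.
      by apply: eq_Rint => x _; rewrite /W; ring.
    rewrite -opprD -Qint_add; last 2 first.
    - by apply: Qint_integrable => //; cont.
    - by apply: Qint_integrable => //; cont.
    by congr (- _); apply: eq_Rint => z _; rewrite /pk'; ring.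
  have lim4 : \int[leb2]_(z in Q) (g z * (pk k z.1 * e z.2)) @[k --> \oo] -->
      - (p 0 * W 0 - p 1 * W 1) - \int[leb2]_(z in Q) (y z * (p' z.1 * e z.2)).
    under eq_fun do rewrite split_k.
    by apply: cvgB; [exact: cvgN|].
  rewrite (cvg_unique _ lim1 lim4)//; congr (_ - _).
  have cy0 := continuous_slice2 (x := 0) cy; have cy1 := continuous_slice2 (x := 1) cy.
  rewrite /W -!RintegralZl//; [|by cint..].
  rewrite opprB -RintegralB//; [|by cint..].
  by apply: eq_Rint => t _; ring.
have [th [th' [dth cth' th01 thK [th1 _]]]] := cutoff T0.
have cth k := is_derive_continuous (dth k).
have eqk k : \int[leb2]_(z in Q) (g z * (p z.1 * (th k z.2 * eta z.2))) =
    \int[leb]_(t in `]0, T[) (th k t * eta t * (y (1, t) * p 1 - y (0, t) * p 0))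
    - \int[leb2]_(z in Q) (y z * (p' z.1 * (th k z.2 * eta z.2))).
  apply: (compact_eta (fun t => th k t * eta t) (fun t => th' k t * eta t + th k t * eta' t)).
  - by move=> x; have dk := dth k; der.
  - by cont.
  - have [a [b [a0 bT abK]]] := thK k; exists a, b; split => // x /abK ->.
    by rewrite mul0r.
have lim_th (f : R -> R -> R) z : Q z ->
    f z.1 z.2 * (th k z.2 * eta z.2) @[k --> \oo] --> f z.1 z.2 * eta z.2.
  case: z => x t [_] /=; rewrite in_itv /= => t01.
  have H : f x t * (th k t * eta t) @[k --> \oo] --> f x t * (1 * eta t).
    by apply: cvgM; [exact: cvg_cst|apply: cvgM; [exact: th1|exact: cvg_cst]].
  by rewrite mul1r in H.
have bound_th (q : R -> R) : continuous q -> exists2 M, 0 <= M & forall k z, Q z ->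
    `|q z.1 * (th k z.2 * eta z.2)| <= M.
  move=> cq; have cqe : continuous (fun z : R * R => q z.1 * eta z.2) by cont.
  have [M M0 qM] := Qopen_bound cqe; exists M => // k z Qz.
  have /andP[k0 k1] := th01 k z.2.
  by rewrite mulrCA normrM (ger0_norm k0) (le_trans _ (qM z Qz))// ler_piMl.
have lim1 : \int[leb2]_(z in Q) (g z * (p z.1 * (th k z.2 * eta z.2))) @[k --> \oo] -->
    \int[leb2]_(z in Q) (g z * (p z.1 * eta z.2)).
  have [M M0 pM] := bound_th p cp.
  apply: (@Qint_cvg _ (fun k z => p z.1 * (th k z.2 * eta z.2)) _ M) => //.
  - by move=> k; cont.
  - exact: (lim_th (fun x _ => p x)).
have lim2 : \int[leb2]_(z in Q) (y z * (p' z.1 * (th k z.2 * eta z.2))) @[k --> \oo] -->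
    \int[leb2]_(z in Q) (y z * (p' z.1 * eta z.2)).
  have [M M0 pM] := bound_th p' cp'.
  apply: (@Qint_cvg _ (fun k z => p' z.1 * (th k z.2 * eta z.2)) _ M) => //.
  - by move=> k; cont.
  - exact: (lim_th (fun x _ => p' x)).
have lim3 : \int[leb]_(t in `]0, T[) (th k t * eta t * (y (1, t) * p 1 - y (0, t) * p 0))
    @[k --> \oo] --> \int[leb]_(t in `]0, T[) (eta t * (y (1, t) * p 1 - y (0, t) * p 0)).
  pose F t := eta t * (y (1, t) * p 1 - y (0, t) * p 0).
  have cF : continuous F by rewrite /F; cont.
  have [M M0 FM] := continuous_itv_bounded 0 T cF.
  apply: (@Rint_cvg _ _ _ M).
  - by move=> k; cont.
  - move=> t t01.
    have H : th k t * eta t * (y (1, t) * p 1 - y (0, t) * p 0) @[k --> \oo] -->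
        1 * eta t * (y (1, t) * p 1 - y (0, t) * p 0).
      by apply: cvgM; [apply: cvgM; [exact: th1|exact: cvg_cst]|exact: cvg_cst].
    by rewrite mul1r in H.
  - move=> k t /andP[t0 tT]; have /andP[k0 k1] := th01 k t.
    rewrite -mulrA -/(F t) normrM (ger0_norm k0).
    have tT' : 0 <= t <= T by rewrite !ltW.
    by apply: le_trans (FM t tT'); rewrite ler_piMl.
have lim4 : \int[leb2]_(z in Q) (g z * (p z.1 * (th k z.2 * eta z.2))) @[k --> \oo] -->
    \int[leb]_(t in `]0, T[) (eta t * (y (1, t) * p 1 - y (0, t) * p 0))
    - \int[leb2]_(z in Q) (y z * (p' z.1 * eta z.2)).
  by under eq_fun do rewrite eqk; exact: cvgB.
exact: (cvg_unique _ lim1 lim4).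
Qed.

End cylinder_integrals.

Section weighted.
Context {R : realType} (a b : R).
Implicit Types (h psi : R -> R).

Lemma integrable_mul_continuous h psi : leb.-integrable `]a, b[ (EFin \o h) -> continuous psi ->
  leb.-integrable `]a, b[ (EFin \o (fun t => h t * psi t)).
Proof.
move=> ih cpsi; have [M _ psiM] := continuous_itv_bounded a b cpsi.
apply: (@integrable_mul_bounded _ _ _ leb `]a, b[ _ h psi M) => //.
  exact: measurable_cont.
by move=> t /=; rewrite in_itv /= => /andP[at' tb]; rewrite psiM// !ltW.
Qed.

Lemma Rint_mul_cvg h (psi_ : nat -> R -> R) psi (M : R) :
  leb.-integrable `]a, b[ (EFin \o h) -> (forall n, continuous (psi_ n)) ->
  (forall t, a < t < b -> psi_ n t @[n --> \oo] --> psi t) ->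
  (forall n t, a < t < b -> `|psi_ n t| <= M) ->
  \int[leb]_(t in `]a, b[) (h t * psi_ n t) @[n --> \oo] -->
  \int[leb]_(t in `]a, b[) (h t * psi t).
Proof.
move=> ih cpsi psit psiM.
have mh : measurable_fun `]a, b[ h by apply/measurable_EFinP; exact: measurable_int ih.
apply: (@Rintegral_dominated_cvg _ _ _ leb `]a, b[ _ (fun n t => h t * psi_ n t)
  (fun t => h t * psi t) (fun t => M * `|h t|)).
- exact: measurable_itv.
- by move=> n; apply: measurable_funM => //; exact: measurable_cont.
- by move=> t /=; rewrite in_itv /= => tab; apply: cvgM; [exact: cvg_cst|exact: psit].
- by apply: (integrableZl _ M (integrable_norm ih)).
- by move=> n t /=; rewrite in_itv /= => tab; rewrite normrM mulrC ler_wpM2r//; exact: psiM.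
Qed.
End weighted.

Section bounds.
Context {R : realType}.

Lemma Rint_cst (a b M : R) : a <= b -> \int[leb]_(x in `]a, b[) M = M * (b - a).
Proof.
move=> ab; have dM (x : R) : is_derive x 1 (fun x => M * x) M by der.
by rewrite (Rint_FTC ab dM (@cont_cst _ _ M)); ring.
Qed.

Lemma Rint_bound (f : R -> R) (a b M : R) : a <= b -> continuous f ->
  (forall x, a < x < b -> `|f x| <= M) -> `|\int[leb]_(x in `]a, b[) f x| <= M * (b - a).
Proof.
move=> ab cf fM.
apply: le_trans (le_normr_Rintegral _ (continuous_integrable _ _ cf)) _ => //.
rewrite -Rint_cst//; apply: le_Rintegral.
- exact: measurable_itv.
- by apply: continuous_integrable => x; apply: cvg_norm; exact: cf.
- exact/continuous_integrable/cont_cst.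
by move=> x /=; rewrite in_itv /=; exact: fM.
Qed.
End bounds.

(** * Exponential series *)

Section power_flat.
Context {R : realType}.

(** The gain is the factor q^K: every term |u|^k / k! with k >= K is at most q^K y^k / k!. This
    geometric smallness survives summation over the modes. *)
Lemma expR_taylor (u y q : R) K : 0 <= y -> 0 <= q <= 1 -> `|u| <= q * y ->
  `|expR u - \sum_(k < K) u ^+ k / k`!%:R| <= q ^+ K * expR y.
Proof.
move=> y0 /andP[q0 q1] uq.
have cu : series (fun n => u ^+ n / n`!%:R) N @[N --> \oo] --> expR u.
  exact: is_cvg_series_exp_coeff.
have cy : series (fun n => y ^+ n / n`!%:R) N @[N --> \oo] --> expR y.
  exact: is_cvg_series_exp_coeff.
have c1 : `|series (fun n => u ^+ n / n`!%:R) N - \sum_(k < K) u ^+ k / k`!%:R|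
    @[N --> \oo] --> `|expR u - \sum_(k < K) u ^+ k / k`!%:R|.
  by apply: cvg_norm; apply: cvgB => //; exact: cvg_cst.
have c2 : q ^+ K * series (fun n => y ^+ n / n`!%:R) N @[N --> \oo] --> q ^+ K * expR y.
  by apply: cvgM => //; exact: cvg_cst.
apply: (ler_cvg_to c1 c2); near=> N.
have KN : (K <= N)%N by near: N; exact: nbhs_infty_ge.
rewrite -(big_mkord xpredT (fun k => u ^+ k / k`!%:R)) sub_series_geq//.
rewrite (le_trans (ler_norm_sum _ _ _))// /series /= (big_cat_nat (leq0n K) KN) /=.
rewrite mulrDr -[leLHS]add0r lerD//.
  by rewrite mulr_ge0 ?exprn_ge0// sumr_ge0// => i _; rewrite divr_ge0 ?exprn_ge0.
rewrite mulr_sumr !big_nat ler_sum// => k /andP[Kk _].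
rewrite normrM normfV normr_nat mulrA ler_wpM2r ?invr_ge0// normrX.
rewrite (le_trans (lerXn2r _ _ _ uq)) ?nnegrE ?normr_ge0 ?mulr_ge0//.
rewrite exprMn ler_wpM2r ?exprn_ge0//.
by rewrite -(subnK Kk) exprD ler_piMl ?exprn_ge0// exprn_ile1.
Unshelve. all: by end_near. Qed.

(** An identity theorem phrased through remainder bounds instead of a convergent power series. At
    zeros s close to 0 the first nonzero coefficient would be O(|s|); once all coefficients vanish,
    the remainder bound at |s| <= r / 2 tends to 0 as K grows. *)
Lemma power_flat (f : R -> R) (b : nat -> R) (D r : R) : 0 < r ->
  (forall K s, `|s| <= r -> `|f s - \sum_(k < K.+1) b k * s ^+ k| <= D * (`|s| / r) ^+ K.+1) ->
  (forall e, 0 < e -> exists s, [/\ s != 0, `|s| < e & f s = 0]) ->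
  forall s, `|s| <= r / 2 -> f s = 0.
Proof.
move=> r0 fD acc.
have D0 : 0 <= D.
  have := fD 0%N r; rewrite gtr0_norm// lexx divff ?gt_eqF// expr1n mulr1 => /(_ isT).
  exact: le_trans.
have b0 k : b k = 0.
  elim/ltn_ind: k => k IH; apply/eqP; rewrite -normr_eq0 eq_le normr_ge0 andbT.
  apply/ler_addgt0Pr => e e0; rewrite add0r.
  (* Chosen so that D |s| / r^(k+1) <= e whenever |s| < [del]; D + 1 avoids a division by zero. *)
  pose del := Num.min r (e * r ^+ k.+1 / (D + 1)).
  have D1 : 0 < D + 1 by lra.
  have del0 : 0 < del by rewrite lt_min r0 divr_gt0// mulr_gt0// exprn_gt0.
  have [s [sN0 sdel fs]] := acc _ del0.
  have sr : `|s| <= r by rewrite ltW// (lt_le_trans sdel)// ge_min lexx.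
  have se : `|s| < e * r ^+ k.+1 / (D + 1) by rewrite (lt_le_trans sdel)// ge_min lexx orbT.
  have := fD k s sr; rewrite fs big_ord_recr /= big1 ?add0r; last first.
    by move=> i _; rewrite IH ?mul0r.
  rewrite normrN normrM normrX => H.
  have sp : 0 < `|s| by rewrite normr_gt0.
  have rp : 0 < r ^+ k.+1 by rewrite exprn_gt0.
  have : `|b k| <= D * `|s| / r ^+ k.+1.
    rewrite -(ler_pM2r (exprn_gt0 k sp)) (le_trans H)// expr_div_n exprS.
    by rewrite le_eqVlt; apply/orP; left; apply/eqP; ring.
  move/le_trans; apply; rewrite ler_pdivrMr//.
  move: se; rewrite ltr_pdivlMr// => se; apply: le_trans (ltW se).
  by rewrite mulrC ler_wpM2l ?normr_ge0//; lra.
move=> s sr; apply/eqP; rewrite -normr_eq0 eq_le normr_ge0 andbT.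
have q2 : `|s| / r <= 2^-1 by rewrite ler_pdivrMr// mulrC.
have bound K : `|f s| <= D * 2^-1 ^+ K.+1.
  have := fD K s; rewrite (le_trans sr) ?ler_pdivrMr ?ler_peMr ?(ltW r0)//; last by lra.
  move=> /(_ isT); rewrite big1 ?subr0; last by move=> k _; rewrite b0 mul0r.
  move/le_trans; apply; rewrite ler_wpM2l//.
  by rewrite lerXn2r ?nnegrE ?divr_ge0 ?invr_ge0 ?normr_ge0// ltW.
have lim : D * 2^-1 ^+ K.+1 @[K --> \oo] --> D * (0 : R).
  apply: cvgM; first exact: cvg_cst.
  rewrite (@cvg_shiftS _ (fun K => 2^-1 ^+ K : R)).
  by apply: cvg_expr; rewrite ger0_norm ?invr_ge0// invf_lt1// ltr1n.
rewrite mulr0 in lim.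
apply: (ler_cvg_to (cvg_cst `|f s|) lim); exact: nearW.
Qed.
End power_flat.

Section exp_series.
Context {R : realType} (rho a : nat -> R) (C : R) (H : R -> R) (c : R).
Hypothesis rho_gt0 : forall n, 0 < rho n.
Hypothesis rho_sum : cvgn (series (fun n => (rho n)^-1)).
Hypothesis a_le : forall n, `|a n| <= C.
Hypothesis HE : forall tau, 0 < tau ->
  series (fun n => a n * expR (- (rho n * tau))) N @[N --> \oo] --> H tau.
Hypothesis c_neq0 : c != 0.

Let C_ge0 : 0 <= C.
Proof. exact: le_trans (normr_ge0 _) (a_le 0). Qed.

Lemma exp_bound n tau : 0 < tau -> expR (- (rho n * tau)) <= tau^-1 * (rho n)^-1.
Proof. by move=> t0; rewrite -invfM mulrC expRN_le// mulr_gt0. Qed.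

Lemma exp_summable tau : 0 < tau -> cvgn (series (fun n => C * expR (- (rho n * tau)))).
Proof.
move=> t0; apply: (@is_cvg_seriesZ _ (fun n => expR (- (rho n * tau)))).
apply: (@series_le_cvg _ _ (fun n => tau^-1 * (rho n)^-1)) => [n|n|n|].
- exact: expR_ge0.
- by rewrite mulr_ge0 ?invr_ge0 ?ltW.
- exact: exp_bound.
exact: (@is_cvg_seriesZ _ (fun n => (rho n)^-1)).
Qed.

Lemma exp_coeff_le (y : R) k : 0 <= y -> y ^+ k / k`!%:R <= expR y.
Proof.
move=> y0.
have nd : {homo series (exp_coeff y) : n m / (n <= m)%N >-> n <= m}.
  by apply/nondecreasing_seqP => n; rewrite seriesSr lerDl exp_coeff_ge0.
apply: le_trans (nondecreasing_cvgn_le nd (is_cvg_series_exp_coeff y) k.+1).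
by rewrite seriesSr lerDr /series /= sumr_ge0// => i _; exact: exp_coeff_ge0.
Qed.

(* Around tau the series is a power series in s; c - H (tau + s) has zeros accumulating at s = 0,
   so all its Taylor coefficients vanish. *)
Lemma exp_series_locally_constant tau : 0 < tau ->
  (forall e, 0 < e -> exists s, [/\ s != 0, `|s| < e & H (tau + s) = c]) ->
  forall s, `|s| <= tau / 4 -> H (tau + s) = c.
Proof.
move=> t0 acc s st.
(* The weight exp(-rho tau) splits into two factors exp(-rho r): one absorbs the Taylor terms, which
   are bounded by exp(rho r), the other keeps the sum over n convergent. *)
pose r := tau / 2; have r0 : 0 < r by rewrite divr_gt0.
pose A n := a n * expR (- (rho n * tau)).
pose u k n := A n * ((- rho n) ^+ k / k`!%:R).
pose B n := C * expR (- (rho n * r)).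
have cB : cvgn (series B) := exp_summable r0.
have A_le n : `|A n| <= C * expR (- (rho n * tau)).
  by rewrite normrM (gtr0_norm (expR_gt0 _)) ler_wpM2r ?expR_ge0.
have cu k : cvgn (series (u k)).
  apply: normed_cvg; apply: (@series_le_cvg _ _ (fun n => r ^- k * B n)) => [n|n|n|].
  - exact: normr_ge0.
  - by rewrite mulr_ge0 ?mulr_ge0 ?expR_ge0// invr_ge0 exprn_ge0// ltW.
  - have p0 := ltW (rho_gt0 n); have rk : 0 < r ^+ k by rewrite exprn_gt0.
    rewrite /= /u normrM (normrM (_ ^+ k)) normfV normr_nat normrX normrN (ger0_norm p0).
    have -> : rho n ^+ k / k`!%:R = r ^- k * ((rho n * r) ^+ k / k`!%:R).
      by rewrite (exprMn k (rho n) r) (mulrC (rho n ^+ k) (r ^+ k)) -!mulrA mulKf// gt_eqF.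
    rewrite mulrCA ler_wpM2l ?invr_ge0 ?(ltW rk)//.
    apply: le_trans (ler_pM (normr_ge0 _) _ (A_le n) (exp_coeff_le k (mulr_ge0 p0 (ltW r0)))) _.
      by rewrite divr_ge0 ?exprn_ge0 ?mulr_ge0// ltW.
    rewrite /B -mulrA -expRD ler_wpM2l// ler_expR /r; lra.
  exact: (@is_cvg_seriesZ _ B).
pose b k := limn (series (u k)) - (k == 0)%:R * c.
have flat : forall s, `|s| <= r / 2 -> H (tau + s) - c = 0.
  apply: (@power_flat _ (fun s => H (tau + s) - c) b (limn (series B)) r r0); last first.
    by move=> e /acc[s' [s0 se sc]]; exists s'; split => //; rewrite sc subrr.
  move=> K {st}s sr.
  have q0 : 0 <= `|s| / r by rewrite divr_ge0// ltW.
  have ts : 0 < tau + s.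
    by have := lerNnormlW (lexx `|s|); rewrite /r in sr; lra.
  (* The Taylor remainder of the n-th summand. Only finite sums over k are ever exchanged with the
     sum over n, so no double series arises. *)
  pose w n := A n * (expR (- rho n * s) - \sum_(k < K.+1) (- rho n * s) ^+ k / k`!%:R).
  have wE N : series w N = series (fun n => a n * expR (- (rho n * (tau + s)))) N
      - \sum_(k < K.+1) series (u k) N * s ^+ k.
    elim: N => [|N IH].
      rewrite /series /= !big_geq// big1 ?subr0// => k _; by rewrite big_geq// mul0r.
    rewrite !seriesSr IH /w mulrBr.
    have -> : a N * expR (- (rho N * (tau + s))) = A N * expR (- rho N * s).
      by rewrite /A -mulrA -expRD; congr (_ * expR _); ring.
    have -> : \sum_(k < K.+1) series (u k) N.+1 * s ^+ k =
        \sum_(k < K.+1) series (u k) N * s ^+ k +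
        A N * \sum_(k < K.+1) (- rho N * s) ^+ k / k`!%:R.
      rewrite mulr_sumr -big_split /=; apply: eq_bigr => k _.
      by rewrite seriesSr /u exprMn; ring.
    ring.
  have lim1 : series w N @[N --> \oo] -->
      H (tau + s) - \sum_(k < K.+1) limn (series (u k)) * s ^+ k.
    rewrite (_ : series w = fun N => series (fun n => a n * expR (- (rho n * (tau + s)))) N
      - \sum_(k < K.+1) series (u k) N * s ^+ k); last exact/funext.
    apply: cvgB; first exact: HE.
    elim: K.+1 => [|m IH].
      by under eq_fun do rewrite big_ord0; rewrite big_ord0; exact: cvg_cst.
    under eq_fun do rewrite big_ord_recr /=; rewrite big_ord_recr /=.
    by apply: cvgD => //; apply: cvgM; [exact: cu|exact: cvg_cst].
  have -> : H (tau + s) - c - \sum_(k < K.+1) b k * s ^+ k =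
      H (tau + s) - \sum_(k < K.+1) limn (series (u k)) * s ^+ k.
    rewrite !big_ord_recl /b /= mul1r expr0 !mulr1.
    rewrite (eq_bigr (fun i : 'I_K => limn (series (u (lift ord0 i))) * s ^+ lift ord0 i)).
      ring.
    by move=> k _; rewrite mul0r subr0.
  have lim2 : (`|s| / r) ^+ K.+1 * series B N @[N --> \oo] --> (`|s| / r) ^+ K.+1 * limn (series B).
    by apply: cvgM => //; exact: cvg_cst.
  rewrite mulrC; apply: (ler_cvg_to (cvg_norm lim1) lim2); apply: nearW => N.
  rewrite (le_trans (ler_norm_sum _ _ _))// /series /= mulr_sumr ler_sum// => n _.
  have p0 := ltW (rho_gt0 n).
  have T := @expR_taylor _ (- rho n * s) (rho n * r) (`|s| / r) K.+1.
  have {}T : `|expR (- rho n * s) - \sum_(k < K.+1) (- rho n * s) ^+ k / k`!%:R| <=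
      (`|s| / r) ^+ K.+1 * expR (rho n * r).
    apply: T; first by rewrite mulr_ge0// ltW.
      by rewrite q0 ler_pdivrMr// mul1r.
    rewrite normrM normrN (ger0_norm p0) le_eqVlt; apply/orP; left; apply/eqP.
    by field; rewrite gt_eqF.
  rewrite normrM (le_trans (ler_pM _ _ (A_le n) T))//.
  rewrite mulrCA ler_wpM2l ?exprn_ge0// /B -mulrA -expRD ler_wpM2l// ler_expR /r; lra.
by apply/eqP; rewrite -subr_eq0 flat// /r; lra.
Qed.

Lemma exp_series_finite eps M : 0 < eps ->
  finite_set [set tau | eps <= tau <= M /\ H tau = c].
Proof.
move=> e0; apply: contrapT => inf.
have bnd : bounded_set [set tau | eps <= tau <= M /\ H tau = c].
  exists M; split; first exact: num_real.
  move=> M' MM' x /= [/andP[ex xM] _]; rewrite ger0_norm; last by lra.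
  lra.
have [tau0 lim0] := infinite_bounded_limit_point_nonempty inf bnd.
pose acc tau := forall e, 0 < e -> exists s, [/\ s != 0, `|s| < e & H (tau + s) = c].
have t0 : 0 < tau0.
  rewrite ltNge; apply/negP => t0.
  have [x [_ [[/andP[ex _] _]]]] := lim0 (ball tau0 eps) (nbhsx_ballx _ _ e0).
  by rewrite /ball /= ltr_norml => /andP[]; lra.
have acc0 : acc tau0.
  move=> e e1; have [x [xt [[_ Hx] bx]]] := lim0 (ball tau0 e) (nbhsx_ballx _ _ e1).
  exists (x - tau0); split; first by rewrite subr_eq0.
    by move: bx; rewrite /ball /= distrC.
  by rewrite addrC subrK.
(* A point where the series takes the value c non-discretely can be moved to the right by a
   fixed factor, while the series tends to 0 at infinity. *)
have step tau : 0 < tau -> acc tau -> acc (tau * (5 / 4)).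
  move=> tp /(exp_series_locally_constant tp) loc e e1.
  pose d := Num.min (e / 2) (tau / 4).
  have d0 : 0 < d by rewrite lt_min !divr_gt0.
  have de : d <= e / 2 by rewrite ge_min lexx.
  have dt : d <= tau / 4 by rewrite ge_min lexx orbT.
  exists (- d); split; first by rewrite oppr_eq0 gt_eqF.
    by rewrite normrN gtr0_norm//; lra.
  have -> : tau * (5 / 4) - d = tau + (tau / 4 - d) by field.
  by apply: loc; rewrite ger0_norm; lra.
have accn n : 0 < tau0 * (5 / 4) ^+ n /\ acc (tau0 * (5 / 4) ^+ n).
  elim: n => [|n [p IH]]; first by rewrite expr0 mulr1.
  rewrite exprSr (mulrA tau0); split; first by rewrite mulr_gt0//; lra.
  exact: step.
(* Bounding exp(-rho tau) by 1 / (rho tau) termwise gives |H| <= D / tau. Along tau0 (5/4)^n this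
   contradicts H = c, because the powers are unbounded by Bernoulli's inequality. *)
pose D := C * limn (series (fun n => (rho n)^-1)).
have Hle tau : 0 < tau -> `|H tau| <= D / tau.
  move=> tp.
  have lim2 : C * tau^-1 * series (fun n => (rho n)^-1) N @[N --> \oo] -->
      C * tau^-1 * limn (series (fun n => (rho n)^-1)).
    by apply: cvgM => //; exact: cvg_cst.
  have -> : D / tau = C * tau^-1 * limn (series (fun n => (rho n)^-1)) by rewrite /D; ring.
  apply: (ler_cvg_to (cvg_norm (HE tp)) lim2); apply: nearW => N.
  rewrite (le_trans (ler_norm_sum _ _ _))// /series /= mulr_sumr ler_sum// => n _.
  rewrite normrM (gtr0_norm (expR_gt0 _)) -mulrA ler_pM ?expR_ge0//.
  exact: exp_bound.
have Hc n : `|c| * (tau0 * (5 / 4) ^+ n) <= D.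
  have [p ac] := accn n.
  have := exp_series_locally_constant p ac (s := 0); rewrite normr0 divr_ge0 ?(ltW p)// addr0.
  by move=> /(_ isT) <-; rewrite -ler_pdivlMr//; exact: Hle.
have geo n : 1 + n%:R / 4 <= (5 / 4) ^+ n :> R.
  elim: n => [|n IH]; first by rewrite expr0 mul0r addr0.
  rewrite exprSr -natr1; have n0 : 0 <= n%:R :> R by []; nra.
have cp : 0 < `|c| * tau0 by rewrite mulr_gt0// normr_gt0.
pose n := (Num.truncn (4 * D / (`|c| * tau0))).+1.
have := truncnS_gt (4 * D / (`|c| * tau0)); rewrite -/n ltr_pdivrMr// => big.
have := Hc n; rewrite mulrA => le1.
have : `|c| * tau0 * (1 + n%:R / 4) <= D by rewrite (le_trans _ le1)// ler_wpM2l// ltW.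
by rewrite mulrDr mulr1; lra.
Qed.

End exp_series.

(** * Integration by parts over the cylinder with smooth test functions *)

Section Lfun_bounded.
Context {d : measure_display} {X : measurableType d} {R : realType}.

Lemma Lfun2_bounded (m : {measure set X -> \bar R}) (D : set X) (f : X -> R) (M : R) :
  measurable D -> (m D < +oo)%E -> measurable_fun D f -> (forall x, D x -> `|f x| <= M) ->
  f \_ D \in Lfun m 2%:E.
Proof.
move=> mD mDoo mf fM.
have mfD : measurable_fun setT (f \_ D) by exact/(measurable_restrictT _ mD).1.
rewrite inE; apply/andP; split; rewrite inE //=.
rewrite /finite_norm unlock; apply: poweR_lty.
rewrite (_ : (\int[m]_x _)%E = (\int[m]_(x in D) (f x ^+ 2)%:E)%E).
  apply: integrable_lty => //; apply: (@integrable_bounded _ _ _ m D _ (fun x => f x ^+ 2) (M ^+ 2)) => //.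
    exact: measurable_funX.
  by move=> x Dx; rewrite normrX lerXn2r ?nnegrE ?(le_trans _ (fM x Dx))// fM.
rewrite [RHS]integral_mkcond; apply: eq_integral => x _ /=.
rewrite powR_mulrn// real_normK ?num_real// !patchE.
by case: ifPn => //; rewrite expr0n.
Qed.
End Lfun_bounded.

Section cylinder_parts.
Context {R : realType} (T : R).
Notation Q := (Qopen T).
Hypothesis T_gt0 : 0 < T.
Implicit Types (v g : R * R -> R) (c p : R -> R).

Lemma class_C1_dx v : class_C1 v -> forall t (x : R), is_derive x 1 (fun x => v (x, t)) (dx v (x, t)).
Proof.
move=> [dvx _ _ _ _] t x; rewrite /dx derive1E; apply: DeriveDef => //.
exact: (dvx (x, t)).
Qed.

Lemma class_C1_dt v : class_C1 v -> forall x (t : R), is_derive t 1 (fun t => v (x, t)) (dt v (x, t)).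
Proof.
move=> [_ dvt _ _ _] x t; rewrite /dt derive1E; apply: DeriveDef => //.
exact: (dvt (x, t)).
Qed.

(** Here the derivative falls on the C^1 test function, so an ordinary integration by parts on each
    time slice suffices. *)
Lemma Q_parts_x v c p (p' : R -> R) : class_C1 v -> continuous c ->
  (forall x : R, is_derive x 1 p (p' x)) -> continuous p' ->
  \int[leb2]_(z in Q) (c z.2 * p z.1 * dx v z) =
  \int[leb]_(t in `]0, T[) (c t * (p 1 * v (1, t) - p 0 * v (0, t)))
  - \int[leb2]_(z in Q) (c z.2 * p' z.1 * v z).
Proof.
move=> vC1 cc dp cp'; have cp := is_derive_continuous dp.
have dvx := class_C1_dx vC1; have [_ _ cv cvx _] := vC1.
have cJ : continuous (fun t => \int[leb]_(x in `]0, 1[) (p' x * v (x, t))).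
  by apply: (@continuous_Rint_param R (fun z => p' z.1 * v z)); cont.
rewrite !fubini_tx; [|by cont..].
rewrite -RintegralB//; last 2 first.
- by cint.
- have := continuous_integrable 0 T (cont_mul cc cJ); apply: eq_integrable => // t _ /=.
  have cvt := continuous_slice1 (t := t) cv.
  rewrite -RintegralZl//; last by cint.
  by congr (_%:E); apply: eq_Rint => x _; ring.
apply: eq_Rint => t _ /=.
have E : \int[leb]_(x in `]0, 1[) (p x * dx v (x, t)) =
    p 1 * v (1, t) - p 0 * v (0, t) - \int[leb]_(x in `]0, 1[) (p' x * v (x, t)).
  by apply: (Rint_parts ler01 dp (dvx t)); cont.
rewrite (@eq_Rint _ _ _ leb `]0, 1[ _ (fun x => c t * (p x * dx v (x, t)))); last by move=> x _; ring.
rewrite RintegralZl ?E//; last by cint.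
rewrite (@eq_Rint _ _ _ leb `]0, 1[ (fun x => c t * p' x * v (x, t))
  (fun x => c t * (p' x * v (x, t)))); last by move=> x _; ring.
rewrite RintegralZl//; last by cint.
ring.
Qed.

(** Both boundary terms in time drop out: [c] vanishes at 0 and the test function at [T]. *)
Lemma Q_parts_t v c (c' : R -> R) p : class_C1 v -> continuous p ->
  (forall t : R, is_derive t 1 c (c' t)) -> continuous c' -> c 0 = 0 ->
  (forall x, 0 <= x <= 1 -> v (x, T) = 0) ->
  \int[leb2]_(z in Q) (c z.2 * p z.1 * dt v z) =
  - (\int[leb2]_(z in Q) (c' z.2 * p z.1 * v z)).
Proof.
move=> vC1 cp dc cc' c0 vT; have cc := is_derive_continuous dc.
have dvt := class_C1_dt vC1; have [_ _ cv _ cvt] := vC1.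
rewrite !fubini_xt; [|by cont..].
rewrite -mulN1r -RintegralZl//; last first.
  apply: continuous_integrable.
  by apply: (@continuous_Rint_param' R (fun z => c' z.2 * p z.1 * v z)); cont.
apply: eq_Rint => x /=; rewrite in_itv /= => /andP[x0 x1].
have E : \int[leb]_(t in `]0, T[) (c t * dt v (x, t)) =
    c T * v (x, T) - c 0 * v (x, 0) - \int[leb]_(t in `]0, T[) (c' t * v (x, t)).
  by apply: (Rint_parts (ltW T_gt0) dc (dvt x)); cont.
rewrite vT ?(ltW x0) ?(ltW x1)// c0 mulr0 mul0r !sub0r in E.
rewrite (@eq_Rint _ _ _ leb `]0, T[ _ (fun t => p x * (c t * dt v (x, t)))); last by move=> t _; ring.
rewrite RintegralZl ?E//; last by cint.
rewrite (@eq_Rint _ _ _ leb `]0, T[ (fun t => c' t * p x * v (x, t))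
  (fun t => p x * (c' t * v (x, t)))); last by move=> t _; ring.
rewrite RintegralZl//; last by cint.
ring.
Qed.

Lemma Lfun2_Qopen g : continuous g -> g \_ Q \in Lfun leb2 2%:E.
Proof.
move=> cg; have [M M0 gM] := Qopen_bound T cg.
apply: (@Lfun2_bounded _ _ _ leb2 Q g M) => //.
- exact: Qopen_measurable.
- exact: Qopen_finite.
- exact: measurable_cont2.
Qed.

End cylinder_parts.

(** * Minimizers of the linearized cost *)

Section clamp_blowup.
Context {R : realType}.

Lemma clamp_le0 (B x : R) : 0 <= B -> x <= 0 -> clamp 0 B x = 0.
Proof. by move=> B0 x0; rewrite /clamp max_l// ge_min x0 orbT. Qed.

Lemma clamp_ge (B x : R) : 0 <= B -> B <= x -> clamp 0 B x = B.
Proof. by move=> B0 Bx; rewrite /clamp min_l// max_r. Qed.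

Lemma clamp_blowup (B x : R) : 0 <= B ->
  clamp 0 B (k.+1%:R * x) @[k --> \oo] --> (if 0 < x then B else 0).
Proof.
move=> B0; apply: cvg_near_cst; case: ltrP => x0; last first.
  by apply: nearW => k; rewrite clamp_le0// pmulr_rle0.
near=> k; rewrite clamp_ge// -ler_pdivrMr//.
have kB : B / x <= k%:R by near: k; exact: nbhs_infty_ger.
by rewrite (le_trans kB)// ler_nat.
Unshelve. all: by end_near. Qed.
End clamp_blowup.

Section bang.
Context {R : realType} (T mu a b : R) (f u : R -> R).
Hypothesis T_gt0 : 0 < T.
Hypothesis mu_gt0 : 0 < mu.
Hypothesis a_lt0 : a < 0.
Hypothesis b_gt0 : 0 < b.
Hypothesis cf : continuous f.
Hypothesis iu : leb.-integrable `]0, T[ (EFin \o u).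
Hypothesis u_ab : {ae leb, forall t, t \in `[0, T] -> a <= u t <= b}.

Definition linear_cost (w : R -> R) := \int[leb]_(t in `]0, T[) (f t * w t + mu * `|w t|).

Hypothesis u_min : forall w q : R -> R, continuous q -> (forall t : R, is_derive t 1 w (q t)) ->
  w 0 = 0 -> (forall t, a <= w t <= b) -> linear_cost u <= linear_cost w.

Lemma linear_cost_cvg (w_ : nat -> R -> R) (w : R -> R) :
  (forall n, continuous (w_ n)) -> (forall n t, a <= w_ n t <= b) ->
  (forall t, 0 < t < T -> w_ n t @[n --> \oo] --> w t) ->
  linear_cost (w_ n) @[n --> \oo] --> linear_cost w.
Proof.
move=> cw wab ww; have [M M0 fM] := continuous_itv_bounded 0 T cf.
apply: (@Rint_cvg _ 0 T (M * (b - a) + mu * (b - a)) (fun n t => f t * w_ n t + mu * `|w_ n t|)).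
- move=> n.
  have cN : continuous (fun t => `|w_ n t|) by move=> t; apply: cvg_norm; exact: (cw n).
  by cont.
- move=> t tT; apply: cvgD; apply: cvgM; [exact: cvg_cst|exact: ww|exact: cvg_cst|].
  by apply: cvg_norm; exact: ww.
move=> n t /andP[t0 tT]; have /andP[wa wb] := wab n t.
have a0 := a_lt0; have b0 := b_gt0; have wM : `|w_ n t| <= b - a by rewrite ler_norml; lra.
apply: le_trans (ler_normD _ _) _; apply: lerD; rewrite normrM.
  by apply: ler_pM => //; rewrite fM// !ltW.
by rewrite normr_id gtr0_norm// ler_pM2l.
Qed.

Lemma min_continuous (w : R -> R) : continuous w -> (forall t, t <= 0 -> w t = 0) ->
  (forall t, a <= w t <= b) -> linear_cost u <= linear_cost w.
Proof.
move=> cw w0 wab; have [P dP P0] := continuous_primitive cw.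
(* The averages of w over [t - h, t] are C^1, admissible and vanish at 0. *)
pose h k : R := harmonic k; pose W k (t : R) := k.+1%:R * (P t - P (t - h k)).
have h0 k : 0 < h k by rewrite invr_gt0.
have dP' c (t : R) : is_derive t 1 (fun t => P (t - c)) (w (t - c)).
  have ds : is_derive t 1 (fun t : R => t - c) 1 by der.
  have := @is_derive1_comp R P (fun t : R => t - c) t _ _ (dP (t - c)) ds.
  by rewrite mulr1.
have dW k (t : R) : is_derive t 1 (W k) (k.+1%:R * (w t - w (t - h k))).
  by have d1 := dP t; have d2 := dP' (h k) t; rewrite /W; der.
have cP := is_derive_continuous dP.
(* By the mean value theorem an average is a value of [w] nearby, which yields the bounds, the
   convergence, and W k 0 = 0, since [w] vanishes to the left of 0. *)
have WE k t : exists2 c, t - h k < c < t & W k t = w c.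
  have ht : t - h k < t by rewrite ltrBlDr ltrDl.
  have [c] := MVT ht (fun x _ => dP x) (continuous_subspaceT cP).
  rewrite in_itv /= => ct E; exists c => //; rewrite /W E.
  by rewrite opprB addrCA subrr addr0 mulrCA mulfV ?mulr1.
have Wab k t : a <= W k t <= b by have [c _ ->] := WE k t; exact: wab.
have cW k : continuous (W k) := is_derive_continuous (dW k).
have Wt t : W k t @[k --> \oo] --> w t.
  apply/cvgrPdist_lt => e e0; have /cvgrPdist_lt/(_ e e0) := cw t.
  move=> /nbhs_ballP[r /= r0 wr].
  have := @cvg_harmonic R => /cvgrPdist_lt/(_ r r0); apply: filterS => k.
  rewrite sub0r normrN gtr0_norm// => hr; have [c /andP[c1 c2] ->] := WE k t.
  apply: wr; rewrite /ball /= ltr_norml.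
  by have : h k < r by []; move: c1 c2; lra.
have := linear_cost_cvg cW Wab (fun t _ => Wt t).
move=> /(ler_cvg_to (cvg_cst (linear_cost u))); apply; apply: nearW => k.
apply: (u_min _ (dW k)) => //.
  have cwc : continuous (fun t => w (t - h k)) by cont.
  by cont.
by have [c /andP[_ c0] ->] := WE k 0; rewrite w0// ltW.
Qed.

(** A difference of two one-sided jumps, the form in which it arises as a limit of clamped
    multiples. Since mu > 0 the conditions exclude each other; where |f| = mu the value is 0. *)
Definition bang t := (if 0 < - mu - f t then b else 0) - (if 0 < f t - mu then - a else 0).

Lemma min_bang : linear_cost u <= linear_cost bang.
Proof.
(* The first factor makes [w k] vanish for t <= 0 and tends to 1 for t > 0. As it lies in [0, 1],
   the bounds a and b are preserved. *)
pose w k t := clamp 0 1 (k.+1%:R * t) *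
  (clamp 0 b (k.+1%:R * (- mu - f t)) - clamp 0 (- a) (k.+1%:R * (f t - mu))).
have a0 := a_lt0; have b0 := b_gt0; have na0 : 0 <= - a by lra.
have cw k : continuous (w k).
  have c1 := @clamp_continuous R 0 1; have c2 := @clamp_continuous R 0 b.
  have c3 := @clamp_continuous R 0 (- a).
  by rewrite /w; cont.
have wab k t : a <= w k t <= b.
  rewrite /w.
  have /andP[p0 p1] := clamp_itv (k.+1%:R * t) (ler01 : 0 <= 1 :> R).
  have /andP[q0 q1] := clamp_itv (k.+1%:R * (- mu - f t)) (ltW b_gt0).
  have /andP[r0 r1] := clamp_itv (k.+1%:R * (f t - mu)) na0.
  by apply/andP; split; nra.
have := @linear_cost_cvg w bang cw wab.
move=> wbang; have /wbang : forall t, 0 < t < T -> w n t @[n --> \oo] --> bang t.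
  move=> t /andP[t0 tT]; rewrite -[bang t]mul1r; apply: cvgM.
    by have := @clamp_blowup R 1 t ler01; rewrite t0.
  by apply: cvgB; apply: clamp_blowup => //; exact: ltW.
move=> /(ler_cvg_to (cvg_cst (linear_cost u))); apply; apply: nearW => k.
apply: (min_continuous (cw k)) (wab k) => t t0.
by rewrite /w clamp_le0 ?mul0r// pmulr_rle0.
Qed.

(** The function v |-> f v + mu |v| is convex with a kink at 0, with slopes f - mu and f + mu on the
    two sides. Its minimizer over [a, b] is unique unless one slope is zero. *)
Lemma bang_optimal t v : a <= v <= b ->
  f t * bang t + mu * `|bang t| <= f t * v + mu * `|v| /\
  (f t * v + mu * `|v| = f t * bang t + mu * `|bang t| -> f t <> mu -> f t <> - mu -> v = bang t).
Proof.
move=> /andP[va vb]; rewrite /bang.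
have mu0 := mu_gt0; have a0 := a_lt0; have b0 := b_gt0.
case: ltrP => f1; case: ltrP => f2.
- lra.
- rewrite subr0 (gtr0_norm b_gt0); have [v0|v0] := ler0P v.
    have : 0 < (- mu - f t) * b by rewrite mulr_gt0.
    have : 0 <= (f t - mu) * v by rewrite mulr_le0.
    split; lra.
  have : 0 <= (- mu - f t) * (b - v) by rewrite mulr_ge0 ?(ltW f1)// subr_ge0.
  split; first lra.
  move=> E _ _; have /eqP : (- mu - f t) * (b - v) = 0 by lra.
  by rewrite mulf_eq0 gt_eqF//= subr_eq0 => /eqP.
- rewrite sub0r opprK (ltr0_norm a_lt0); have [v0|v0] := ler0P v.
    have : 0 <= (f t - mu) * (v - a) by rewrite mulr_ge0 ?(ltW f2)// subr_ge0.
    split; first lra.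
    move=> E _ _; have /eqP : (f t - mu) * (v - a) = 0 by lra.
    by rewrite mulf_eq0 gt_eqF//= subr_eq0 => /eqP.
  have : (f t - mu) * a < 0 by rewrite pmulr_rlt0.
  have : 0 < (f t + mu) * v by rewrite mulr_gt0//; lra.
  split; lra.
- rewrite subr0 normr0 !mulr0 addr0; have [v0|v0] := ler0P v.
    have : 0 <= (f t - mu) * v by rewrite mulr_le0.
    split; first lra.
    move=> E ne _; have /eqP : (f t - mu) * v = 0 by lra.
    by rewrite mulf_eq0 subr_eq0 => /orP[/eqP|/eqP].
  have : 0 <= (f t + mu) * v by rewrite mulr_ge0 ?(ltW v0)//; lra.
  split; first lra.
  move=> E _ ne; have /eqP : (f t + mu) * v = 0 by lra.
  by rewrite mulf_eq0 addr_eq0 => /orP[/eqP|/eqP].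
Qed.

Lemma bang_integrable : leb.-integrable `]0, T[ (EFin \o (fun t => f t * bang t + mu * `|bang t|)).
Proof.
have mf : measurable_fun setT f by exact: measurable_cont.
have mb : measurable_fun `]0, T[ bang.
  apply: measurable_funTS; apply: measurable_funB; apply: measurable_fun_ifT => //.
    apply: measurable_fun_ltr => //; apply: measurable_funB => //.
  by apply: measurable_fun_ltr => //; apply: measurable_funB.
have [M M0 fM] := continuous_itv_bounded 0 T cf.
apply: (@integrable_bounded _ _ _ leb `]0, T[ _ _ (M * (b - a) + mu * (b - a))).
- exact: measurable_itv.
- exact: itvoo_finite.
- apply: measurable_funD; apply: measurable_funM => //; first exact: measurable_funTS.
  exact: measurableT_comp.
move=> t /=; rewrite in_itv /= => /andP[t0 tT].
have bM : `|bang t| <= b - a.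
  have a0 := a_lt0; have b0 := b_gt0; rewrite ler_norml /bang.
  by case: ifP => _; case: ifP => _; lra.
apply: le_trans (ler_normD _ _) _; apply: lerD; rewrite normrM.
  by apply: ler_pM => //; rewrite fM// !ltW.
by rewrite normr_id gtr0_norm// ler_pM2l.
Qed.

(** The difference of the two integrands is nonnegative almost everywhere and has integral at most
    0, hence vanishes almost everywhere; uniqueness of the pointwise minimizer does the rest. *)
Lemma bang_bang : {ae leb, forall t, t \in `]0, T[ -> f t <> mu -> f t <> - mu -> u t = bang t}.
Proof.
pose G t := f t * u t + mu * `|u t|; pose B t := f t * bang t + mu * `|bang t|.
have iG : leb.-integrable `]0, T[ (EFin \o G).
  apply: (@integrableD _ _ _ leb _ _ (EFin \o (fun t => f t * u t)) (EFin \o (fun t => mu * `|u t|))) => //.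
    rewrite (_ : _ \o _ = EFin \o (fun t => u t * f t)); first exact: integrable_mul_continuous.
    by apply/funext => t /=; rewrite mulrC.
  apply: (@integrableZl _ _ _ leb _ _ _ (EFin \o (fun t => `|u t|))) => //.
  exact: integrable_norm.
have iB := bang_integrable.
have iGB : leb.-integrable `]0, T[ (EFin \o (fun t => G t - B t)).
  exact: (@integrableB _ _ _ leb _ _ (EFin \o G) (EFin \o B)).
have mGB : measurable_fun `]0, T[ (EFin \o (fun t => G t - B t)) by exact: measurable_int iGB.
have GB : {ae leb, forall t, `]0, T[%classic t -> B t <= G t}.
  apply: (@filterS _ _ (ae_filter_ringOfSetsType leb) _ _ _ u_ab) => t uab.
  rewrite /= in_itv /= => /andP[t0 tT].
  by apply: (bang_optimal t _).1; apply: uab; rewrite in_itv /= !ltW.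
pose h := EFin \o (fun t : R => G t - B t).
have abs0 : (\int[leb]_(t in `]0%R, T[) `|h t| = 0)%E.
  apply/eqP; rewrite eq_le integral_ge0// andbT.
  rewrite (@ae_eq_integral _ _ _ leb `]0, T[ (EFin \o (fun t => G t - B t)))//; first last.
  - apply: (@filterS _ _ (ae_filter_ringOfSetsType leb) _ _ _ GB) => t BG /BG BGt /=.
    by rewrite ger0_norm// subr_ge0.
  - exact: measurableT_comp.
  have /fineK <- : (\int[leb]_(t in `]0%R, T[) h t)%E \is a fin_num.
    exact: integrable_fin_num.
  rewrite lee_fin.
  have := min_bang; rewrite /linear_cost -subr_le0 -RintegralB//.
have mD : measurable `]0%R, T[%classic by exact: measurable_itv.
have /(ae_eq_integral_abs leb mD mGB) ae0 := abs0.
 apply: (@filterS2 _ _ (ae_filter_ringOfSetsType leb) _ _ _ _ u_ab ae0) => t uab + tT.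
move: tT; rewrite in_itv /= => /andP[t0 tT] /(_ _)/[!in_itv]/=.
rewrite t0 tT => /(_ isT) [E] fmu fmu'.
have uab' : a <= u t <= b by apply: uab; rewrite in_itv /= !ltW.
by apply: (bang_optimal t uab').2 => //; rewrite /G /B in E; lra.
Qed.
End bang.

(** * Sign changes and switching points *)

Section sign_change.
Context {R : realType}.
Implicit Types (g : R -> R).

Lemma near_neg g x : continuous g -> g x < 0 ->
  exists2 r, 0 < r & forall y, `|x - y| < r -> g y < 0.
Proof.
move=> cg gx; have /nbhs_ballP[r /= r0 gr] : \forall y \near x, g y < 0.
  by have := cg x => /cvgr_lt; exact.
by exists r.
Qed.

Lemma near_pos g x : continuous g -> 0 < g x ->
  exists2 r, 0 < r & forall y, `|x - y| < r -> 0 < g y.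
Proof.
move=> cg gx; have cg' : continuous (fun y => - g y) by cont.
have [|r r0 gr] := near_neg (x := x) cg'; first by rewrite oppr_lt0.
by exists r => // y /gr; rewrite oppr_lt0.
Qed.

(** A zero from the intermediate value theorem is not enough, because strict signs are required
    arbitrarily close. The supremum of the points with [g] negative has negative values accumulating
    from the left; to its right g >= 0, and [gne] provides strictly positive values. *)
Lemma sign_change_up g p q : continuous g -> p < q -> g p < 0 -> 0 < g q ->
  (forall x y, p <= x -> x < y -> y <= q -> exists2 z, x < z < y & g z <> 0) ->
  exists2 x, p < x < q & forall r, 0 < r -> exists s s',
    [/\ p <= s < x, x < s' <= q, x - r < s, s' < x + r & g s < 0 < g s'].
Proof.
move=> cg pq gp gq gne; pose E := [set r | p <= r <= q /\ g r < 0].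
have Ep : E p by split=> //; rewrite lexx ltW.
have supE : has_sup E.
  by split; [exists p|exists q => r [/andP[]]].
have xge r : E r -> r <= sup E by move=> Er; exact: sup_upper_bound.
set x := sup E in xge *.
have px : p <= x := xge _ Ep.
have xq : x < q.
  have [r r0 gr] := near_pos cg gq.
  have xq' : x <= q by apply: ge_sup; [exists p|move=> y [/andP[]]].
  rewrite lt_neqAle xq' andbT; apply/eqP => xE.
  have [s [/andP[ps sq] gs]] := sup_adherent r0 supE; rewrite -/x xE => rs.
  have : 0 < g s by apply: gr; rewrite ltr_norml; lra.
  lra.
have gx : 0 <= g x.
  rewrite leNgt; apply/negP => gx; have [r r0 gr] := near_neg cg gx.
  pose y := x + Num.min (r / 2) ((q - x) / 2).
  have m0 : 0 < Num.min (r / 2) ((q - x) / 2) by rewrite lt_min; apply/andP; split; lra.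
  have m1 : Num.min (r / 2) ((q - x) / 2) <= r / 2 by rewrite ge_min lexx.
  have m2 : Num.min (r / 2) ((q - x) / 2) <= (q - x) / 2 by rewrite ge_min lexx orbT.
  have : E y.
    by split; [rewrite /y; lra|apply: gr; rewrite /y ltr_norml; lra].
  by move/xge; rewrite /y; lra.
have ltx s : E s -> s < x.
  move=> Es; rewrite lt_neqAle xge// andbT; apply/eqP => sx.
  by have := Es.2; rewrite sx; lra.
exists x; first by rewrite ltx.
move=> r r0; have [s Es rs] := sup_adherent r0 supE.
have xm : x < Num.min (x + r) q by rewrite lt_min xq andbT; lra.
have mq : Num.min (x + r) q <= q by rewrite ge_min lexx orbT.
have [z /andP[xz zy] gz] := gne _ _ px xm mq.
have [zr zq] : z < x + r /\ z < q by move: zy; rewrite lt_min => /andP[].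
exists s, z; split => //.
- by rewrite (ltx _ Es) andbT; case: Es => /andP[].
- by rewrite xz ltW.
- rewrite Es.2 /= lt_neqAle eq_sym; apply/andP; split; first exact/eqP.
  rewrite leNgt; apply/negP => gz0; have /ltx : E z; last by lra.
  by split=> //; lra.
Qed.

Lemma sign_change g p q : continuous g -> p < q -> g p * g q < 0 ->
  (forall x y, p <= x -> x < y -> y <= q -> exists2 z, x < z < y & g z <> 0) ->
  exists2 x, p < x < q & forall r, 0 < r -> exists s s',
    [/\ p <= s < x, x < s' <= q, x - r < s, s' < x + r & g s * g s' < 0].
Proof.
move=> cg pq gpq gne; have [gp0|gp0|gp0] := ltgtP (g p) 0.
- have gq : 0 < g q by move: gpq; rewrite nmulr_rlt0.
  have [x xpq H] := sign_change_up cg pq gp0 gq gne.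
  exists x => // r r0; have [s [s' [? ? ? ? /andP[gs gs']]]] := H r r0.
  by exists s, s'; split => //; rewrite nmulr_rlt0.
- have gq : g q < 0 by move: gpq; rewrite pmulr_rlt0.
  have cg' : continuous (fun y => - g y) by cont.
  have [| | |x xpq H] := sign_change_up cg' pq; [by rewrite oppr_lt0|by rewrite oppr_gt0| |].
    by move=> x y px xy yq; have [z xzy gz] := gne x y px xy yq; exists z => //; move/eqP; rewrite oppr_eq0 => /eqP.
  exists x => // r r0; have [s [s' [? ? ? ? /andP[gs gs']]]] := H r r0.
  exists s, s'; split => //; rewrite oppr_lt0 in gs; rewrite oppr_gt0 in gs'.
  by rewrite pmulr_rlt0.
- by move: gpq; rewrite gp0 mul0r ltxx.
Qed.

Lemma changes_sign_zero T g t : continuous g -> changes_sign T g t -> g t = 0.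
Proof.
move=> cg ch; apply/eqP/negPn/negP => gt.
(* Multiplying by the nonzero value [g t] treats both signs at once. *)
have cg' : continuous (fun s => g s * g t) by cont.
have gg : 0 < g t * g t by rewrite -expr2 lt_neqAle sqr_ge0 eq_sym sqrf_eq0 gt.
have [r r0 gr] := near_pos (x := t) cg' gg.
have [s [s' [_ _ /andP[s1 s2] /andP[s3 s4] neg]]] := ch r r0.
have : 0 < (g s * g t) * (g s' * g t).
  by rewrite mulr_gt0//; apply: gr; rewrite ltr_norml; lra.
rewrite (_ : _ * _ = (g s * g s') * (g t * g t)); last by ring.
by rewrite pmulr_lgt0//; lra.
Qed.
End sign_change.

Section ae_interval.
Context {R : realType}.

Lemma ae_imply (P P' : R -> Prop) : {ae leb, forall t, P t} -> (forall t, P t -> P' t) ->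
  {ae leb, forall t, P' t}.
Proof. by move=> aeP PP'; apply: (@filterS _ _ (ae_filter_ringOfSetsType leb) _ _ _ aeP). Qed.

Lemma ae_itv_false (p q : R) : p < q -> ~ {ae leb, forall t, t \in `]p, q[ -> False}.
Proof.
move=> pq H; have : leb `]p, q[%classic = 0%E.
  apply: measure_negligible; first exact: measurable_itv.
  by apply: negligibleS H => t pqt; apply.
by rewrite lebesgue_measure_itv /= lte_fin pq -EFinB => /eqP; rewrite eqe subr_eq0 gt_eqF.
Qed.

Lemma countable_ae (A : set R) : countable A -> {ae leb, forall t, ~ A t}.
Proof.
move=> cA; have mA : leb.-negligible A.
  exists A; split => //; first exact: countable_measurable.
  exact: countable_lebesgue_measure0.
by apply: negligibleS mA => t /contrapT.
Qed.

Lemma itv_not_countable (p q : R) (A : set R) : p < q -> countable A ->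
  exists2 z, p < z < q & ~ A z.
Proof.
move=> pq cA; apply: contrapT => none; apply: (@ae_itv_false p q pq).
apply: (ae_imply (countable_ae cA)) => t nA tpq.
by apply: none; exists t => //; rewrite in_itv in tpq.
Qed.
End ae_interval.

Section switching.
Context {R : realType} (T mu a b : R) (f u : R -> R).
Hypothesis T_gt0 : 0 < T.
Hypothesis mu_gt0 : 0 < mu.
Hypothesis a_lt0 : a < 0.
Hypothesis b_gt0 : 0 < b.
Hypothesis cf : continuous f.
Hypothesis u_bang : {ae leb, forall t, t \in `]0, T[ -> f t <> mu -> f t <> - mu ->
  u t = bang mu a b f t}.
Hypothesis level_finite : forall c eps : R, c != 0 -> 0 < eps < T ->
  finite_set [set t : R | 0 <= t <= T - eps /\ f t = c].

(** Switching points depend on the adjoint state only through its trace, so [f] enters as a function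
    constant in x. *)
Let S := switching_points T mu (fun z => f z.2).
(** The level points of the trace. They contain all switching points and, being countable, form a
    null set that can be ignored in statements about [u]. *)
Let Z := [set t : R | 0 < t < T /\ (f t = mu \/ f t = - mu)].

Lemma critical_finite eps : 0 < eps < T -> finite_set (Z `&` `[0, T - eps]).
Proof.
move=> epsT; have m0 : mu != 0 by rewrite gt_eqF.
have m0' : - mu != 0 by rewrite oppr_eq0.
have fin : finite_set ([set t | 0 <= t <= T - eps /\ f t = mu] `|`
    [set t | 0 <= t <= T - eps /\ f t = - mu]).
  by rewrite finite_setU; split; exact: level_finite.
apply: sub_finite_set fin => t [[_ ft]]; rewrite /= in_itv /= => tT.
by case: ft; [left|right].
Qed.

Lemma critical_countable : countable Z.
Proof.
(* A null sequence that stays strictly between 0 and T, as finiteness on [0, T - e] requires. *)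
pose e k := T / 2 * harmonic k.
have h1 k : 0 < (harmonic k : R) <= 1.
  by rewrite /harmonic /= invr_gt0 ltr0n/= invf_le1// ler1n.
have eT k : 0 < e k < T.
  have T0 := T_gt0; rewrite /e; move: (h1 k); set h := harmonic k => /andP[h0 h1'].
  by apply/andP; split; nra.
apply: (@sub_countable _ _ _ (\bigcup_k (Z `&` `[0, T - e k]))); last first.
  by apply: bigcup_countable => // k _; apply: finite_set_countable; exact: critical_finite.
apply: subset_card_le => t Zt; have [/andP[t0 tT] _] := Zt.
have tT' : 0 < (T - t) / T by rewrite divr_gt0// subr_gt0.
have := @cvg_harmonic R => /cvgrPdist_lt/(_ _ tT') [k _ /(_ k (leqnn k))].
rewrite sub0r normrN; have := h1 k; set h := harmonic k => /andP[h0 _].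
rewrite gtr0_norm// ltr_pdivlMr// => hk; exists k => //; split => //.
by rewrite /= in_itv /= ltW//= /e -/h; nra.
Qed.

Lemma switching_critical : S `<=` Z.
Proof.
have c1 : continuous (fun s => f s - mu) by cont.
have c2 : continuous (fun s => f s + mu) by cont.
move=> t [tT ch]; split => //; case: ch => ch; [left|right].
  by apply/eqP; rewrite -subr_eq0; apply/eqP; exact: changes_sign_zero ch.
by apply/eqP; rewrite -addr_eq0; apply/eqP; exact: changes_sign_zero ch.
Qed.

(** Discarding the level points and the single point [T] as well gives a form that applies directly
    to intervals closed at [T]. *)
Lemma u_bang_strict : {ae leb, forall t, t \in `]0, T] ->
  [/\ t < T, f t <> mu, f t <> - mu & u t = bang mu a b f t]}.
Proof.
have aeZ := countable_ae critical_countable; have aeT := countable_ae (countable1 T).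
apply: (@filterS3 _ _ (ae_filter_ringOfSetsType leb) _ _ _ _ _ u_bang aeZ aeT) => t ub nZ nT.
rewrite in_itv /= => /andP[t0 tT].
have tT' : t < T by rewrite lt_neqAle tT andbT; exact/eqP.
have n1 : f t <> mu by move=> ft; apply: nZ; split; [rewrite t0|left].
have n2 : f t <> - mu by move=> ft; apply: nZ; split; [rewrite t0|right].
by split => //; apply: ub => //; rewrite in_itv /= t0.
Qed.

Lemma switching_finite eps : 0 < eps -> eps < T -> finite_set (S `&` `[0, T - eps]).
Proof.
move=> e0 eT; apply: sub_finite_set (critical_finite (eps := eps) _); last by rewrite e0.
by apply: setSI; exact: switching_critical.
Qed.

Lemma switching_countable : countable S.
Proof. exact: sub_countable (subset_card_le switching_critical) critical_countable. Qed.

Lemma switching_limit t : limit_point S t -> t = T.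
Proof.
move=> lim; have [tT|tT|//] := ltgtP t T; last first.
  have [|y [_ [/andP[_ yT] _] ty]] := lim (ball t (t - T)).
    by apply: nbhsx_ballx; rewrite subr_gt0.
  by move: ty; rewrite /ball /= ltr_norml; lra.
(* Then t + e <= T - e, so the e-ball around t meets only finitely many switching points. Deleting t
   from them leaves a closed set, whose complement is a neighborhood of t. *)
pose e := Num.min (T / 2) ((T - t) / 2).
have T0 := T_gt0.
have e0 : 0 < e by rewrite lt_min; apply/andP; split; lra.
have e1 : e <= T / 2 by rewrite ge_min lexx.
have e2 : e <= (T - t) / 2 by rewrite ge_min lexx orbT.
have eT : e < T by lra.
have fin := switching_finite e0 eT.
have clo : closed ((S `&` `[0, T - e]) `\ t).
  have [clf _] := @accessible_finite_set_closed R.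
  exact: clf (hausdorff_accessible (@Rhausdorff R)) _ (finite_setD _ fin).
have [|y [yt Sy [ty ny]]] := lim (ball t e `&` ~` ((S `&` `[0, T - e]) `\ t)).
  apply: filterI; first exact: nbhsx_ballx.
  by apply: open_nbhs_nbhs; split; [exact: closed_openC|move=> [_ /=]; exact].
exfalso; apply: ny; split; last exact/eqP.
split => //=; have [/andP[y0 yT] _] := Sy.
by move: ty; rewrite /ball /= ltr_norml in_itv /=; lra.
Qed.

Lemma bang_b t : f t < - mu -> bang mu a b f t = b.
Proof.
have m0 := mu_gt0; move=> ft; rewrite /bang (_ : 0 < - mu - f t); last by lra.
by rewrite (_ : 0 < f t - mu = false) ?subr0//; apply/negbTE; rewrite -leNgt; lra.
Qed.

Lemma bang_0 t : - mu < f t < mu -> bang mu a b f t = 0.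
Proof.
move=> /andP[f1 f2]; rewrite /bang (_ : 0 < - mu - f t = false).
  by rewrite (_ : 0 < f t - mu = false) ?subr0//; apply/negbTE; rewrite -leNgt; lra.
by apply/negbTE; rewrite -leNgt; lra.
Qed.

Lemma bang_a t : mu < f t -> bang mu a b f t = a.
Proof.
have m0 := mu_gt0; move=> ft; rewrite /bang (_ : 0 < - mu - f t = false).
  by rewrite (_ : 0 < f t - mu) ?sub0r ?opprK//; lra.
by apply/negbTE; rewrite -leNgt; lra.
Qed.

Lemma bang_on (I : interval R) (c : R) : (forall t, t \in I -> 0 < t <= T) ->
  (forall t, t \in I -> t < T -> f t <> mu -> f t <> - mu -> bang mu a b f t = c) -> ae_eq_cst I u c.
Proof.
move=> IT Ic; apply: (ae_imply u_bang_strict) => t ub tI.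
by have [|tT n1 n2 ->] := ub; [rewrite in_itv; exact: IT|exact: Ic].
Qed.

Lemma bang_excluded (p q c : R) : 0 <= p -> p < q -> q <= T ->
  (forall t, p < t < q -> bang mu a b f t <> c) -> ~ ae_eq_cst `]p, q[ u c.
Proof.
move=> p0 pq qT ne uc; apply: (@ae_itv_false R p q pq).
apply: (@filterS2 _ _ (ae_filter_ringOfSetsType leb) _ _ _ _ u_bang_strict uc) => t ub uct tpq.
have := tpq; rewrite in_itv /= => /[dup] tpq' /andP[pt tq].
have [|_ _ _ E] := ub; first by rewrite in_itv /=; lra.
by apply: (ne t tpq'); rewrite -E uct.
Qed.

(** Two points with opposite strict signs would produce a sign change between them; finiteness of
    the zeros before [T] supplies a nonzero value in each subinterval. *)
Lemma one_signed (g : R -> R) s t : continuous g -> 0 < s -> s < t -> t < T ->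
  (forall eps, 0 < eps < T -> finite_set [set t : R | 0 <= t <= T - eps /\ g t = 0]) ->
  (forall r, s < r < t -> ~ changes_sign T g r) ->
  (forall r, s < r < t -> 0 <= g r) \/ (forall r, s < r < t -> g r <= 0).
Proof.
move=> cg s0 st tT gfin nch; apply: contrapT => /not_orP[/existsNP[p /not_implyP[pst gp]]].
move=> /existsNP[q /not_implyP[qst gq]].
move: gp gq => /negP; rewrite -ltNge => gp /negP; rewrite -ltNge => gq.
have gne p' q' x y : s < p' < t -> s < q' < t -> p' <= x -> x < y -> y <= q' ->
    exists2 z, x < z < y & g z <> 0.
  move=> /andP[sp pt] /andP[sq qt] px xy yq.
  have eT : 0 < T - q' < T by lra.
  have [z /andP[xz zy] gz] := itv_not_countable xy (finite_set_countable (gfin _ eT)).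
  by exists z; [rewrite xz|move=> gz0; apply: gz; split => //; lra].
have change p' q' : s < p' < t -> s < q' < t -> p' < q' -> g p' * g q' < 0 -> False.
  move=> pst' qst' pq gpq.
  have [x /andP[px xq] ch] := sign_change cg pq gpq (fun x y => gne p' q' x y pst' qst').
  move: pst' qst' => /andP[sp pt] /andP[sq qt].
  apply: (nch x); first by lra.
  move=> r r0; have [z [z' [/andP[pz zx] /andP[xz zq] rz zr gz]]] := ch r r0.
  by exists z, z'; split => //; rewrite ?in_itv /= ?rz ?zx ?xz ?zr//; lra.
have [pq|pq|pq] := ltgtP p q.
- by apply: (change p q) => //; rewrite nmulr_rlt0.
- by apply: (change q p) => //; rewrite pmulr_rlt0.
- by move: gp gq; rewrite pq; lra.
Qed.

(** On the gap f - mu and f + mu each keep a weak sign. Off the levels the signs are strict, and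
    their combination selects one value of [bang]. *)
Lemma switching_gap s t : S s -> S t -> s < t -> (forall r, s < r < t -> ~ S r) ->
  exists2 c, [\/ c = b, c = a | c = 0] & ae_eq_cst `]s, t[ u c.
Proof.
move=> [/andP[s0 _] _] [/andP[_ tT] _] st nS.
have m0 := mu_gt0.
have c1 : continuous (fun s => f s - mu) by cont.
have c2 : continuous (fun s => f s + mu) by cont.
have fin1 eps : 0 < eps < T -> finite_set [set t : R | 0 <= t <= T - eps /\ f t - mu = 0].
  move=> epsT; have mu_neq0 : mu != 0 by rewrite gt_eqF.
  apply: sub_finite_set (level_finite mu_neq0 epsT) => r [rT E]; split => //; lra.
have fin2 eps : 0 < eps < T -> finite_set [set t : R | 0 <= t <= T - eps /\ f t + mu = 0].
  move=> epsT; have mu_neq0 : - mu != 0 by rewrite oppr_eq0 gt_eqF.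
  apply: sub_finite_set (level_finite mu_neq0 epsT) => r [rT E]; split => //; lra.
have rT r : s < r < t -> 0 < r < T by move=> /andP[? ?]; lra.
have stT r : r \in `]s, t[ -> 0 < r <= T by rewrite in_itv /= => /andP[? ?]; lra.
have [|pos1|neg1] := one_signed c1 s0 st tT fin1.
- by move=> r rst ch; apply: (nS r rst); split; [exact: rT|left].
- exists a; first by constructor 2.
  apply: bang_on => // r; rewrite in_itv /= => rst _ n1 _; apply: bang_a.
  by rewrite lt_neqAle eq_sym; apply/andP; split; [exact/eqP|have := pos1 r rst; lra].
have [|pos2|neg2] := one_signed c2 s0 st tT fin2.
- by move=> r rst ch; apply: (nS r rst); split; [exact: rT|right].
- exists 0; first by constructor 3.
  apply: bang_on => // r; rewrite in_itv /= => rst _ n1 n2; apply: bang_0.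
  rewrite !lt_neqAle; apply/andP; split; apply/andP; split.
  + by rewrite eq_sym; exact/eqP.
  + by have := pos2 r rst; lra.
  + exact/eqP.
  + by have := neg1 r rst; lra.
- exists b; first by constructor 1.
  apply: bang_on => // r; rewrite in_itv /= => rst _ _ n2; apply: bang_b.
  by rewrite lt_neqAle; apply/andP; split; [exact/eqP|have := neg2 r rst; lra].
Qed.

Lemma near_final (P : R -> Prop) (r : R) : 0 < r -> (forall t, `|T - t| < r -> P t) ->
  exists2 delta, 0 < delta < T & forall t, T - delta < t <= T -> P t.
Proof.
have T0 := T_gt0; move=> r0 rP; exists (Num.min r (T / 2)).
  by rewrite lt_min r0 gt_min /= divr_gt0//=; apply/orP; right; lra.
move=> t /andP[]; rewrite ltrBlDl -ltrBlDr lt_min => /andP[t1 t2] tT; apply: rP.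
by rewrite ger0_norm ?subr_ge0.
Qed.

Lemma final_itv delta t : delta < T -> t \in `]T - delta, T] -> 0 < t <= T.
Proof. by move=> dT; rewrite in_itv /= => /andP[? ?]; lra. Qed.

Lemma bang_locally_constant x : f x <> mu -> f x <> - mu -> exists2 r, 0 < r &
  forall t, `|x - t| < r -> [/\ f t <> mu, f t <> - mu & bang mu a b f t = bang mu a b f x].
Proof.
move=> n1 n2; have m0 := mu_gt0.
have c1 : continuous (fun s => f s - mu) by cont.
have c2 : continuous (fun s => - mu - f s) by cont.
have [f1|f1|//] := ltgtP (f x) mu; last first.
  have [|r r0 fr] := near_pos (x := x) c1; first by lra.
  by exists r => // t /fr ft; split; [lra|lra|rewrite !bang_a//; lra].
have [f2|f2|//] := ltgtP (f x) (- mu).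
  have [|r r0 fr] := near_pos (x := x) c2; first by lra.
  by exists r => // t /fr ft; split; [lra|lra|rewrite !bang_b//; lra].
have [|r r0 fr] := near_neg (x := x) c1; first by lra.
have [|r' r'0 fr'] := near_neg (x := x) c2; first by lra.
exists (Num.min r r') => [|t]; first by rewrite lt_min r0.
by rewrite lt_min => /andP[/fr ft /fr' ft']; split; [lra|lra|rewrite !bang_0//; lra].
Qed.

Lemma final_regular : f T <> mu -> f T <> - mu -> finite_set S /\
  exists delta, [/\ 0 < delta < T,
    f T < - mu -> ae_eq_cst `]T - delta, T] u b,
    - mu < f T < mu -> ae_eq_cst `]T - delta, T] u 0
  & mu < f T -> ae_eq_cst `]T - delta, T] u a].
Proof.
move=> n1 n2; have [r r0 fr] := bang_locally_constant n1 n2.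
have [delta dT fd] := near_final r0 fr.
have /andP[d0 dT'] := dT.
split.
  apply: sub_finite_set (switching_finite d0 dT') => t St; split => //=.
  have [/andP[t0 tT] ft] := switching_critical St.
  rewrite in_itv /= ltW//= leNgt; apply/negP => td.
  have [|? ? _] := fd t; first by rewrite td ltW.
  by case: ft.
have uT : ae_eq_cst `]T - delta, T] u (bang mu a b f T).
  apply: bang_on => [t|t tT _ _ _]; first exact: final_itv.
  by have [|_ _ ->] := fd t; first by rewrite in_itv in tT.
exists delta; split => // fT; move: uT.
- by rewrite bang_b.
- by rewrite bang_0.
- by rewrite bang_a.
Qed.

(** Away from the levels [u] is almost everywhere constant near t. As c and 0 differ, at least one
    of them can then be discarded there. *)
Lemma switches_critical c t : c <> 0 -> 0 < t < T -> switches_between u c 0 t -> Z t.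
Proof.
move=> c0 /[dup] t0T /andP[t0 tT] sw; split => //; apply: contrapT => /not_orP[n1 n2].
have [r r0 fr] := bang_locally_constant n1 n2.
pose r' := Num.min r (Num.min t (T - t)).
have r'0 : 0 < r' by rewrite !lt_min r0 t0 subr_gt0.
have [r1 r2 r3] : [/\ r' <= r, r' <= t & r' <= T - t].
  by rewrite /r' !ge_min !lexx !orbT.
have ut : ae_eq_cst `]t - r', t + r'[ u (bang mu a b f t).
  apply: bang_on => s; rewrite in_itv /= => /andP[s1 s2]; first by lra.
  by move=> _ _ _; have [|_ _] := fr s; first by rewrite ltr_norml; lra.
have [nc n0] := sw r' r'0.
have [bc|bc] := eqVneq (bang mu a b f t) c.
  apply: n0; apply: (ae_imply ut) => s us sI.
  by rewrite us// bc.
apply: nc; apply: (ae_imply ut) => s us sI.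
by rewrite us//; exact/eqP.
Qed.

(** The common part of the two critical end values: near [T] the trace stays away from one of the
    levels, so only one nonzero value c remains possible. *)
Lemma final_critical c (r : R) : c <> 0 -> 0 < r ->
  (forall t, `|T - t| < r -> f t <> mu -> f t <> - mu ->
    bang mu a b f t = c \/ bang mu a b f t = 0) ->
  exists delta, [/\ 0 < delta < T,
     {ae leb, forall t, t \in `]T - delta, T] -> u t = c \/ u t = 0}
   & countable [set t | T - delta < t < T /\ switches_between u c 0 t]].
Proof.
move=> c0 r0 fr; have [delta dT fd] := near_final r0 fr.
have /andP[d0 dT'] := dT; exists delta; split => //.
  apply: (ae_imply u_bang_strict) => t ub tI.
  have [|_ n1 n2 ->] := ub; first by rewrite in_itv; exact: final_itv tI.
  by apply: fd => //; rewrite in_itv in tI.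
apply: sub_countable critical_countable; apply: subset_card_le => t [/andP[td tT] sw].
by apply: switches_critical sw => //; lra.
Qed.

Lemma final_upper : f T = mu -> exists delta, [/\ 0 < delta < T,
     {ae leb, forall t, t \in `]T - delta, T] -> u t = a \/ u t = 0}
   & countable [set t | T - delta < t < T /\ switches_between u a 0 t]].
Proof.
move=> fT; have m0 := mu_gt0.
have cg : continuous (fun s => f s + mu) by cont.
have [|r r0 fr] := near_pos (x := T) cg; first by lra.
apply: (final_critical _ r0); first by have := a_lt0; lra.
move=> t /fr ft n1 _; have [f1|f1|//] := ltgtP (f t) mu.
  by right; rewrite bang_0//; lra.
by left; exact: bang_a.
Qed.

Lemma final_lower : f T = - mu -> exists delta, [/\ 0 < delta < T,
     {ae leb, forall t, t \in `]T - delta, T] -> u t = b \/ u t = 0}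
   & countable [set t | T - delta < t < T /\ switches_between u b 0 t]].
Proof.
move=> fT; have m0 := mu_gt0.
have cg : continuous (fun s => f s - mu) by cont.
have [|r r0 fr] := near_neg (x := T) cg; first by lra.
apply: (final_critical _ r0); first by have := b_gt0; lra.
move=> t /fr ft _ n2; have [f1|f1|//] := ltgtP (f t) (- mu).
  by left; exact: bang_b.
by right; rewrite bang_0//; lra.
Qed.

(** Each one-sided neighborhood contains an interval inside (0, T) where [bang] avoids c, and such
    an interval is not a null set. *)
Lemma side_excluded c t r r1 : 0 < t < T -> 0 < r -> 0 < r1 ->
  (forall s, `|t - s| < r1 -> bang mu a b f s <> c) ->
  ~ ae_eq_cst `]t - r, t[ u c /\ ~ ae_eq_cst `]t, t + r[ u c.
Proof.
move=> /andP[t0 tT] r0 r10 ne.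
pose r' := Num.min (Num.min r r1) (Num.min t (T - t)).
have r'0 : 0 < r' by rewrite !lt_min r0 r10 t0 subr_gt0.
have [h1 h2 h3 h4] : [/\ r' <= r, r' <= r1, r' <= t & r' <= T - t].
  by rewrite /r' !ge_min !lexx !orbT.
split => uc.
  apply: (@bang_excluded (t - r') t c); [lra..| |].
    by move=> s /andP[s1 s2]; apply: ne; rewrite ltr_norml; lra.
  apply: (ae_imply uc) => s us.
  by rewrite in_itv /= => /andP[s1 s2]; apply: us; rewrite in_itv /=; lra.
apply: (@bang_excluded t (t + r') c); [lra..| |].
  by move=> s /andP[s1 s2]; apply: ne; rewrite ltr_norml; lra.
apply: (ae_imply uc) => s us.
by rewrite in_itv /= => /andP[s1 s2]; apply: us; rewrite in_itv /=; lra.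
Qed.

Lemma no_direct_switch : ~ exists t, S t /\ exists2 r, 0 < r &
  (ae_eq_cst `]t - r, t[ u a /\ ae_eq_cst `]t, t + r[ u b) \/
  (ae_eq_cst `]t - r, t[ u b /\ ae_eq_cst `]t, t + r[ u a).
Proof.
move=> [t [/switching_critical[t0T ft] [r r0 H]]].
have m0 := mu_gt0; have a0 := a_lt0; have b0 := b_gt0.
case: ft => ft.
  have cg : continuous (fun s => f s + mu) by cont.
  have [|r1 r10 fr] := near_pos (x := t) cg; first by lra.
  have [|n1 n2] := @side_excluded b t r r1 t0T r0 r10; last by case: H => -[].
  move=> s /fr fs; rewrite /bang (_ : 0 < - mu - f s = false).
    by case: ifP => _; lra.
  by apply/negbTE; rewrite -leNgt; lra.
have cg : continuous (fun s => f s - mu) by cont.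
have [|r1 r10 fr] := near_neg (x := t) cg; first by lra.
have [|n1 n2] := @side_excluded a t r r1 t0T r0 r10; last by case: H => -[].
move=> s /fr fs; rewrite /bang (_ : 0 < f s - mu = false).
  by case: ifP => _; lra.
by apply/negbTE; rewrite -leNgt; lra.
Qed.

End switching.

(** * Linearity of the control-to-state map *)

Section linear_structure.
Context {R : realType} (T alpha : R).
Notation Q := (Qopen T).
Hypothesis T_gt0 : 0 < T.
Implicit Types (y g : R * R -> R) (u w : R -> R).

Lemma Lfun2_lin d (X : measurableType d) (m : {measure set X -> \bar R}) (f g : X -> R) (c1 c2 : R) :
  f \in Lfun m 2%:E -> g \in Lfun m 2%:E -> (fun x => c1 * f x + c2 * g x) \in Lfun m 2%:E.
Proof.
have p1 : (1 <= 2%:E :> \bar R)%E by rewrite lee_fin ler1n.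
have [L0 LZ] := Lfun_submod_closed m p1; move=> Lf Lg.
have Lg2 := LZ c2 _ _ Lg L0; rewrite addr0 in Lg2.
exact: (LZ c1 _ _ Lf Lg2).
Qed.

Lemma patch_lin X (D : set X) (f g : X -> R) (c1 c2 : R) :
  (fun x => c1 * f x + c2 * g x) \_ D = (fun x => c1 * (f \_ D) x + c2 * (g \_ D) x).
Proof. by apply/funext => x; rewrite !patchE; case: ifP => // _; rewrite !mulr0 addr0. Qed.

Lemma Qopen_Qclosed z : Q z -> Qclosed T z.
Proof.
by case: z => x t [] /=; rewrite !in_itv /= => /andP[? ?] /andP[? ?]; split; rewrite /= in_itv /= !ltW.
Qed.

Lemma Qclosed1 t : 0 < t < T -> Qclosed T (1, t).
Proof. by move=> /andP[t0 tT]; split; rewrite /= in_itv /= ?ler01 ?lexx// !ltW. Qed.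

Lemma Qclosed_extension y : {within Qclosed T, continuous y} ->
  exists2 Y : R * R -> R, continuous Y & forall z, Qclosed T z -> Y z = y z.
Proof.
move=> cy; have [Y cY YE] := continuous_extension2 (ltW T_gt0) cy.
exists Y => // -[x t] [/=]; rewrite !in_itv /= => x01 tT; exact: YE.
Qed.

Lemma weak_dx_ext y y' g : (forall z, Q z -> y z = y' z) -> weak_dx_L2 T y g -> weak_dx_L2 T y' g.
Proof.
move=> yy' [g2 wg]; split => // psi psiC1 psiK; rewrite -wg//.
by apply: eq_Rint => z Qz; rewrite yy'.
Qed.

(** A state is continuous only relative to the closed cylinder. A continuous extension to the plane
    satisfies the same identities, since these see only the cylinder and the trace at x = 1. *)
Lemma state_extension u y : state T alpha u y -> exists Y g, [/\ continuous Y,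
  forall z, Qclosed T z -> Y z = y z, weak_dx_L2 T Y g &
  weak_state T alpha u Y g].
Proof.
move=> [cy [g wg weak]]; have [Y cY YE] := Qclosed_extension cy.
exists Y, g; split => //.
  by apply: weak_dx_ext wg => z /Qopen_Qclosed /YE.
move=> v vC1 vT; rewrite -weak//; congr (_ + _ * _); apply: eq_Rint.
  by move=> z /Qopen_Qclosed /YE ->.
by move=> t /=; rewrite in_itv /= => /Qclosed1 /YE ->.
Qed.

Lemma state_lin u1 u2 y1 y2 c1 c2 :
  leb.-integrable `]0, T[ (EFin \o u1) -> leb.-integrable `]0, T[ (EFin \o u2) ->
  state T alpha u1 y1 -> state T alpha u2 y2 ->
  state T alpha (fun t => c1 * u1 t + c2 * u2 t) (fun z => c1 * y1 z + c2 * y2 z).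
Proof.
move=> iu1 iu2 s1 s2.
have [Y1 [g1 [cY1 YE1 wg1 weak1]]] := state_extension s1.
have [Y2 [g2 [cY2 YE2 wg2 weak2]]] := state_extension s2.
have ig1 := Lfun2_Qopen_integrable wg1.1; have ig2 := Lfun2_Qopen_integrable wg2.1.
have cY : continuous (fun z => c1 * Y1 z + c2 * Y2 z) by cont.
have YE z : Qclosed T z -> c1 * Y1 z + c2 * Y2 z = c1 * y1 z + c2 * y2 z.
  by move=> Qz; rewrite YE1// YE2.
have lin (h h' : R * R -> R) : leb2.-integrable Q (EFin \o h) -> leb2.-integrable Q (EFin \o h') ->
    \int[leb2]_(z in Q) (c1 * h z + c2 * h' z) =
    c1 * \int[leb2]_(z in Q) h z + c2 * \int[leb2]_(z in Q) h' z.
  by move=> ? ?; rewrite Rint_lin//; exact: Qopen_measurable.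
split.
  have : {within Qclosed T, continuous (fun z => c1 * Y1 z + c2 * Y2 z)}.
    exact: continuous_subspaceT.
  apply: subspace_eq_continuous => z /set_mem Qz; exact: YE.
exists (fun z => c1 * g1 z + c2 * g2 z).
  apply: (weak_dx_ext (y := fun z => c1 * Y1 z + c2 * Y2 z)).
    by move=> z /Qopen_Qclosed /YE.
  split; first by rewrite patch_lin; apply: Lfun2_lin; [exact: wg1.1|exact: wg2.1].
  move=> psi psiC1 psiK; have [_ _ cpsi cpsix _] := psiC1.
  have e1 := wg1.2 _ psiC1 psiK; have e2 := wg2.2 _ psiC1 psiK.
  rewrite (@eq_Rint _ _ _ leb2 Q _ (fun z => c1 * (Y1 z * dx psi z) + c2 * (Y2 z * dx psi z))); last first.
    by move=> z _; ring.
  rewrite lin; [|by cint..].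
  rewrite e1 e2 (@eq_Rint _ _ _ leb2 Q (fun z => (c1 * g1 z + c2 * g2 z) * psi z)
    (fun z => c1 * (g1 z * psi z) + c2 * (g2 z * psi z))); last first.
    by move=> z _; ring.
  rewrite lin; last 2 first.
  - exact: Qint_integrable.
  - exact: Qint_integrable.
  ring.
move=> v vC1 vT; have [_ _ cv cvx cvt] := vC1.
have iL (Y g : R * R -> R) : continuous Y -> leb2.-integrable Q (EFin \o g) ->
    leb2.-integrable Q (EFin \o (fun z => - Y z * dt v z + g z * dx v z)).
  move=> cYY igg.
  apply: (@integrableD _ _ _ leb2 Q _ (fun z => (- Y z * dt v z)%:E) (fun z => (g z * dx v z)%:E)).
  - exact: Qopen_measurable.
  - by cint.
  - exact: Qint_integrable.
rewrite (@eq_Rint _ _ _ leb2 Q _ (fun z => c1 * (- Y1 z * dt v z + g1 z * dx v z)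
  + c2 * (- Y2 z * dt v z + g2 z * dx v z))); last first.
  by move=> z /Qopen_Qclosed Qz; rewrite -YE//; ring.
rewrite lin; [|exact: iL..].
rewrite (@eq_Rint _ _ _ leb `]0, T[ (fun t => (c1 * y1 (1, t) + c2 * y2 (1, t)) * v (1, t))
  (fun t => c1 * (Y1 (1, t) * v (1, t)) + c2 * (Y2 (1, t) * v (1, t)))); last first.
  by move=> t /=; rewrite in_itv /= => /Qclosed1 Qt; rewrite YE1// YE2//; ring.
rewrite (@eq_Rint _ _ _ leb `]0, T[ (fun t => (c1 * u1 t + c2 * u2 t) * v (1, t))
  (fun t => c1 * (u1 t * v (1, t)) + c2 * (u2 t * v (1, t)))); last by move=> t _; ring.
rewrite !Rint_lin//; [|first [by cint|by apply: integrable_mul_continuous => //; cont]..].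
by rewrite -weak1// -weak2//; ring.
Qed.

(** Convexity of the admissible set, which permits variations in the direction w - u. *)
Lemma Uad_lin a b u w (s : R) : 0 <= s <= 1 -> Uad T a b u -> Uad T a b w ->
  Uad T a b (fun t => (1 - s) * u t + s * w t).
Proof.
move=> /andP[s0 s1] [u2 uab] [w2 wab]; split.
  by rewrite patch_lin; exact: Lfun2_lin.
apply: (@filterS2 _ _ (ae_filter_ringOfSetsType leb) _ _ _ _ uab wab) => t uabt wabt tT.
have /andP[ua ub] := uabt tT; have /andP[wa wb] := wabt tT.
by apply/andP; split; nra.
Qed.

Lemma Uad_integrable a b u : Uad T a b u -> leb.-integrable `]0, T[ (EFin \o u).
Proof.
move=> [u2 _]; apply: (@Lfun2_integrable_on _ _ _ leb `]0, T[ u) => //; exact: itvoo_finite.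
Qed.

End linear_structure.

(** * Robin eigenfunctions *)

(** The location between n pi and n pi + pi / 2 is recorded because it yields order and growth, and
    the bound lam_n < (k + 1/2) pi for n <= k on which completeness depends. *)
Definition robin_frequencies {R : realType} (alpha : R) (lam : nat -> R) :=
  forall n, n%:R * pi < lam n < n%:R * pi + pi / 2 /\ lam n * sin (lam n) = alpha * cos (lam n).

Section heat_modes.
Context {R : realType} (alpha T : R) (lam : nat -> R).
Hypothesis alpha_gt0 : 0 < alpha.
Hypothesis T_gt0 : 0 < T.
Hypothesis lamP : robin_frequencies alpha lam.

Section robin_modes.
Implicit Types (f g : R -> R).

Lemma lam_gt0 n : 0 < lam n.
Proof.
have [/andP[+ _] _] := lamP n; apply: le_lt_trans.
by rewrite mulr_ge0// pi_ge0.
Qed.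

Lemma lam_lt n m : (n < m)%N -> lam n < lam m.
Proof.
move=> nm; have [/andP[_ ln] _] := lamP n; have [/andP[lm _] _] := lamP m.
apply: lt_trans ln (le_lt_trans _ lm).
have p0 : 0 < pi :> R := pi_gt0 R.
have : n.+1%:R * pi <= m%:R * pi :> R by rewrite ler_wpM2r// ?ler_nat// ltW.
rewrite -natr1 mulrDl mul1r; lra.
Qed.

Lemma lam_neq n m : n != m -> lam n ^+ 2 != lam m ^+ 2.
Proof.
rewrite neq_ltn => /orP[] /lam_lt nm; [rewrite lt_eqF//|rewrite gt_eqF//];
by rewrite ltr_pXn2r// nnegrE ltW// lam_gt0.
Qed.

Lemma lam_ge n : n%:R <= lam n.
Proof.
have [/andP[ln _] _] := lamP n; apply: le_trans (ltW ln).
by rewrite ler_peMr// (le_trans _ (pi_ge2 R))// ler1n.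
Qed.

Definition mode n (x : R) := cos (lam n * x).
Definition mode' n (x : R) := - (lam n * sin (lam n * x)).

Lemma mode_derive n (x : R) : is_derive x 1 (mode n) (mode' n x).
Proof. by rewrite /mode /mode'; der. Qed.

Lemma mode'_derive n (x : R) : is_derive x 1 (mode' n) (- lam n ^+ 2 * mode n x).
Proof. by rewrite /mode /mode'; der. Qed.

Lemma mode_continuous n : continuous (mode n).
Proof. by rewrite /mode; cont. Qed.

Lemma mode'_continuous n : continuous (mode' n).
Proof. by rewrite /mode'; cont. Qed.

Lemma mode_le1 n x : `|mode n x| <= 1.
Proof. by rewrite ler_norml cos_le1 cos_geN1. Qed.

Lemma mode'_le n x : `|mode' n x| <= lam n.
Proof.
rewrite normrN normrM (gtr0_norm (lam_gt0 n)) ler_piMr// ?(ltW (lam_gt0 n))//.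
by rewrite ler_norml sin_le1 sin_geN1.
Qed.

Lemma mode'0 n : mode' n 0 = 0.
Proof. by rewrite /mode' mulr0 sin0 mulr0 oppr0. Qed.

Lemma mode'1 n : mode' n 1 = - (alpha * mode n 1).
Proof. by rewrite /mode' /mode mulr1; have [_ ->] := lamP n. Qed.

Arguments mode_continuous : clear implicits.
Arguments mode'_continuous : clear implicits.
Hint Resolve mode_continuous mode'_continuous : core.

Lemma Rint_ext f g : (forall x, f x = g x) -> I01 f = I01 g.
Proof. by move=> fg; apply: eq_Rint => x _. Qed.

Lemma Rint_add f g : continuous f -> continuous g ->
  I01 (fun x => f x + g x) = I01 f + I01 g.
Proof. by move=> cf cg; rewrite RintegralD//; exact: continuous_integrable. Qed.

Lemma Rint_scale (c : R) f : continuous f -> I01 (fun x => c * f x) = c * I01 f.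
Proof. by move=> cf; rewrite RintegralZl//; exact: continuous_integrable. Qed.

(** The weak eigenvalue equation: the boundary term at 0 vanishes with [mode'], and the Robin
    condition converts the one at 1. *)
Lemma mode_weak n (F f : R -> R) : (forall x : R, is_derive x 1 F (f x)) -> continuous f ->
  I01 (fun x => f x * mode' n x) + alpha * F 1 * mode n 1 =
  lam n ^+ 2 * I01 (fun x => F x * mode n x).
Proof.
move=> dF cf; have cF := is_derive_continuous dF.
have := @Rint_parts _ f (fun x => - lam n ^+ 2 * mode n x) F (mode' n) 0 1 ler01 dF
  (mode'_derive n) cf ltac:(by cont).
rewrite mode'0 mode'1.
have -> : \int[leb]_(x in `]0, 1[) (F x * (- lam n ^+ 2 * mode n x)) =
    - lam n ^+ 2 * I01 (fun x => F x * mode n x).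
  rewrite -Rint_scale; last by cont.
  by apply: Rint_ext => x; ring.
move=> E; apply/eqP; rewrite -subr_eq0; apply/eqP; move: E => /eqP.
by rewrite -subr_eq0 => /eqP; rewrite /=; lra.
Qed.

(** The left side of the weak eigenvalue equation is symmetric in the two modes, and the squared
    frequencies differ. *)
Lemma mode_orthogonal n m : n != m -> I01 (fun x => mode n x * mode m x) = 0.
Proof.
move=> nm; have E1 := mode_weak m (mode_derive n) (mode'_continuous n).
have E2 := mode_weak n (mode_derive m) (mode'_continuous m).
have C (f g : R -> R) : I01 (fun x => f x * g x) = I01 (fun x => g x * f x).
  by apply: eq_Rint => x _; exact: mulrC.
rewrite (C (mode' m)) (C (mode m)) in E2.
have /eqP : (lam n ^+ 2 - lam m ^+ 2) * I01 (fun x => mode n x * mode m x) = 0.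
  by rewrite mulrBl -E1 -E2; ring.
by rewrite mulf_eq0 subr_eq0 (negbTE (lam_neq nm)) => /eqP.
Qed.

Definition mode_sq n := I01 (fun x => mode n x ^+ 2).

(** The integral is 1/2 + sin(lam) cos(lam) / (2 lam), and the Robin condition makes the product
    sin(lam) cos(lam) equal to lam sin(lam)^2 / alpha >= 0. *)
Lemma mode_sq_ge n : 2^-1 <= mode_sq n.
Proof.
have l0 := lam_gt0 n.
pose F x := x / 2 + sin (lam n * x) * cos (lam n * x) / (2 * lam n).
have dF (x : R) : is_derive x 1 F (mode n x ^+ 2).
  rewrite /F /mode; apply: is_derive_eq; rewrite /GRing.scale /=.
  have := cos2Dsin2 (lam n * x).
  set c := cos _; set s := sin _ => cs.
  have -> : 2^-1 = (c ^+ 2 + s ^+ 2) / 2 :> R by rewrite cs mul1r.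
  by field; rewrite gt_eqF.
rewrite /mode_sq (Rint_FTC ler01 dF); last by cont.
rewrite /F !mulr0 sin0 !mul0r addr0 subr0 mulr1 mul1r lerDl.
have [_ E] := lamP n.
have -> : cos (lam n) = lam n * sin (lam n) / alpha.
  by rewrite E mulrAC divff ?mul1r// gt_eqF.
apply: divr_ge0; last by rewrite mulr_ge0// ltW.
rewrite mulrA mulrCA -expr2.
apply: divr_ge0; last exact: ltW.
by apply: mulr_ge0; [exact: ltW|exact: sqr_ge0].
Qed.

Lemma mode_sq_gt0 n : 0 < mode_sq n.
Proof. by apply: lt_le_trans (mode_sq_ge n); rewrite invr_gt0. Qed.

(** The Robin quadratic form minus omega^2 times the squared L^2 norm, with [f] in the role of the
    derivative of [F]. *)
Definition energy (omega : R) (F f : R -> R) :=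
  I01 (fun x => f x ^+ 2) + alpha * F 1 ^+ 2 - omega ^+ 2 * I01 (fun x => F x ^+ 2).

(** By [mode_weak], L^2 orthogonality to a mode is also orthogonality for the Robin form, so no
    cross term survives. *)
Lemma energy_add (omega c : R) n (F f : R -> R) :
  (forall x : R, is_derive x 1 F (f x)) -> continuous f ->
  I01 (fun x => F x * mode n x) = 0 ->
  energy omega (fun x => F x + c * mode n x) (fun x => f x + c * mode' n x) =
  energy omega F f + c ^+ 2 * (lam n ^+ 2 - omega ^+ 2) * mode_sq n.
Proof.
move=> dF cf F0; have cF := is_derive_continuous dF.
have expand (G H : R -> R) : continuous G -> continuous H ->
    I01 (fun x => (G x + c * H x) ^+ 2) =
    I01 (fun x => G x ^+ 2) + 2 * c * I01 (fun x => G x * H x) + c ^+ 2 * I01 (fun x => H x ^+ 2).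
  move=> cG cH; rewrite -!Rint_scale; [|by cont..].
  rewrite -!Rint_add; [|by cont..].
  by apply: Rint_ext => x; ring.
rewrite /energy !expand// F0.
have E1 := mode_weak n dF cf; rewrite F0 mulr0 in E1.
have E2 := mode_weak n (mode_derive n) (mode'_continuous n).
have E3 : I01 (fun x => mode n x * mode n x) = mode_sq n by apply: Rint_ext => x; ring.
have E4 : I01 (fun x => mode' n x * mode' n x) = I01 (fun x => mode' n x ^+ 2).
  by apply: Rint_ext => x; ring.
rewrite E3 E4 in E2; rewrite -/(mode_sq n).
have -> : I01 (fun x => f x * mode' n x) = - (alpha * F 1 * mode n 1) by lra.
have -> : I01 (fun x => mode' n x ^+ 2) = lam n ^+ 2 * mode_sq n - alpha * mode n 1 * mode n 1 by lra.
ring.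
Qed.

(* Courant's argument: some combination of F and the first k+1 modes vanishes at the k+1
   nodes, and on the span of the modes the quotient is below omega^2. *)
Lemma energy_ge0 (k : nat) (F f : R -> R) :
  (forall x : R, is_derive x 1 F (f x)) -> continuous f ->
  (forall n, (n < k.+1)%N -> I01 (fun x => F x * mode n x) = 0) ->
  0 <= energy ((k%:R + 2^-1) * pi) F f.
Proof.
move=> dF cf F0; have cF := is_derive_continuous dF.
set omega := _ * pi.
pose node j : R := j.*2.+1%:R / k.+1.*2%:R.
(* The rows are the modes 0, ..., k and [F], the columns the k + 1 nodes. With one row too many
   there is a nonzero left kernel vector; its entries are the coefficients of the combination. *)
pose M : 'M[R]_(k.+2, k.+1) := \matrix_(i, j)
  (if (i < k.+1)%N then mode i (node j) else F (node j)).
have /rowV0Pn[v /sub_kermxP vM v0] : kermx M != 0.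
  by rewrite kermx_eq0 /row_free neq_ltn ltnS rank_leq_col.
pose c i := v 0 (inord i).
pose G n x := c k.+1 * F x + \sum_(i < n) c i * mode i x.
pose G' n x := c k.+1 * f x + \sum_(i < n) c i * mode' i x.
have GS n : G n.+1 = fun x => G n x + c n * mode n x.
  by apply/funext => x; rewrite /G big_ord_recr /= addrA.
have G'S n : G' n.+1 = fun x => G' n x + c n * mode' n x.
  by apply/funext => x; rewrite /G' big_ord_recr /= addrA.
have G0 : G 0 = fun x => c k.+1 * F x by apply/funext => x; rewrite /G big_ord0 addr0.
have G'0 : G' 0 = fun x => c k.+1 * f x by apply/funext => x; rewrite /G' big_ord0 addr0.
have dG n (x : R) : is_derive x 1 (G n) (G' n x).
  elim: n x => [|n IH] x; first by rewrite G0 G'0; der.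
  by have mn := mode_derive n; rewrite GS G'S; der.
have cG' n : continuous (G' n).
  by elim: n => [|n IH]; rewrite ?G'0 ?G'S; cont.
have cG n := is_derive_continuous (dG n).
have orth n m : (n <= m)%N -> (m < k.+1)%N -> I01 (fun x => G n x * mode m x) = 0.
  elim: n => [|n IH] nm mk.
    rewrite G0 (@Rint_ext _ (fun x => c k.+1 * (F x * mode m x))); last by move=> x; ring.
    by rewrite Rint_scale ?F0 ?mulr0//; cont.
  rewrite GS (@Rint_ext _ (fun x => G n x * mode m x + c n * (mode n x * mode m x))); last first.
    by move=> x; ring.
  rewrite Rint_add; [|by cont..].
  rewrite Rint_scale; last by cont.
  rewrite IH ?(ltnW nm)// add0r.
  by rewrite mode_orthogonal ?mulr0// neq_ltn nm.
have lo n : (n < k.+1)%N -> lam n ^+ 2 < omega ^+ 2.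
  move=> nk; rewrite ltr_pXn2r// ?nnegrE ?(ltW (lam_gt0 _))//; last first.
    by rewrite mulr_ge0 ?pi_ge0// addr_ge0// invr_ge0.
  have [/andP[_ ln] _] := lamP n; apply: lt_le_trans ln _.
  have p0 : 0 < pi :> R := pi_gt0 R.
  have : n%:R * pi <= k%:R * pi :> R by rewrite ler_wpM2r// ?ler_nat// ltW.
  rewrite /omega; lra.
have EG n : (n <= k.+1)%N -> energy omega (G n) (G' n) =
    c k.+1 ^+ 2 * energy omega F f
    - \sum_(i < n) c i ^+ 2 * (omega ^+ 2 - lam i ^+ 2) * mode_sq i.
  elim: n => [|n IH] nk.
    rewrite big_ord0 subr0 G0 G'0 /energy.
    rewrite (@Rint_ext _ (fun x => c k.+1 ^+ 2 * f x ^+ 2)); last by move=> x; ring.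
    rewrite (@Rint_ext (fun x => (c k.+1 * F x) ^+ 2) (fun x => c k.+1 ^+ 2 * F x ^+ 2)); last by move=> x; ring.
    by rewrite !Rint_scale; [ring|by cont..].
  rewrite GS G'S energy_add//; last by apply: orth; rewrite // ltnW.
  by rewrite IH 1?ltnW// big_ord_recr /=; ring.
(* The boundary term is nonnegative, and the Poincare inequality applies to the rest because the
   combination vanishes at all nodes. *)
have EGk : 0 <= energy omega (G k.+1) (G' k.+1).
  rewrite /energy addrAC; apply: addr_ge0; last first.
    by apply: mulr_ge0; [exact: ltW|exact: sqr_ge0].
  rewrite subr_ge0; apply: poincare_nodes => // j jk.
  have := congr1 (fun A : 'rV_k.+1 => A 0 (Ordinal jk)) vM; rewrite !mxE big_ord_recr /=.
  rewrite mxE /= ltnn addrC => E; rewrite /G -[RHS]E; congr (_ * _ + _).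
    by rewrite /c; congr (v 0 _); apply/val_inj; rewrite /= inordK.
  apply: eq_bigr => i _; rewrite mxE /= ltn_ord; congr (_ * _); rewrite /c; congr (v 0 _).
  by apply/val_inj; rewrite /= inordK// ltnS ltnW.
have term0 (i : 'I_k.+1) : true -> 0 <= c i ^+ 2 * (omega ^+ 2 - lam i ^+ 2) * mode_sq i.
  move=> _; apply: mulr_ge0; last exact/ltW/mode_sq_gt0.
  by rewrite mulr_ge0 ?sqr_ge0// subr_ge0 ltW// lo.
have sum0 : 0 <= \sum_(i < k.+1) c i ^+ 2 * (omega ^+ 2 - lam i ^+ 2) * mode_sq i.
  exact: sumr_ge0.
have pos : 0 <= c k.+1 ^+ 2 * energy omega F f by rewrite EG// in EGk; lra.
(* If [F] had weight 0, the energy would be nonnegative and equal to minus a sum of nonnegative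
   terms. As lam_i < omega, all coefficients would vanish, against [v0]. *)
have [c0|c0] := eqVneq (c k.+1) 0; last first.
  by move: pos; rewrite pmulr_rge0// exprn_even_gt0.
exfalso; move/negP : v0; apply; apply/eqP/rowP => i; rewrite mxE.
have vi : v 0 i = c i by rewrite /c inord_val.
rewrite vi; have [ik|] := ltnP i k.+1; last first.
  by move=> ki; have -> : (i : nat) = k.+1 by apply/eqP; rewrite eqn_leq ki -ltnS ltn_ord.
have s0 : \sum_(i < k.+1) c i ^+ 2 * (omega ^+ 2 - lam i ^+ 2) * mode_sq i = 0.
  by apply/eqP; rewrite eq_le sum0 andbT; rewrite EG// c0 expr0n mul0r sub0r oppr_ge0 in EGk.
have /(_ (Ordinal ik) isT)/eqP := psumr_eq0P term0 s0.
rewrite mulf_eq0 (gt_eqF (mode_sq_gt0 _)) orbF mulf_eq0 subr_eq0 (gt_eqF (lo _ ik)) orbF.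
by rewrite sqrf_eq0 => /eqP.
Qed.

Lemma mode_complete f : continuous f -> (forall n, I01 (fun x => f x * mode n x) = 0) ->
  forall x, 0 < x < 1 -> f x = 0.
Proof.
move=> cf f0.
(* The solution F of -F'' = f with the Robin conditions is orthogonal to all modes. *)
have [p dp p0] := continuous_primitive cf.
have cp := is_derive_continuous dp.
have [q dq _] := continuous_primitive cp.
(* p(0) = 0 gives F'(0) = 0, and the additive constant is chosen so that F'(1) + alpha F(1) = 0. *)
pose F x := q 1 + p 1 / alpha - q x.
have dF (x : R) : is_derive x 1 F (- p x) by rewrite /F; der.
have cNp : continuous (fun x => - p x) by cont.
have cF := is_derive_continuous dF.
have F0 n : I01 (fun x => F x * mode n x) = 0.
  have := mode_weak n dF cNp.
  have := @Rint_parts _ f (mode' n) p (mode n) 0 1 ler01 dp (mode_derive n) cf (mode'_continuous n).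
  rewrite f0 p0 mul0r !subr0 /F => E1 E2.
  move: E2; rewrite (@Rint_ext _ (fun x => -1 * (p x * mode' n x))); last by move=> x; ring.
  rewrite Rint_scale; last by cont.
  rewrite E1 => /eqP; rewrite eq_sym.
  have -> : alpha * (q 1 + p 1 / alpha - q 1) = p 1 by field; rewrite gt_eqF.
  rewrite mulN1r addNr mulf_eq0 expf_eq0 /= (gt_eqF (lam_gt0 n)) => /eqP; exact.
have int0 : I01 (fun x => F x ^+ 2) = 0.
  pose J := I01 (fun x => F x ^+ 2); rewrite -/J.
  have J0 : 0 <= J by apply: Rintegral_ge0 => x _; exact: sqr_ge0.
  apply/eqP; rewrite eq_le J0 andbT leNgt; apply/negP => Jp.
  pose E0 := I01 (fun x => (- p x) ^+ 2) + alpha * F 1 ^+ 2.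
  (* Orthogonality to every mode allows every k, and the fixed number [E0] dominates arbitrarily
     large multiples of [J] unless J = 0. *)
  have QJ k : k%:R * J <= E0.
    have := energy_ge0 dF cNp (fun n _ => F0 n) (k := k).
    rewrite /energy -/J -/E0 subr_ge0; apply: le_trans.
    rewrite ler_wpM2r//; have p2 := pi_ge2 R; have k0 : 0 <= k%:R :> R by [].
    have A : k%:R + 1 <= (k%:R + 2^-1) * pi :> R by nra.
    by rewrite expr2; nra.
  have := truncnS_gt (E0 / J); rewrite ltr_pdivrMr// => /lt_le_trans/(_ (QJ _)).
  by rewrite ltxx.
have cF2 : continuous (fun x => F x ^+ 2) by cont.
have Fz x : 0 < x < 1 -> F x = 0.
  by move=> x01; have /eqP := Rint_eq0 cF2 (fun x _ => sqr_ge0 _) int0 x01; rewrite sqrf_eq0 => /eqP.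
have dNp (x : R) : is_derive x 1 (fun x => - p x) (- f x) by der.
move=> x x01; apply/eqP; rewrite -oppr_eq0; apply/eqP.
exact: derive_locally_constant dNp (derive_locally_constant dF Fz) _ x01.
Qed.
End robin_modes.

Notation Q := (Qopen T).
Let mode_cont : forall n, continuous (mode n) := mode_continuous.
Let mode'_cont : forall n, continuous (mode' n) := mode'_continuous.

(** * Uniformly convergent mode expansions *)

Section expansion.
Implicit Types (f g : R -> R).

Lemma summable_lam_sqV : cvgn (series (fun n => (lam n ^+ 2)^-1)).
Proof.
(* The majorant telescopes. The summand 2 suffices for n >= 1, where lam_n >= 2 n because pi >= 2;
   the other summand takes care of n = 0. *)
pose M := 2 + 2 / lam 0 ^+ 2.
have l00 : 0 < lam 0 by exact: lam_gt0.
have M0 : 0 < M by rewrite /M addr_gt0// divr_gt0// exprn_gt0.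
pose B n := M * (n.+1%:R^-1 - n.+2%:R^-1) : R.
have nS n : 0 < n.+1%:R :> R by rewrite ltr0n.
have Bge n : (lam n ^+ 2)^-1 <= B n.
  have E : n.+1%:R^-1 - n.+2%:R^-1 = (n.+1%:R * n.+2%:R)^-1 :> R.
    have p := nS n; have -> : n.+2%:R = n.+1%:R + 1 :> R by rewrite natr1.
    by field; apply/andP; split; rewrite gt_eqF//; lra.
  rewrite /B E; case: n {E} => [|n].
    have -> : M * (1%:R * 2%:R)^-1 = 1 + (lam 0 ^+ 2)^-1.
      by rewrite /M; field; rewrite gt_eqF.
    by rewrite lerDr.
  have ln := lam_ge n.+1.
  have l2 : (2 * n.+1%:R) ^+ 2 <= lam n.+1 ^+ 2.
    have [/andP[l1 _] _] := lamP n.+1.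
    rewrite ler_pXn2r// ?nnegrE ?mulr_ge0// ?(ltW (lam_gt0 _))//.
    by rewrite mulrC (le_trans _ (ltW l1))// ler_wpM2l// pi_ge2.
  have p := nS n; have pl := lam_gt0 n.+1.
  have n1 : 1 <= n.+1%:R :> R by rewrite ler1n.
  rewrite (@le_trans _ _ (2 * (n.+2%:R * n.+3%:R)^-1))//.
    have pl2 : 0 < lam n.+1 ^+ 2 by exact: exprn_gt0.
    have pn : 0 < 2^-1 * (n.+2%:R * n.+3%:R) :> R by rewrite !mulr_gt0.
    rewrite -[X in X * _]invrK -invfM lef_pV2 ?posrE//.
    apply: le_trans l2; have -> : n.+3%:R = n.+1%:R + 2 :> R by rewrite -natrD addn2.
    have -> : n.+2%:R = n.+1%:R + 1 :> R by rewrite natr1.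
    nra.
  rewrite ler_wpM2r ?invr_ge0 ?mulr_ge0// /M lerDl divr_ge0// exprn_ge0// ltW//.
apply: (@series_le_cvg _ _ B) => [n|n|n|] //.
- by rewrite invr_ge0 exprn_ge0// ltW// lam_gt0.
- apply: le_trans (Bge n); by rewrite invr_ge0 exprn_ge0// ltW// lam_gt0.
have serB n : series B n = M * (1 - n.+1%:R^-1).
  elim: n => [|n IH]; first by rewrite /series /= big_geq// invr1 subrr mulr0.
  by rewrite seriesSr IH /B; ring.
apply: nondecreasing_is_cvgn.
  apply/nondecreasing_seqP => n; rewrite seriesSr lerDl.
  apply: le_trans (Bge n); by rewrite invr_ge0 exprn_ge0// ltW// lam_gt0.
exists M => _ [n _ <-]; rewrite serB ler_piMr ?ltW// lerBlDr lerDl invr_ge0 ltW//.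
Qed.

Lemma summable_lam_sqV_scale (C : R) : cvgn (series (fun n => C * (lam n ^+ 2)^-1)).
Proof. exact/(@is_cvg_seriesZ _ (fun n => (lam n ^+ 2)^-1))/summable_lam_sqV. Qed.

Lemma summable_exp (C tau : R) : 0 < tau ->
  cvgn (series (fun n => C * expR (- (lam n ^+ 2 * tau)))).
Proof.
move=> t0; apply: (@is_cvg_seriesZ _ (fun n => expR (- (lam n ^+ 2 * tau)))).
apply: (@series_le_cvg _ _ (fun n => tau^-1 * (lam n ^+ 2)^-1)) => [n|n|n|].
- exact: expR_ge0.
- by rewrite mulr_ge0 ?invr_ge0 ?exprn_ge0// ltW// lam_gt0.
- rewrite -invfM mulrC expRN_le// mulr_gt0// exprn_gt0// lam_gt0//.
exact: summable_lam_sqV_scale.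
Qed.

Definition coef f n := I01 (fun x => f x * mode n x) / mode_sq n.

(** With summable coefficients the series converges uniformly, its limit has the same coefficients
    as [f], and completeness identifies the two functions. *)
Lemma mode_expansion f (B : nat -> R) : continuous f ->
  (forall n, `|coef f n| <= B n) -> cvgn (series B) ->
  forall x, 0 <= x <= 1 -> series (fun n => coef f n * mode n x) N @[N --> \oo] --> f x.
Proof.
move=> cf fB cB.
have [S [cS SE Stail]] : exists S : R -> R, [/\ continuous S,
    forall x, series (fun n => coef f n * mode n x) n @[n --> \oo] --> S x
  & forall N x, `|S x - series (fun n => coef f n * mode n x) N| <=
      limn (series B) - series B N].
  apply: weierstrass_mtest cB => [n|n x]; first by cont.
  rewrite normrM; apply: le_trans (fB n).
  by rewrite ler_piMr// mode_le1.
suff fS x : 0 <= x <= 1 -> f x = S x by move=> x /fS ->; exact: SE.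
pose g x := f x - S x.
have cg : continuous g by rewrite /g; cont.
have gm m : I01 (fun x => g x * mode m x) = 0.
  have lim1 : \int[leb]_(x in `]0, 1[) (series (fun n => coef f n * mode n x) N * mode m x)
      @[N --> \oo] --> \int[leb]_(x in `]0, 1[) (S x * mode m x).
    apply: (@Rint_cvg _ _ _ (limn (series B))
      (fun N y => series (fun n => coef f n * mode n y) N * mode m y)).
    - by move=> N; cont.
    - by move=> y _; apply: cvgM; [exact: SE|exact: cvg_cst].
    - move=> N y _; rewrite normrM.
      apply: (@le_trans _ _ (`|series (fun n => coef f n * mode n y) N|)).
        by rewrite ler_piMr// mode_le1.
      by apply: series_bound => // n; rewrite normrM (le_trans _ (fB n))// ler_piMr// mode_le1.
  have lim2 : \int[leb]_(x in `]0, 1[) (series (fun n => coef f n * mode n x) N * mode m x)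
      @[N --> \oo] --> I01 (fun x => f x * mode m x).
    have E N : \int[leb]_(x in `]0, 1[) (series (fun n => coef f n * mode n x) N * mode m x) =
        if (m < N)%N then I01 (fun x => f x * mode m x) else 0.
      elim: N => [|N IH].
        rewrite (@Rint_ext _ (fun x => 0 * mode m x)); last first.
          by move=> y; rewrite /series /= big_geq.
        by rewrite Rint_scale// mul0r.
      rewrite (@Rint_ext _ (fun x => series (fun n => coef f n * mode n x) N * mode m x
         + coef f N * (mode N x * mode m x))); last first.
        by move=> y; rewrite seriesSr mulrDl mulrA.
      rewrite Rint_add; [|by cont..].
      rewrite IH Rint_scale; last by cont.
      rewrite ltnS [in RHS]leq_eqVlt; have [->|mN] := eqVneq m N.
        rewrite ltnn add0r /= (@Rint_ext _ (fun x => mode N x ^+ 2)); last by move=> y; ring.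
        by rewrite /coef divfK// gt_eqF//; exact: (mode_sq_gt0).
      rewrite (mode_orthogonal) 1?eq_sym// mulr0 addr0 //=.
    apply: cvg_near_cst; near=> N; rewrite E; case: ifPn => // /negP; case.
    by near: N; exact: nbhs_infty_gt.
  have SfE : I01 (fun x => S x * mode m x) = I01 (fun x => f x * mode m x).
    exact: (cvg_unique _ lim1 lim2).
  rewrite (@Rint_ext _ (fun x => f x * mode m x + -1 * (S x * mode m x))); last first.
    by move=> y; rewrite /g; ring.
  rewrite Rint_add; [|by cont..].
  by rewrite Rint_scale ?SfE ?mulN1r ?subrr//; cont.
have g0 := mode_complete cg gm.
move=> /andP[x0 x1]; apply/eqP; rewrite -subr_eq0 -/(g x); apply/eqP.
(* Completeness gives equality on the open interval only. Continuity extends it to the end points,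
   and the value at 1 is the one that expands the trace. *)
move: x0 x1; rewrite le_eqVlt => /predU1P[<- _|x0].
  have c0 : g y @[y --> 0^'+] --> g 0 by exact: cvg_at_right_filter (cg 0).
  have c0' : g y @[y --> 0^'+] --> (0 : R).
    by apply: cvg_near_cst; near=> y; apply: g0; apply/andP; split.
  exact: (cvg_unique _ c0 c0').
rewrite le_eqVlt => /predU1P[->|x1]; last by apply: g0; rewrite x0.
have c1 : g y @[y --> 1^'-] --> g 1 by exact: cvg_at_left_filter (cg 1).
have c1' : g y @[y --> 1^'-] --> (0 : R).
  apply: cvg_near_cst; near=> y; apply: g0; apply/andP; split; near: y.
    exact: nbhs_left_gt.
  exact: nbhs_left_lt.
exact: (cvg_unique _ c1 c1').
Unshelve. all: by end_near. Qed.
End expansion.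

(** * Weak solutions *)

Section coefficients.
Implicit Types (y g phi : R * R -> R) (h d : R -> R).

Definition moment y n (t : R) := I01 (fun x => y (x, t) * mode n x).

Lemma moment_continuous y n : continuous y -> continuous (moment y n).
Proof.
move=> cy.
by apply: (@continuous_Rint_param R (fun z => y z * mode n z.1)); cont.
Qed.

(** The boundary term from integrating by parts cancels the alpha term, leaving the weak form of a
    scalar ODE for the moment. [sigma] is -1 for the state and 1 for the adjoint, whose equations
    differ in the sign of the time derivative. *)
Lemma mode_form y y' g n (sigma : R) (eta eta' : R -> R) :
  continuous y -> weak_dx_L2 T y g -> (forall z, y' z = sigma * y z) ->
  (forall t : R, is_derive t 1 eta (eta' t)) -> continuous eta' ->
  let v z := mode n z.1 * eta z.2 in
  class_C1 v /\
  \int[leb2]_(z in Q) (y' z * dt v z + g z * dx v z)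
  + alpha * \int[leb]_(t in `]0, T[) (y (1, t) * v (1, t)) =
  sigma * \int[leb]_(t in `]0, T[) (eta' t * moment y n t)
  + lam n ^+ 2 * \int[leb]_(t in `]0, T[) (eta t * moment y n t).
Proof.
move=> cy wg yy' deta ceta' v; have ceta := is_derive_continuous deta.
have [vC1 vx vt] := class_C1_prod (mode_derive n) (@mode'_cont n) deta ceta'; split=> //.
have ig := Lfun2_Qopen_integrable wg.1.
have cmom := moment_continuous (n := n) cy.
have cl : continuous (fun x => - lam n ^+ 2 * mode n x) by cont.
rewrite -(Qint_prod T cy (@mode_cont n) ceta') -Qint_scale; last by cint.
rewrite (@eq_Rint _ _ _ leb2 Q _ (fun z => sigma * (y z * (mode n z.1 * eta' z.2))
  + g z * (mode' n z.1 * eta z.2))); last first.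
  by move=> z _; rewrite vx vt yy'; ring.
rewrite Qint_add; [|by cint|by apply: Qint_integrable => //; cont].
rewrite -addrA; congr (_ + _).
rewrite (weak_dx_parts T_gt0 cy wg (mode'_derive n) cl deta ceta').
rewrite (Qint_prod T cy cl ceta).
have -> : \int[leb]_(t in `]0, T[) (eta t * (y (1, t) * mode' n 1 - y (0, t) * mode' n 0)) =
    - alpha * \int[leb]_(t in `]0, T[) (y (1, t) * v (1, t)).
  rewrite -RintegralZl//; last by rewrite /v /=; cint.
  apply: eq_Rint => t _; rewrite mode'0 mode'1 /v; ring.
have -> : \int[leb]_(t in `]0, T[) (eta t * I01 (fun x => y (x, t) * (- lam n ^+ 2 * mode n x))) =
    - lam n ^+ 2 * \int[leb]_(t in `]0, T[) (eta t * moment y n t).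
  rewrite -RintegralZl//; last by cint.
  apply: eq_Rint => t _; rewrite mulrCA; congr (_ * _).
  rewrite /moment -Rint_scale; last by cont.
  by apply: Rint_ext => x; ring.
ring.
Qed.

(** Duhamel's formula. The factor [1 - th k] makes the test function vanish at [T], and the identity
    becomes pointwise as [th' k] concentrates at t; the indicator of s <= t keeps the domain of
    integration fixed. *)
Lemma state_moment y g h n (t : R) : continuous y -> weak_dx_L2 T y g ->
  leb.-integrable `]0, T[ (EFin \o h) ->
  weak_state T alpha h y g ->
  0 <= t < T ->
  moment y n t * expR (lam n ^+ 2 * t) =
  mode n 1 * \int[leb]_(s in `]0, T[) (h s * (expR (lam n ^+ 2 * s) * (s <= t)%R%:R)).
Proof.
move=> cy wg ih weak tT.
have [th [th' [dth cth' th01 [th0 thT] [th1 thI]]]] := ramp tT.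
have cth k := is_derive_continuous (dth k).
have cmom := moment_continuous (n := n) cy.
pose E s := expR (lam n ^+ 2 * s).
have cE : continuous E by rewrite /E; cont.
have dE (s : R) : is_derive s 1 E (lam n ^+ 2 * E s) by rewrite /E; der.
have step k : \int[leb]_(s in `]0, T[) (moment y n s * E s * th' k s) =
    mode n 1 * \int[leb]_(s in `]0, T[) (h s * (E s * (1 - th k s))).
  have dk := dth k.
  pose eta s := E s * (1 - th k s).
  pose eta' s := lam n ^+ 2 * eta s - E s * th' k s.
  have deta (s : R) : is_derive s 1 eta (eta' s) by rewrite /eta /eta' /eta; der.
  have ceta : continuous eta by rewrite /eta; cont.
  have ceta' : continuous eta' by rewrite /eta'; cont.
  have [|vC1 form] := @mode_form y (fun z => - y z) g n (-1) _ _ cy wg _ deta ceta'.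
    by move=> z; rewrite mulN1r.
  have := weak _ vC1; rewrite form => wv.
  have e3 : \int[leb]_(s in `]0, T[) (moment y n s * E s * th' k s) =
      lam n ^+ 2 * \int[leb]_(s in `]0, T[) (eta s * moment y n s)
      - \int[leb]_(s in `]0, T[) (eta' s * moment y n s).
    rewrite -RintegralZl//; last by cint.
    rewrite -RintegralB//; [|by cint..].
    by apply: eq_Rint => s _; rewrite /eta'; ring.
  have e4 : mode n 1 * \int[leb]_(s in `]0, T[) (h s * (E s * (1 - th k s))) =
      \int[leb]_(t in `]0, T[) (h t * (mode n 1 * eta t)).
    rewrite -RintegralZl//; last by apply: integrable_mul_continuous => //; cont.
    by apply: eq_Rint => s _; rewrite /eta; ring.
  rewrite e3 e4 -wv; first by ring.
  by move=> x _; rewrite /eta thT// subrr !mulr0.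
have lim1 : \int[leb]_(s in `]0, T[) (moment y n s * E s * th' k s) @[k --> \oo] -->
    moment y n t * E t := thI _ (cont_mul cmom cE).
have lim2 : mode n 1 * \int[leb]_(s in `]0, T[) (h s * (E s * (1 - th k s))) @[k --> \oo] -->
    mode n 1 * \int[leb]_(s in `]0, T[) (h s * (E s * (s <= t)%R%:R)).
  apply: cvgM; first exact: cvg_cst.
  have [M M0 EM] := continuous_itv_bounded 0 T cE.
  apply: (@Rint_mul_cvg _ _ _ _ (fun k s => E s * (1 - th k s)) _ M) => //.
  - by move=> k; cont.
  - move=> s s0T; apply: cvgM; first exact: cvg_cst.
    have [st|st] := leP s t.
      by apply: cvg_near_cst; apply: nearW => k; rewrite th0// subr0.
    have H : 1 - th k s @[k --> \oo] --> 1 - (1 : R).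
      by apply: cvgB; [exact: cvg_cst|exact: th1].
    by rewrite subrr in H.
  - move=> k s /andP[s0 sT]; have /andP[k0 k1] := th01 k s.
    have sT' : 0 <= s <= T by rewrite !ltW.
    rewrite normrM (le_trans _ (EM s sT'))// ler_piMr// ger0_norm ?subr_ge0//.
    by rewrite lerBlDr lerDl.
rewrite (_ : (fun k => _) = (fun k => mode n 1 *
  \int[leb]_(s in `]0, T[) (h s * (E s * (1 - th k s))))) in lim1; last exact/funext.
exact: (cvg_unique _ lim1 lim2).
Qed.

(** The time factor [E * th k] vanishes at 0 and equals [E] at [T]. The exponential cancels the
    zero-order term, so the tested identity has the same value for all k. *)
Lemma adjoint_moment phi g d n (t : R) : continuous phi -> weak_dx_L2 T phi g ->
  continuous d ->
  weak_adjoint T alpha d phi g ->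
  0 <= t < T ->
  moment phi n t = I01 (fun x => d x * mode n x) * expR (- (lam n ^+ 2 * (T - t))).
Proof.
move=> cy wg cd weak tT; have /andP[t0 t1] := tT.
have [th [th' [dth cth' th01 [th0 thT] [_ thI]]]] := ramp tT.
have cth k := is_derive_continuous (dth k).
have cmom := moment_continuous (n := n) cy.
pose E s := expR (- (lam n ^+ 2 * s)).
have cE : continuous E by rewrite /E; cont.
have dE (s : R) : is_derive s 1 E (- lam n ^+ 2 * E s) by rewrite /E; der.
have step k : \int[leb]_(s in `]0, T[) (moment phi n s * E s * th' k s) =
    E T * I01 (fun x => d x * mode n x).
  have dk := dth k.
  pose eta s := E s * th k s.
  pose eta' s := E s * th' k s - lam n ^+ 2 * eta s.
  have deta (s : R) : is_derive s 1 eta (eta' s) by rewrite /eta /eta' /eta; der.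
  have ceta : continuous eta by rewrite /eta; cont.
  have ceta' : continuous eta' by rewrite /eta'; cont.
  have [|vC1 form] := @mode_form phi phi g n 1 _ _ cy wg _ deta ceta'.
    by move=> z; rewrite mul1r.
  have := weak _ vC1; rewrite form => wv.
  have e3 : \int[leb]_(s in `]0, T[) (moment phi n s * E s * th' k s) =
      lam n ^+ 2 * \int[leb]_(s in `]0, T[) (eta s * moment phi n s)
      + \int[leb]_(s in `]0, T[) (eta' s * moment phi n s).
    rewrite -RintegralZl//; last by cint.
    rewrite -RintegralD//; [|by cint..].
    by apply: eq_Rint => s _; rewrite /eta'; ring.
  have e4 : E T * I01 (fun x => d x * mode n x) =
      \int[leb]_(x in `]0, 1[) (d x * (mode n x * eta T)).
    rewrite -Rint_scale; last by cont.
    by apply: Rint_ext => x; rewrite /eta thT//; ring.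
  rewrite e3 e4 -wv; first by ring.
  by move=> x _; rewrite /eta th0// !mulr0.
have lim1 : \int[leb]_(s in `]0, T[) (moment phi n s * E s * th' k s) @[k --> \oo] -->
    moment phi n t * E t := thI _ (cont_mul cmom cE).
have lim2 : \int[leb]_(s in `]0, T[) (moment phi n s * E s * th' k s) @[k --> \oo] -->
    E T * I01 (fun x => d x * mode n x).
  by apply: cvg_near_cst; exact: nearW.
have E0 : E t != 0 by rewrite gt_eqF// expR_gt0.
apply: (mulIf E0); rewrite (cvg_unique _ lim1 lim2)//.
by rewrite mulrC -mulrA /E -expRD; congr (_ * expR _); ring.
Qed.
End coefficients.

(** * The adjoint trace and the duality formula *)

Section duality.
Variables (phi gphi : R * R -> R) (d : R -> R).
Hypothesis cphi : continuous phi.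
Hypothesis wphi : weak_dx_L2 T phi gphi.
Hypothesis cd : continuous d.
Hypothesis weak_phi : weak_adjoint T alpha d phi gphi.

Lemma phi_moment n t : 0 <= t < T ->
  moment phi n t = I01 (fun x => d x * mode n x) * expR (- (lam n ^+ 2 * (T - t))).
Proof. exact: (adjoint_moment n cphi wphi cd weak_phi). Qed.

Lemma coef_bound : exists2 C, 0 <= C & forall n, `|coef d n| <= C.
Proof.
have [M M0 dM] := continuous_itv_bounded 0 1 cd.
exists (2 * M); first by rewrite mulr_ge0.
move=> n.
have cdm : continuous (fun x => d x * mode n x) by cont.
have IM : `|I01 (fun x => d x * mode n x)| <= M.
  rewrite -[leRHS]mulr1 -[X in M * X](subr0 1); apply: Rint_bound => // x /andP[x0 x1].
  have x01 : 0 <= x <= 1 by rewrite !ltW.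
  by rewrite normrM (le_trans _ (dM x x01))// ler_piMr// mode_le1.
rewrite /coef normrM normfV (gtr0_norm (mode_sq_gt0 n)).
rewrite ler_pdivrMr ?(mode_sq_gt0)// (le_trans IM)//.
have := mode_sq_ge n; nra.
Qed.

Lemma coef_phi n t : 0 <= t < T ->
  coef (fun x => phi (x, t)) n = coef d n * expR (- (lam n ^+ 2 * (T - t))).
Proof.
move=> tT; rewrite /coef; have := phi_moment n tT; rewrite /moment => ->; ring.
Qed.

Lemma coef_phi_bound C t : 0 <= t < T -> (forall n, `|coef d n| <= C) ->
  forall n, `|coef (fun x => phi (x, t)) n| <= C * expR (- (lam n ^+ 2 * (T - t))).
Proof.
move=> tT dC n; rewrite coef_phi// normrM (gtr0_norm (expR_gt0 _)).
by rewrite ler_wpM2r ?expR_ge0.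
Qed.

Lemma adjoint_expansion t x : 0 <= t < T -> 0 <= x <= 1 ->
  series (fun n => coef (fun x => phi (x, t)) n * mode n x) N @[N --> \oo] --> phi (x, t).
Proof.
move=> tT x01; have [C C0 dC] := coef_bound; have /andP[_ t1] := tT.
apply: (mode_expansion (continuous_slice1 (t := t) cphi)
  (coef_phi_bound tT dC)) x01.
by apply: summable_exp; rewrite subr_gt0.
Qed.

Definition amplitude n := coef d n * mode n 1.

Lemma adjoint_trace t : 0 <= t < T ->
  series (fun n => amplitude n * expR (- (lam n ^+ 2 * (T - t)))) N @[N --> \oo] --> phi (1, t).
Proof.
move=> tT; have := @adjoint_expansion t 1 tT; rewrite ler01 lexx => /(_ isT).
by under eq_fun do [under eq_fun do rewrite coef_phi// mulrAC -/(amplitude _)].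
Qed.

(** The end condition is contained only in the weak identity: the moment formula extends from t < T
    to [T] by continuity, and completeness recovers the function. *)
Lemma phi_final x : 0 < x < 1 -> phi (x, T) = d x.
Proof.
move=> x01; apply/eqP; rewrite -subr_eq0; apply/eqP.
apply: (mode_complete (f := fun x => phi (x, T) - d x)) x01; first by cont.
move=> n; have cmom := moment_continuous (n := n) cphi.
have -> : I01 (fun x => (phi (x, T) - d x) * mode n x) =
    moment phi n T - I01 (fun x => d x * mode n x).
  rewrite /moment -RintegralB//; [|by cint..].
  by apply: eq_Rint => y _; rewrite mulrBl.
have lim1 : moment phi n s @[s --> T^'-] --> moment phi n T.
  by apply: cvg_at_left_filter; exact: cmom.
have cE : continuous (fun s => I01 (fun x => d x * mode n x) * expR (- (lam n ^+ 2 * (T - s)))).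
  by cont.
have lim2 : moment phi n s @[s --> T^'-] --> I01 (fun x => d x * mode n x).
  have := cvg_at_left_filter (cE T); rewrite subrr mulr0 oppr0 expR0 mulr1.
  apply: cvg_trans; apply: near_eq_cvg; near=> s; rewrite phi_moment//.
  apply/andP; split; last by near: s; exact: nbhs_left_lt.
  by near: s; apply: nbhs_left_ge.
by rewrite (cvg_unique _ lim1 lim2) ?subrr.
Unshelve. all: by end_near. Qed.

Variables (y gy : R * R -> R) (h : R -> R).
Hypothesis cy : continuous y.
Hypothesis wy : weak_dx_L2 T y gy.
Hypothesis ih : leb.-integrable `]0, T[ (EFin \o h).
Hypothesis weak_y : weak_state T alpha h y gy.

Let upto (t s : R) : R := (s <= t)%R%:R.

Lemma upto_measurable t : measurable_fun `]0, T[ (upto t).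
Proof.
have -> : upto t = \1_(`]-oo, t]).
  apply/funext => s; rewrite /upto indicE; congr (_%:R).
  by rewrite mem_setE in_itv.
exact: measurable_indic.
Qed.

Lemma upto_integrable t f : leb.-integrable `]0, T[ (EFin \o f) ->
  leb.-integrable `]0, T[ (EFin \o (fun s => f s * upto t s)).
Proof.
move=> if_; apply: (@integrable_mul_bounded _ _ _ leb `]0, T[ _ f (upto t) 1) => //.
  exact: upto_measurable.
by move=> s _; rewrite /upto normr_nat lern1 leq_b1.
Qed.

(* Expand phi (., t) in modes: by Duhamel's formula for the moments of y both sides are the same
   series. *)
Lemma pairing t : 0 <= t < T ->
  I01 (fun x => phi (x, t) * y (x, t)) = \int[leb]_(s in `]0, T[) (h s * upto t s * phi (1, s)).
Proof.
move=> tT; have /andP[t0 t1] := tT; have [C C0 dC] := coef_bound.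
have cyt := continuous_slice1 (t := t) cy.
pose B n := C * expR (- (lam n ^+ 2 * (T - t))).
have cB : cvgn (series B) by apply: summable_exp; rewrite subr_gt0.
pose ser N x := series (fun n => coef (fun x => phi (x, t)) n * mode n x) N.
have cser N : continuous (ser N) by rewrite /ser; cont.
have lim1 : I01 (fun x => ser N x * y (x, t)) @[N --> \oo] -->
    I01 (fun x => phi (x, t) * y (x, t)).
  have [M M0 yM] := continuous_itv_bounded 0 1 cyt.
  apply: (@Rint_cvg _ _ _ (limn (series B) * M) (fun N x => ser N x * y (x, t))).
  - by move=> N; cont.
  - move=> x /andP[x0 x1]; apply: cvgM; last exact: cvg_cst.
    by apply: adjoint_expansion => //; rewrite !ltW.
  - move=> N x /andP[x0 x1]; rewrite normrM ler_pM//; last by rewrite yM// !ltW.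
    apply: series_bound => // n; rewrite normrM (le_trans _ (coef_phi_bound tT dC n))//.
    by rewrite ler_piMr// mode_le1.
have serE N : I01 (fun x => ser N x * y (x, t)) =
    \int[leb]_(s in `]0, T[) (h s * upto t s *
      series (fun n => amplitude n * expR (- (lam n ^+ 2 * (T - s)))) N).
  elim: N => [|N IH].
    rewrite (@Rint_ext _ (fun x => 0 * y (x, t))); last first.
      by move=> x; rewrite /ser /series /= big_geq.
    rewrite Rint_scale// mul0r (@eq_Rint _ _ _ _ _ _ (fun=> 0)) ?Rintegral_cst ?mul0r//.
    by move=> s _; rewrite /series /= big_geq// mulr0.
  have cserE : continuous (fun s => series (fun n => amplitude n * expR (- (lam n ^+ 2 * (T - s)))) N).
    by cont.
  rewrite (@Rint_ext _ (fun x => ser N x * y (x, t) +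
      coef (fun x => phi (x, t)) N * (y (x, t) * mode N x))); last first.
    by move=> x; rewrite /ser seriesSr; ring.
  rewrite Rint_add; [|by cont..].
  rewrite IH Rint_scale; last by cont.
  rewrite -/(moment y N t).
  have mom : moment y N t = expR (- (lam N ^+ 2 * t)) * mode N 1 *
      \int[leb]_(s in `]0, T[) (h s * (expR (lam N ^+ 2 * s) * upto t s)).
    have := state_moment N cy wy ih weak_y tT.
    move/(congr1 (fun r => r * expR (- (lam N ^+ 2 * t)))).
    rewrite -(mulrA (moment _ _ _)) -expRD subrr expR0 mulr1 => ->; rewrite /upto; ring.
  have cE : continuous (fun s => expR (lam N ^+ 2 * s)) by cont.
  have ihu := upto_integrable t ih.
  rewrite mom coef_phi// (@eq_Rint _ _ _ leb `]0, T[
    (fun s => h s * (expR (lam N ^+ 2 * s) * upto t s))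
    (fun s => h s * upto t s * expR (lam N ^+ 2 * s))); last by move=> s _; rewrite mulrA mulrAC.
  rewrite mulrA -RintegralZl//; last exact: integrable_mul_continuous.
  rewrite -RintegralD//; last 2 first.
  - exact: integrable_mul_continuous.
  - apply: (@integrableZl _ _ _ leb `]0, T[ _ _ (fun s => (h s * upto t s * expR (lam N ^+ 2 * s))%:E)) => //.
    exact: integrable_mul_continuous.
  apply: eq_Rint => s _; rewrite seriesSr /amplitude.
  have -> : expR (- (lam N ^+ 2 * (T - s))) =
      expR (- (lam N ^+ 2 * (T - t))) * expR (- (lam N ^+ 2 * t)) * expR (lam N ^+ 2 * s).
    by rewrite -!expRD; congr expR; ring.
  ring.
pose serA N s := series (fun n => amplitude n * expR (- (lam n ^+ 2 * (T - s)))) N.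
have cserA N : continuous (serA N) by rewrite /serA; cont.
have cmin : continuous (fun s : R => Num.min s t).
  by move=> s; apply: (@continuous_min R R (fun s => s) (fun _ => t)); [exact: cvg_id|exact: cvg_cst].
(* The series in s is dominated uniformly only for s <= t < T. Where s exceeds t the indicator
   vanishes, so s may be replaced by its minimum with t. *)
have uptoE f s : h s * upto t s * f s = h s * upto t s * f (Num.min s t).
  by rewrite /upto; case: (leP s t) => st; rewrite ?mulr0 ?mul0r.
have lim2 : \int[leb]_(s in `]0, T[) (h s * upto t s * serA N s) @[N --> \oo] -->
    \int[leb]_(s in `]0, T[) (h s * upto t s * phi (1, s)).
  rewrite (@eq_Rint _ _ _ leb `]0, T[ _ (fun s => h s * upto t s * phi (1, Num.min s t))); last first.
    by move=> s _; exact: (uptoE (fun s => phi (1, s))).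
  under eq_fun do under eq_Rint do rewrite uptoE.
  apply: (@Rint_mul_cvg _ _ _ _ (fun N s => serA N (Num.min s t)) _ (limn (series B))).
  - exact: upto_integrable.
  - by move=> N; cont.
  - move=> s /andP[s0 sT]; apply: adjoint_trace.
    by rewrite le_min (ltW s0) t0 /= gt_min t1 orbT.
  - move=> N s _; apply: series_bound => // n; rewrite normrM (gtr0_norm (expR_gt0 _)).
    apply: ler_pM; rewrite ?expR_ge0//.
      by rewrite normrM (le_trans _ (dC n))// ler_piMr// mode_le1.
    rewrite ler_expR lerN2 ler_wpM2l ?sqr_ge0// lerB// ge_min lexx orbT //.
rewrite (_ : (fun N => I01 (fun x => ser N x * y (x, t))) = (fun N => \int[leb]_(s in `]0, T[) (h s * upto t s *
  serA N s))) in lim1; last exact/funext.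
exact: (cvg_unique _ lim1 lim2).
Qed.

(** The pairing is available for t < T, where the coefficients decay exponentially; it is evaluated
    along T - T / (k + 1) and passed to the limit. *)
Lemma duality : I01 (fun x => d x * y (x, T)) = \int[leb]_(s in `]0, T[) (h s * phi (1, s)).
Proof.
have cp1 := continuous_slice2 (x := 1) cphi.
have cJ : continuous (fun t => I01 (fun x => phi (x, t) * y (x, t))).
  by apply: (@continuous_Rint_param R (fun z => phi z * y z)); cont.
pose tk k : R := T - T * harmonic k.
have tkT k : 0 <= tk k < T.
  rewrite /tk /harmonic /= ltrBlDr ltrDl mulr_gt0 ?invr_gt0// andbT subr_ge0.
  by rewrite ler_piMr ?(ltW T_gt0)// invf_le1// ler1n.
have tk_cvg : tk k @[k --> \oo] --> T.
  rewrite -[X in _ --> X]subr0 -[X in _ --> _ - X](mulr0 T).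
  by apply: cvgB; [exact: cvg_cst|apply: cvgM; [exact: cvg_cst|exact: cvg_harmonic]].
have lim1 : I01 (fun x => phi (x, tk k) * y (x, tk k)) @[k --> \oo] -->
    I01 (fun x => phi (x, T) * y (x, T)).
  exact: (cvg_comp _ _ tk_cvg (cJ T)).
have ihp := integrable_mul_continuous ih cp1.
have lim2 : \int[leb]_(s in `]0, T[) (h s * phi (1, s) * upto (tk k) s) @[k --> \oo] -->
    \int[leb]_(s in `]0, T[) (h s * phi (1, s)).
  apply: (@Rintegral_dominated_cvg _ _ _ leb `]0, T[ _
    (fun k s => h s * phi (1, s) * upto (tk k) s) _ (fun s => `|h s * phi (1, s)|)).
  - exact: measurable_itv.
  - by move=> k; apply/measurable_EFinP; exact: measurable_int (upto_integrable _ ihp).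
  - move=> s /=; rewrite in_itv /= => /andP[s0 sT]; apply: cvg_near_cst.
    near=> k; rewrite /upto (_ : s <= tk k) ?mulr1//; apply: ltW; near: k.
    exact: (cvgr_gt T).
  - exact: integrable_norm ihp.
  - by move=> k s _; rewrite normrM ler_piMr// /upto normr_nat lern1 leq_b1.
rewrite (_ : (fun k => I01 (fun x => phi (x, tk k) * y (x, tk k))) =
    fun k => \int[leb]_(s in `]0, T[) (h s * phi (1, s) * upto (tk k) s)) in lim1; last first.
  apply/funext => k; rewrite (pairing (tkT k)); apply: eq_Rint => s _; ring.
rewrite -(cvg_unique _ lim1 lim2)//; apply: eq_Rint => x /=; rewrite in_itv /= => x01.
by rewrite phi_final.
Unshelve. all: by end_near. Qed.
End duality.

(** * Construction of states for smooth boundary data *)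

Section state_existence.
(** The weak eigenvalue equation for F = 1 computes the integral of a mode from its boundary
    value. *)
Lemma coef_cst n : coef (fun=> alpha^-1) n = mode n 1 / (lam n ^+ 2 * mode_sq n).
Proof.
have d1 (x : R) : is_derive x 1 (fun=> 1 : R) 0 by der.
have := mode_weak n d1 (@cont_cst _ _ 0).
rewrite (@Rint_ext (fun x => 0 * mode' n x) (fun x => 0 * mode n x)); last by move=> x; rewrite !mul0r.
rewrite Rint_scale// mul0r add0r mulr1 => E.
rewrite /coef Rint_scale//; have -> : I01 (fun x => mode n x) = I01 (fun x => 1 * mode n x).
  by apply: Rint_ext => x; rewrite mul1r.
have l0 := lam_gt0 n; have s0 := mode_sq_gt0 n.
have -> : I01 (fun x => 1 * mode n x) = alpha * mode n 1 / lam n ^+ 2.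
  by rewrite E mulrAC divff ?mul1r// expf_neq0// gt_eqF.
by field; rewrite !gt_eqF.
Qed.

Let kap n := coef (fun=> alpha^-1) n.

Lemma kap_le n : `|kap n| <= 2 * (lam n ^+ 2)^-1.
Proof.
have l0 := lam_gt0 n; have s0 := mode_sq_gt0 n.
have l2 : 0 < lam n ^+ 2 by rewrite exprn_gt0.
rewrite /kap coef_cst normrM normfV (gtr0_norm (mulr_gt0 l2 s0)) ler_pdivrMr ?mulr_gt0//.
have -> : 2 / lam n ^+ 2 * (lam n ^+ 2 * mode_sq n) = 2 * mode_sq n by field; rewrite gt_eqF.
apply: le_trans (mode_le1 _ _) _; have := mode_sq_ge n; lra.
Qed.

Lemma kap_expansion x : 0 <= x <= 1 ->
  series (fun n => kap n * mode n x) N @[N --> \oo] --> alpha^-1.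
Proof.
apply: (mode_expansion (@cont_cst _ _ alpha^-1) kap_le).
exact: summable_lam_sqV_scale.
Qed.

Variables (w q : R -> R).
Hypothesis cq : continuous q.
Hypothesis dw : forall t : R, is_derive t 1 w (q t).
Hypothesis w0 : w 0 = 0.

(** Variation of constants: integrating the exponential gains 1 / lam_n^2, and [kap] another one.
    The total decay lam_n^-4 still leaves summability after an x-derivative, which costs a factor
    lam_n. *)
Lemma mode_source n : exists k : R -> R, [/\
  forall t : R, is_derive t 1 k (kap n * q t - lam n ^+ 2 * k t), k 0 = 0 &
  forall M, (forall t, 0 <= t <= T -> `|q t| <= M) -> forall t, 0 <= t <= T ->
    `|k t| <= 2 * M * (lam n ^+ 2)^-1 * (lam n ^+ 2)^-1].
Proof.
have l2 : 0 < lam n ^+ 2 by rewrite exprn_gt0// lam_gt0.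
have cE : continuous (fun s => expR (lam n ^+ 2 * s) * q s) by cont.
have [P dP P0] := continuous_primitive cE.
exists (fun t => kap n * (expR (- (lam n ^+ 2 * t)) * P t)); split.
- move=> t; apply: is_derive_eq; rewrite /GRing.scale /=.
  have E : expR (- (lam n ^+ 2 * t)) * expR (lam n ^+ 2 * t) = 1 :> R by rewrite -expRD addNr expR0.
  by rewrite (mulrA (expR (- _)) (expR _) (q t)) E; ring.
- by rewrite P0 !mulr0.
move=> M qM t /andP[t0 tT].
have M0 : 0 <= M by apply: le_trans (normr_ge0 (q 0)) (qM 0 _); rewrite lexx ltW.
have PM : `|P t| <= M * (expR (lam n ^+ 2 * t) / lam n ^+ 2).
  rewrite -[P t]subr0 -P0 -(Rint_FTC t0 dP cE).
  apply: le_trans (le_normr_Rintegral _ (continuous_integrable _ _ cE)) _ => //.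
  have dEx (s : R) : is_derive s 1 (fun s => expR (lam n ^+ 2 * s) / lam n ^+ 2) (expR (lam n ^+ 2 * s)).
    by apply: is_derive_eq; rewrite /GRing.scale /=; field; rewrite gt_eqF ?lam_gt0.
  have cEx : continuous (fun s => expR (lam n ^+ 2 * s)) by cont.
  apply: (@le_trans _ _ (M * \int[leb]_(s in `]0, t[) expR (lam n ^+ 2 * s))).
    rewrite -RintegralZl//; last exact: continuous_integrable.
    apply: le_Rintegral.
    - exact: measurable_itv.
    - by apply: continuous_integrable => s; apply: cvg_norm; exact: cE.
    - by cint.
    move=> s /=; rewrite in_itv /= => /andP[s0 st].
    rewrite normrM (gtr0_norm (expR_gt0 _)) mulrC ler_wpM2r ?expR_ge0// qM// (ltW s0)/=.
    exact: le_trans (ltW st) tT.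
  by rewrite (Rint_FTC t0 dEx cEx) ler_wpM2l// lerBlDr lerDl divr_ge0 ?expR_ge0// ltW.
have E : expR (- (lam n ^+ 2 * t)) * expR (lam n ^+ 2 * t) = 1 :> R by rewrite -expRD addNr expR0.
have EP : `|expR (- (lam n ^+ 2 * t)) * P t| <= M * (lam n ^+ 2)^-1.
  rewrite normrM (gtr0_norm (expR_gt0 _)).
  apply: le_trans (ler_wpM2l (expR_ge0 _) PM) _.
  by rewrite mulrCA (mulrA (expR _) (expR _)) E mul1r.
rewrite normrM; apply: le_trans (ler_pM (normr_ge0 _) (normr_ge0 _) (kap_le n) EP) _.
by rewrite le_eqVlt; apply/orP; left; apply/eqP; ring.
Qed.

(* The state is w / alpha - sum_n k_n(t) cos (lam_n x): the first term lifts the boundary data,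
   kap is the expansion of the constant 1 / alpha, and k_n' + lam_n^2 k_n = kap_n w'. *)
Lemma state_exists : exists y, state T alpha w y.
Proof.
have /choice[k kP] : forall n, exists k : R -> R, [/\
  forall t : R, is_derive t 1 k (kap n * q t - lam n ^+ 2 * k t), k 0 = 0 &
  forall M, (forall t, 0 <= t <= T -> `|q t| <= M) -> forall t, 0 <= t <= T ->
    `|k t| <= 2 * M * (lam n ^+ 2)^-1 * (lam n ^+ 2)^-1] := mode_source.
have dk n := let: And3 h _ _ := kP n in h.
have k0 n := let: And3 _ h _ := kP n in h.
have ck n := is_derive_continuous (dk n).
have cw := is_derive_continuous dw.
have cdk n : continuous (fun t => kap n * q t - lam n ^+ 2 * k n t).
  by cont.
have [M M0 qM] := continuous_itv_bounded 0 T cq.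
have kM n t : 0 <= t <= T -> `|k n t| <= 2 * M * (lam n ^+ 2)^-1 * (lam n ^+ 2)^-1.
  by case: (kP n) => _ _; apply.
have l0 n := lam_gt0 n.
have lmono n : lam 0 <= lam n.
  by case: n => // n; rewrite ltW// lam_lt.
(* One majorant for two series: since lam_0 <= lam_n, the first summand covers |k_n| and the second
   |k_n| lam_n, both relative to 1 / lam_n^2. *)
pose C := 2 * M * (lam 0 ^+ 2)^-1 + 2 * M * (lam 0)^-1.
pose B n := C * (lam n ^+ 2)^-1.
have cB : cvgn (series B).
  exact: summable_lam_sqV_scale.
have lV n : 0 <= (lam n ^+ 2)^-1 by rewrite invr_ge0 sqr_ge0.
have C1 : 0 <= 2 * M * (lam 0 ^+ 2)^-1 by rewrite !mulr_ge0.
have C2 : 0 <= 2 * M * (lam 0)^-1 by rewrite !mulr_ge0// invr_ge0 ltW.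
have kB n t : 0 <= t <= T -> `|k n t| <= B n.
  move=> /(kM n)/le_trans; apply; rewrite /B ler_wpM2r//.
  rewrite (@le_trans _ _ (2 * M * (lam 0 ^+ 2)^-1))//; last by rewrite /C lerDl.
  by rewrite ler_wpM2l ?mulr_ge0// lef_pV2 ?posrE ?exprn_gt0// lerXn2r ?nnegrE ?(ltW (l0 _)).
have kB' n t : 0 <= t <= T -> `|k n t| * lam n <= B n.
  move=> /(kM n)/(ler_wpM2r (ltW (l0 n)))/le_trans; apply.
  rewrite mulrAC /B ler_wpM2r//.
  have -> : 2 * M * (lam n ^+ 2)^-1 * lam n = 2 * M * (lam n)^-1 by field; rewrite gt_eqF.
  rewrite (@le_trans _ _ (2 * M * (lam 0)^-1))//; last by rewrite /C lerDr.
  by rewrite ler_wpM2l ?mulr_ge0// lef_pV2 ?posrE.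
(* The bounds on k_n hold on [0, T] only; clamping the time makes them hold on the whole plane, as
   the M-test demands. *)
pose cl (z : R * R) := clamp 0 T z.2.
have ccl : continuous cl by exact: (cont_comp (@clamp_continuous _ 0 T) (@cont_snd R)).
have clT z : 0 <= cl z <= T by apply: clamp_itv; exact: ltW.
have clE z : 0 <= z.2 <= T -> cl z = z.2 by move=> zT; rewrite /cl clamp_id.
have FB n z : `|k n (cl z) * mode n z.1| <= B n.
  by rewrite normrM (le_trans _ (kB n _ (clT z)))// ler_piMr// mode_le1.
have GB n z : `|k n (cl z) * mode' n z.1| <= B n.
  rewrite normrM (le_trans _ (kB' n _ (clT z)))// ler_wpM2l//.
  exact: (mode'_le).
have [S [cS SE _]] : exists S : R * R -> R, [/\ continuous S,
    forall z, series (fun n => k n (cl z) * mode n z.1) N @[N --> \oo] --> S z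
  & forall N z, `|S z - series (fun n => k n (cl z) * mode n z.1) N| <=
     limn (series B) - series B N].
  apply: weierstrass_mtest FB cB => n; cont.
have [G [cG GE _]] : exists S : R * R -> R, [/\ continuous S,
    forall z, series (fun n => k n (cl z) * mode' n z.1) N @[N --> \oo] --> S z
  & forall N z, `|S z - series (fun n => k n (cl z) * mode' n z.1) N| <=
     limn (series B) - series B N].
  apply: weierstrass_mtest GB cB => n; cont.
pose y z := w (cl z) / alpha - S z; pose g z := - G z.
pose yN N z := w z.2 / alpha - series (fun n => k n z.2 * mode n z.1) N.
pose gN N z := - series (fun n => k n z.2 * mode' n z.1) N.
have cy : continuous y by rewrite /y; cont.
have cg : continuous g by rewrite /g; cont.
have cyN N : continuous (yN N) by rewrite /yN; cont.
have cgN N : continuous (gN N) by rewrite /gN; cont.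
have [Mw Mw0 wM] := continuous_itv_bounded 0 T cw.
have yNQ z : 0 <= z.2 <= T -> yN N z @[N --> \oo] --> y z.
  move=> zT; have clz := clE z zT.
  rewrite /yN /y clz; apply: cvgB; first exact: cvg_cst.
  by have := SE z; rewrite clz.
have gNQ z : 0 <= z.2 <= T -> gN N z @[N --> \oo] --> g z.
  move=> zT; have clz := clE z zT.
  by rewrite /gN /g; apply: cvgN; have := GE z; rewrite clz.
have yNM N z : 0 <= z.2 <= T -> `|yN N z| <= Mw / alpha + limn (series B).
  move=> zT; have clz := clE z zT.
  rewrite /yN (le_trans (ler_normB _ _))// lerD//.
    by rewrite normrM (gtr0_norm (_ : 0 < alpha^-1)) ?invr_gt0// ler_wpM2r ?invr_ge0 ?(ltW alpha_gt0)// wM.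
  by apply: series_bound => // n; have := FB n z; rewrite clz.
have gNM N z : 0 <= z.2 <= T -> `|gN N z| <= limn (series B).
  move=> zT; have clz := clE z zT.
  by rewrite /gN normrN; apply: series_bound => // n; have := GB n z; rewrite clz.
have Q2 z : Q z -> 0 <= z.2 <= T.
  by case: z => x t [_] /=; rewrite in_itv /= => /andP[t0 t1]; rewrite !ltW.
have Qlim (h : R * R -> R) : continuous h ->
    \int[leb2]_(z in Q) (h z * yN N z) @[N --> \oo] --> \int[leb2]_(z in Q) (h z * y z) /\
    \int[leb2]_(z in Q) (h z * gN N z) @[N --> \oo] --> \int[leb2]_(z in Q) (h z * g z).
  move=> ch; have ih := continuous2_integrable T ch; split.
    by apply: (@Qint_cvg _ _ _ yN _ (Mw / alpha + limn (series B))) => //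
      [z /Q2/yNQ|N z /Q2/yNM].
  by apply: (@Qint_cvg _ _ _ gN _ (limn (series B))) => // [z /Q2/gNQ|N z /Q2/gNM].
have yNS N z : yN N.+1 z = yN N z - k N z.2 * mode N z.1.
  by rewrite /yN seriesSr; ring.
have gNS N z : gN N.+1 z = gN N z - k N z.2 * mode' N z.1.
  by rewrite /gN seriesSr; ring.
exists y; split; first exact: continuous_subspaceT.
exists g.
  split; first exact: Lfun2_Qopen.
  move=> psi psiC1 [K [_ KQ] psiK].
  have [_ _ cpsi cpsix _] := psiC1.
  have psi0 x t : x = 0 \/ x = 1 -> psi (x, t) = 0.
    move=> x01; apply: psiK => /KQ [/=]; rewrite in_itv /=.
    by case: x01 => ->; rewrite ltxx ?andbF.
  (* Each partial sum has its classical derivative as weak derivative; boundary terms vanish because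
     [psi] is zero at x = 0 and x = 1. *)
  have partial N : \int[leb2]_(z in Q) (dx psi z * yN N z) =
      - (\int[leb2]_(z in Q) (psi z * gN N z)).
    have base (c p p' : R -> R) : continuous c ->
        (forall x : R, is_derive x 1 p (p' x)) -> continuous p' ->
        \int[leb2]_(z in Q) (c z.2 * p z.1 * dx psi z) =
        - (\int[leb2]_(z in Q) (c z.2 * p' z.1 * psi z)).
      move=> cc dp cp'; rewrite (Q_parts_x T psiC1 cc dp cp').
      rewrite (@eq_Rint _ _ _ leb `]0, T[ _ (fun t => 0 * c t)); last first.
        by move=> t _; rewrite (psi0 1 t (or_intror erefl)) (psi0 0 t (or_introl erefl)); ring.
      by rewrite RintegralZl ?mul0r ?sub0r//; exact: continuous_integrable.
    elim: N => [|N IH].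
      have d1 (x : R) : is_derive x 1 (fun=> alpha^-1 : R) 0 by der.
      have := base w _ _ cw d1 (@cont_cst _ _ 0).
      rewrite (@eq_Rint _ _ _ leb2 Q (fun z => w z.2 * alpha^-1 * dx psi z)
        (fun z => dx psi z * yN 0 z)); last first.
        by move=> z _; rewrite /yN /series /= big_geq// subr0; ring.
      move=> ->; congr (- _); apply: eq_Rint => z _.
      by rewrite /gN /series /= big_geq// oppr0; ring.
    rewrite (@eq_Rint _ _ _ leb2 Q _ (fun z => dx psi z * yN N z + -1 * (k N z.2 * mode N z.1 * dx psi z))); last first.
      by move=> z _; rewrite yNS; ring.
    rewrite Qint_add; [|by cint..].
    rewrite Qint_scale; last by cint.
    rewrite IH (base _ _ _ (ck N) (mode_derive N) (@mode'_cont N)).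
    rewrite (@eq_Rint _ _ _ leb2 Q (fun z => psi z * gN N.+1 z)
      (fun z => psi z * gN N z + -1 * (k N z.2 * mode' N z.1 * psi z))); last first.
      by move=> z _; rewrite gNS; ring.
    rewrite Qint_add; [|by cint..].
    rewrite Qint_scale; last by cint.
    ring.
  have [lim1 _] := Qlim _ cpsix; have [_ lim2] := Qlim _ cpsi.
  rewrite (@eq_Rint _ _ _ leb2 Q _ (fun z => dx psi z * y z)); last by move=> z _; exact: mulrC.
  rewrite (@eq_Rint _ _ _ leb2 Q (fun z => g z * psi z) (fun z => psi z * g z)); last by move=> z _; exact: mulrC.
  rewrite (_ : (fun N => \int[leb2]_(z in Q) (dx psi z * yN N z)) =
    fun N => - (\int[leb2]_(z in Q) (psi z * gN N z))) in lim1; last exact/funext.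
  exact: (cvg_unique _ lim1 (cvgN lim2)).
move=> v vC1 vT.
have [_ _ cv cvx cvt] := vC1.
have cv1 := continuous_slice2 (x := 1) cv.
(* The partial sums satisfy the weak equation up to the residual q(t) v r_N(x), where r_N is the
   remainder in the expansion of 1 / alpha and tends to 0. *)
pose rN N x := alpha^-1 - series (fun n => kap n * mode n x) N.
have crN N : continuous (rN N) by rewrite /rN; cont.
pose form (Y G : R * R -> R) :=
  - (\int[leb2]_(z in Q) (dt v z * Y z)) + \int[leb2]_(z in Q) (dx v z * G z)
  + alpha * \int[leb]_(t in `]0, T[) (v (1, t) * Y (1, t)).
have formE N : form (yN N) (gN N) = \int[leb]_(t in `]0, T[) (w t * v (1, t))
    + \int[leb2]_(z in Q) (q z.2 * v z * rN N z.1).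
  elim: N => [|N IH].
    have E := Q_parts_t T_gt0 vC1 (@cont_cst _ _ alpha^-1) dw cq w0 vT.
    rewrite /form (@eq_Rint _ _ _ leb2 Q _ (fun z => w z.2 * alpha^-1 * dt v z)); last first.
      by move=> z _; rewrite /yN /series /= big_geq// subr0; ring.
    rewrite E (@eq_Rint _ _ _ leb2 Q (fun z => dx v z * gN 0 z) (fun z => 0 * v z)); last first.
      by move=> z _; rewrite /gN /series /= big_geq// oppr0 mulr0 mul0r.
    rewrite Qint_scale ?mul0r; last exact: continuous2_integrable.
    rewrite (@eq_Rint _ _ _ leb2 Q (fun z => q z.2 * v z * rN 0 z.1)
      (fun z => q z.2 * alpha^-1 * v z)); last first.
      by move=> z _; rewrite /rN /series /= big_geq// subr0; ring.
    rewrite -RintegralZl//; last by have c0 := continuous_slice2 (x := 1) (@cyN 0%N); cint.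
    rewrite (@eq_Rint _ _ _ leb `]0, T[ (fun t => alpha * (v (1, t) * yN 0 (1, t)))
      (fun t => w t * v (1, t))); last first.
      by move=> t _; rewrite /yN /series /= big_geq// subr0; field; rewrite gt_eqF.
    ring.
  have E1 := Q_parts_t T_gt0 vC1 (@mode_cont N) (dk N) (@cdk N) (k0 N) vT.
  have cl2 : continuous (fun x => - lam N ^+ 2 * mode N x) by cont.
  have E2 := Q_parts_x T vC1 (ck N) (mode'_derive N) cl2.
  pose I1 := \int[leb2]_(z in Q) (q z.2 * mode N z.1 * v z).
  pose I2 := \int[leb2]_(z in Q) (k N z.2 * mode N z.1 * v z).
  pose I3 := \int[leb]_(t in `]0, T[) (v (1, t) * k N t).
  have F1 : \int[leb2]_(z in Q) (k N z.2 * mode N z.1 * dt v z) = lam N ^+ 2 * I2 - kap N * I1.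
    rewrite E1 /I1 /I2 -!Qint_scale; [|by cint..].
    rewrite -mulN1r -Qint_scale; last by cint.
    rewrite -Qint_sub; [|by cont..].
    by apply: eq_Rint => z _; ring.
  have F2 : \int[leb2]_(z in Q) (k N z.2 * mode' N z.1 * dx v z) =
      lam N ^+ 2 * I2 - alpha * mode N 1 * I3.
    rewrite E2 (@eq_Rint _ _ _ leb2 Q _ (fun z => - lam N ^+ 2 * (k N z.2 * mode N z.1 * v z))); last first.
      by move=> z _; ring.
    rewrite Qint_scale; last by cint.
    rewrite (@eq_Rint _ _ _ leb `]0, T[ _ (fun t => - (alpha * mode N 1) * (v (1, t) * k N t))); last first.
      by move=> t _; rewrite mode'0 mode'1; ring.
    rewrite RintegralZl//; last by cint.
    rewrite /I2 /I3; ring.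
  have G1 : \int[leb2]_(z in Q) (dt v z * yN N.+1 z) =
      \int[leb2]_(z in Q) (dt v z * yN N z) - (lam N ^+ 2 * I2 - kap N * I1).
    rewrite -F1 -Qint_sub; [|by cont..].
    by apply: eq_Rint => z _; rewrite yNS; ring.
  have G2 : \int[leb2]_(z in Q) (dx v z * gN N.+1 z) =
      \int[leb2]_(z in Q) (dx v z * gN N z) - (lam N ^+ 2 * I2 - alpha * mode N 1 * I3).
    rewrite -F2 -Qint_sub; [|by cont..].
    by apply: eq_Rint => z _; rewrite gNS; ring.
  have cy1 : continuous (fun t => v (1, t) * yN N (1, t)).
    by have c1 := continuous_slice2 (x := 1) (@cyN N); cont.
  have G3 : \int[leb]_(t in `]0, T[) (v (1, t) * yN N.+1 (1, t)) =
      \int[leb]_(t in `]0, T[) (v (1, t) * yN N (1, t)) - mode N 1 * I3.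
    rewrite /I3 -RintegralZl//; last by cint.
    rewrite -RintegralB//; last 2 first.
    - exact: continuous_integrable.
    - by cint.
    by apply: eq_Rint => t _; rewrite yNS; ring.
  have G4 : \int[leb2]_(z in Q) (q z.2 * v z * rN N.+1 z.1) =
      \int[leb2]_(z in Q) (q z.2 * v z * rN N z.1) - kap N * I1.
    rewrite /I1 -Qint_scale; last by cint.
    rewrite -Qint_sub; [|by cont..].
    by apply: eq_Rint => z _; rewrite /rN seriesSr; ring.
  rewrite G4 addrA -IH /form G1 G2 G3; ring.
have lim1 : form (yN N) (gN N) @[N --> \oo] --> form y g.
  have [l1 _] := Qlim _ cvt; have [_ l2] := Qlim _ cvx.
  apply: cvgD; first by apply: cvgD => //; exact: cvgN.
  apply: cvgM; first exact: cvg_cst.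
  have [Mv Mv0 vM] := continuous_itv_bounded 0 T cv1.
  apply: (@Rint_cvg _ _ _ (Mv * (Mw / alpha + limn (series B)))).
  - by move=> N; cont.
  - move=> t /andP[t0 t1]; apply: cvgM; first exact: cvg_cst.
    by apply: yNQ; rewrite !ltW.
  - move=> N t /andP[t0 t1]; have tT : 0 <= t <= T by rewrite !ltW.
    by rewrite normrM ler_pM// ?vM//; exact: (yNM N (1, t)).
have lim2 : \int[leb2]_(z in Q) (q z.2 * v z * rN N z.1) @[N --> \oo] --> (0 : R).
  have cqv : continuous (fun z : R * R => q z.2 * v z) by cont.
  have -> : 0 = \int[leb2]_(z in Q) (q z.2 * v z * 0).
    rewrite (@eq_Rint _ _ _ leb2 Q _ (fun z => 0 * v z)); last by move=> z _; rewrite mulr0 mul0r.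
    by rewrite Qint_scale ?mul0r//; exact: continuous2_integrable.
  pose Bk n := 2 * (lam n ^+ 2)^-1.
  have cBk : cvgn (series Bk).
    exact: summable_lam_sqV_scale.
  apply: (@Qint_cvg _ _ (fun z => q z.2 * v z) (fun N z => rN N z.1) (fun=> 0)
    (alpha^-1 + limn (series Bk))).
  - exact: continuous2_integrable.
  - by move=> N; cont.
  - move=> [x t] [] /=; rewrite in_itv /= => /andP[x0 x1] _.
    have H : rN N x @[N --> \oo] --> alpha^-1 - alpha^-1.
      by apply: cvgB; [exact: cvg_cst|apply: kap_expansion; rewrite !ltW].
    by rewrite subrr in H.
  - move=> N z _; rewrite /rN (le_trans (ler_normB _ _))// lerD//.
      by rewrite gtr0_norm// invr_gt0.
    apply: series_bound => // n.
    by rewrite normrM (le_trans _ (kap_le n))// ler_piMr// mode_le1.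
have lim3 : form (yN N) (gN N) @[N --> \oo] --> \int[leb]_(t in `]0, T[) (w t * v (1, t)) + 0.
  rewrite (_ : (fun N => form (yN N) (gN N)) = fun N => \int[leb]_(t in `]0, T[) (w t * v (1, t))
    + \int[leb2]_(z in Q) (q z.2 * v z * rN N z.1)); last exact/funext.
  by apply: cvgD => //; exact: cvg_cst.
rewrite addr0 in lim3; rewrite -(cvg_unique _ lim1 lim3)// /form.
congr (_ + _ * _); last by apply: eq_Rint => t _; exact: mulrC.
rewrite -mulN1r -Qint_scale; last by cint.
rewrite -Qint_add; [|by cint..].
by apply: eq_Rint => z _; ring.
Qed.
End state_existence.

Lemma trace_level_finite (phi g : R * R -> R) (d : R -> R) : continuous phi ->
  weak_dx_L2 T phi g -> continuous d ->
  weak_adjoint T alpha d phi g ->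
  forall c eps : R, c != 0 -> 0 < eps < T ->
    finite_set [set t : R | 0 <= t <= T - eps /\ phi (1, t) = c].
Proof.
move=> cphi wphi cd weak c eps c0 /andP[e0 eT].
have trace := adjoint_trace cphi wphi cd weak.
have [C C0 dC] := coef_bound cd.
have aC n : `|amplitude d n| <= C.
  rewrite /amplitude normrM -[leRHS]mulr1; apply: ler_pM => //; exact: mode_le1.
have rho0 n : 0 < lam n ^+ 2 by rewrite exprn_gt0// lam_gt0.
have rho_sum := summable_lam_sqV.
pose F tau n := amplitude d n * expR (- (lam n ^+ 2 * tau)).
have cF tau : 0 < tau -> cvgn (series (F tau)).
  move=> tau0; apply: normed_cvg.
  apply: series_le_cvg (exp_summable (C := C) rho0 rho_sum tau0) => n //=.
    by rewrite mulr_ge0// expR_ge0.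
  by rewrite normrM (ger0_norm (expR_ge0 _)) ler_wpM2r// expR_ge0.
(* The trace is available only for tau in (0, T], whereas the finiteness argument follows the
   function to infinity; hence [H] is the sum of the series itself. *)
pose H tau := limn (series (F tau)).
have fin := exp_series_finite (H := H) rho0 rho_sum aC cF c0 T e0.
apply: sub_finite_set (finite_image (fun tau => T - tau) fin) => t [/andP[t0 te] tc].
exists (T - t); last by rewrite opprB addrC subrK.
split; first by lra.
have tT : 0 <= t < T by lra.
rewrite -tc; apply: cvg_lim => //; exact: trace.
Qed.

(** * The variational inequality *)

Section variational.
Variables (mu a b : R).
Hypothesis mu_gt0 : 0 < mu.
Notation "'IT' f" := (\int[leb]_(t in `]0, T[) f t) (at level 10, f at level 9).
Variables (yOmega u : R -> R) (y phi : R * R -> R).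
Hypothesis cOmega : {within `[0, 1], continuous yOmega}.
Hypothesis u_opt : optimal_control T alpha mu a b yOmega u.
Hypothesis y_state : state T alpha u y.
Hypothesis phi_adj : adjoint_state T alpha yOmega y phi.

Lemma quadratic_slope (A B : R) :
  (forall s, 0 < s <= 1 -> 0 <= s * A + s ^+ 2 * B) -> 0 <= A.
Proof.
move=> AB; rewrite leNgt; apply/negP => A0.
(* For A < 0 this lies in (0, 1] and gives A + s B <= - s (|A| + 1) < 0. *)
pose s := - A / (`|A| + `|B| + 1).
have D0 : 0 < `|A| + `|B| + 1 by rewrite ltr_wpDl// addr_ge0.
have sE : s * (`|A| + `|B| + 1) = - A by rewrite /s divfK// gt_eqF.
have s0 : 0 < s by rewrite divr_gt0// oppr_gt0.
have s1 : s <= 1.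
  by rewrite ler_pdivrMr// mul1r ltr0_norm//; have := normr_ge0 B; lra.
have := AB s; rewrite s0 s1 => /(_ isT).
rewrite (_ : s * A + s ^+ 2 * B = s * (A + s * B)); last by ring.
rewrite pmulr_rge0// => h.
have : s * B <= s * `|B| by rewrite ler_pM2l// ler_norm.
have : 0 <= s * `|A| by rewrite mulr_ge0// ltW.
have : s * (`|A| + `|B| + 1) = s * `|A| + s * `|B| + s by ring.
rewrite sE; lra.
Qed.

Lemma adjoint_extension : exists (Phi g : R * R -> R) (d : R -> R), [/\ continuous Phi,
  forall z, Qclosed T z -> Phi z = phi z, weak_dx_L2 T Phi g,
  continuous d /\ (forall x, 0 <= x <= 1 -> d x = y (x, T) - yOmega x) &
  weak_adjoint T alpha d Phi g].
Proof.
have [cphi [g wg weak]] := phi_adj.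
have [Phi cPhi PhiE] := Qclosed_extension T_gt0 cphi.
have [Y [gy [cY YE _ _]]] := state_extension T_gt0 y_state.
have [Om cOm OmE] := continuous_extension1 ler01 cOmega.
have dE x : 0 <= x <= 1 -> Y (x, T) - Om x = y (x, T) - yOmega x.
  move=> x01; rewrite OmE// YE//; split; rewrite /= in_itv //=.
  by rewrite lexx ltW.
exists Phi, g, (fun x => Y (x, T) - Om x); split => //.
- by apply: weak_dx_ext wg => z /Qopen_Qclosed /PhiE.
- by split => //; cont.
move=> v vC1 vT.
rewrite (@eq_Rint _ _ _ leb `]0, 1[ _ (fun x => (y (x, T) - yOmega x) * v (x, T))); last first.
  by move=> x /=; rewrite in_itv /= => /andP[? ?]; rewrite dE// !ltW.
rewrite -weak//; congr (_ + _ * _); apply: eq_Rint.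
  by move=> z /Qopen_Qclosed /PhiE ->.
by move=> t /=; rewrite in_itv /= => /Qclosed1 /PhiE ->.
Qed.

(** Along (1 - s) u + s w the tracking term is quadratic in s and the L^1 term is bounded by
    convexity. Duality rewrites the linear coefficient as an integral of the trace, and
    [quadratic_slope] extracts it. *)
Lemma variational_inequality w yw : Uad T a b w -> state T alpha w yw ->
  IT (fun t => phi (1, t) * u t + mu * `|u t|) <=
  IT (fun t => phi (1, t) * w t + mu * `|w t|).
Proof.
move=> wU w_state; have [uU opt] := u_opt.
have iu := Uad_integrable uU; have iw := Uad_integrable wU.
have [Phi [g [d [cPhi PhiE wg [cd dE] weak_phi]]]] := adjoint_extension.
(* The state of w - u, the direction of variation. *)
have zst := state_lin T_gt0 (-1) 1 iu iw y_state w_state.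
have [Z [gz [cZ ZE wz weak_z]]] := state_extension T_gt0 zst.
have ilin f h c1 c2 : leb.-integrable `]0, T[ (EFin \o f) -> leb.-integrable `]0, T[ (EFin \o h) ->
    leb.-integrable `]0, T[ (EFin \o (fun t => c1 * f t + c2 * h t)).
  exact: integrable_lin.
have iN f : leb.-integrable `]0, T[ (EFin \o f) ->
    leb.-integrable `]0, T[ (EFin \o (fun t => `|f t|)).
  by move=> if_; exact: integrable_norm.
have dual := duality cPhi wg cd weak_phi cZ wz
  (ilin _ _ (-1) 1 iu iw) weak_z.
have phiE t : 0 < t < T -> phi (1, t) = Phi (1, t) by move=> /Qclosed1 /PhiE.
have iP h : leb.-integrable `]0, T[ (EFin \o h) ->
    leb.-integrable `]0, T[ (EFin \o (fun t => Phi (1, t) * h t)).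
  move=> ih; rewrite (_ : _ \o _ = EFin \o (fun t => h t * Phi (1, t))); last first.
    by apply/funext => t /=; rewrite mulrC.
  by apply: integrable_mul_continuous => //; cont.
have split_cost h : leb.-integrable `]0, T[ (EFin \o h) ->
    IT (fun t => phi (1, t) * h t + mu * `|h t|) =
    IT (fun t => Phi (1, t) * h t) + mu * IT (fun t => `|h t|).
  move=> ih; rewrite -[X in X + _]mul1r -Rint_lin//; [|exact: iP|exact: iN].
  by apply: eq_Rint => t /=; rewrite in_itv /= mul1r => /phiE ->.
rewrite !split_cost// -subr_ge0.
pose B := I01 (fun x => Z (x, T) ^+ 2).
apply: (@quadratic_slope _ (2^-1 * B)) => s /andP[s0 s1].
have s01 : 0 <= s <= 1 by rewrite s1 ltW.
have := opt _ _ _ (Uad_lin s01 uU wU) y_state (state_lin T_gt0 (1 - s) s iu iw y_state w_state).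
rewrite /cost.
rewrite (@eq_Rint _ _ _ leb `]0, 1[ (fun x => `|y (x, T) - yOmega x| ^+ 2) (fun x => d x ^+ 2)); last first.
  move=> x /=; rewrite in_itv /= => /andP[? ?].
  by rewrite dE ?real_normK ?num_real// !ltW.
rewrite (@eq_Rint _ _ _ leb `]0, 1[ (fun x => `|(1 - s) * y (x, T) + s * yw (x, T) - yOmega x| ^+ 2)
  (fun x => d x ^+ 2 + (2 * s * (d x * Z (x, T)) + s ^+ 2 * Z (x, T) ^+ 2))); last first.
  move=> x /=; rewrite in_itv /= => /andP[x0 x1].
  rewrite real_normK ?num_real// dE ?ltW// ZE.
    by ring.
  by split; rewrite /= in_itv /= ?lexx !ltW.
rewrite RintegralD//; [|by cint..].
rewrite RintegralD//; [|by cint..].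
rewrite (RintegralZl (2 * s))//; last by cint.
rewrite (RintegralZl (s ^+ 2))//; last by cint.
rewrite dual -/B.
rewrite (@eq_Rint _ _ _ leb `]0, T[ (fun t => (-1 * u t + 1 * w t) * Phi (1, t))
  (fun t => 1 * (Phi (1, t) * w t) + -1 * (Phi (1, t) * u t))); last by move=> t _; ring.
rewrite Rint_lin//; [|exact: iP..].
have ineq : IT (fun t => `|(1 - s) * u t + s * w t|) <=
    (1 - s) * IT (fun t => `|u t|) + s * IT (fun t => `|w t|).
  rewrite -Rint_lin//; [|exact: iN..].
  apply: le_Rintegral => //; [exact/iN/ilin|exact: ilin (iN _ iu) (iN _ iw)|].
  move=> t _; apply: le_trans (ler_normD _ _) _.
  by rewrite !normrM (ger0_norm (ltW s0)) ger0_norm// subr_ge0.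
have := ler_wpM2l (ltW mu_gt0) ineq.
set D := I01 (fun x => d x ^+ 2).
set PW := IT (fun t => _ * w t); set PU := IT (fun t => _ * u t).
set U := IT (fun t => `|u t|); set W := IT (fun t => `|w t|); set X := IT (fun t => `|_ + _|).
rewrite (_ : 2^-1 * (D + (2 * s * (1 * PW + -1 * PU) + s ^+ 2 * B)) =
  2^-1 * D + s * (PW - PU) + s ^+ 2 * (2^-1 * B)); last by field.
rewrite (_ : mu * ((1 - s) * U + s * W) = mu * U + s * (mu * W - mu * U)); last by ring.
rewrite (_ : s * (PW + mu * W - (PU + mu * U)) = s * (PW - PU) + s * (mu * W - mu * U)); last by ring.
lra.
Qed.
End variational.

End heat_modes.

(** * Structure of the optimal control *)

Set Strict Implicit.
Unset Implicit Arguments.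
Theorem theorem3 (R : realType) (T alpha mu a b : R) (yOmega : R -> R)
    (ubar : R -> R) (ybar phibar : R * R -> R) :
  0 < T -> 0 < alpha -> 0 < mu -> a < 0 -> 0 < b ->
  {within `[0, 1], continuous yOmega} ->
  optimal_control T alpha mu a b yOmega ubar ->
  state T alpha ubar ybar ->
  adjoint_state T alpha yOmega ybar phibar ->
  (0 < L2norm01 (fun x => (ybar (x, T) - yOmega x)%R))%E ->
  let S := switching_points T mu phibar in
  (* (i) *)
  [/\ [/\ forall eps, 0 < eps -> eps < T -> finite_set (S `&` `[0, T - eps]),
          countable S,
          forall t, limit_point S t -> t = T
        & forall s t, S s -> S t -> s < t ->
            (forall r, s < r < t -> ~ S r) ->
            exists2 c, [\/ c = b, c = a | c = 0]
                     & ae_eq_cst `]s, t[ ubar c],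
  (* (ii) *)
      phibar (1, T) <> mu -> phibar (1, T) <> - mu ->
        finite_set S /\
        exists delta, [/\ 0 < delta < T,
          phibar (1, T) < - mu -> ae_eq_cst `]T - delta, T] ubar b,
          - mu < phibar (1, T) < mu -> ae_eq_cst `]T - delta, T] ubar 0
        & mu < phibar (1, T) -> ae_eq_cst `]T - delta, T] ubar a],
  (* (iii) *)
      (phibar (1, T) = mu -> exists delta, [/\ 0 < delta < T,
         {ae (@lebesgue_measure R),
           forall t, t \in `]T - delta, T] -> ubar t = a \/ ubar t = 0}
       & countable [set t | T - delta < t < T /\
                            switches_between ubar a 0 t]]) /\
      (phibar (1, T) = - mu -> exists delta, [/\ 0 < delta < T,
         {ae (@lebesgue_measure R),
           forall t, t \in `]T - delta, T] -> ubar t = b \/ ubar t = 0}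
       & countable [set t | T - delta < t < T /\
                            switches_between ubar b 0 t]])
  (* (iv) *)
    & ~ exists t, S t /\ exists2 r, 0 < r &
        (ae_eq_cst `]t - r, t[ ubar a /\ ae_eq_cst `]t, t + r[ ubar b) \/
        (ae_eq_cst `]t - r, t[ ubar b /\ ae_eq_cst `]t, t + r[ ubar a)].
Proof.
move=> T0 alpha0 mu0 a0 b0 cOmega u_opt y_state phi_adj _ S.
have root n := robin_root n alpha0.
have [lam lamP] := choice root.
have [Phi [g [d [cPhi PhiE wg [cd dE] weak]]]] := adjoint_extension T0 cOmega y_state phi_adj.
have cf := continuous_slice2 (x := 1) cPhi.
set f := fun t => Phi (1, t) in cf.
have fE t : 0 <= t <= T -> phibar (1, t) = f t.
  move=> tT; rewrite /f PhiE//; split; rewrite /= in_itv /= ?lexx ?ler01//.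
have level := trace_level_finite alpha0 T0 lamP cPhi wg cd weak.
have [uU _] := u_opt.
have iu := Uad_integrable uU.
have cost_eq h : linear_cost T mu f h =
    \int[lebesgue_measure]_(t in `]0, T[) (phibar (1, t) * h t + mu * `|h t|).
  by apply: eq_Rint => t /=; rewrite in_itv /= => /andP[t0 tT]; rewrite fE// !ltW.
have u_min (w q : R -> R) : continuous q -> (forall t : R, is_derive t 1 w (q t)) ->
    w 0 = 0 -> (forall t, a <= w t <= b) -> linear_cost T mu f ubar <= linear_cost T mu f w.
  move=> cq dw w0 wab; rewrite !cost_eq.
  have [yw w_state] := state_exists alpha0 T0 lamP cq dw w0.
  apply: (variational_inequality alpha0 T0 lamP mu0 cOmega u_opt y_state phi_adj _ w_state).
  split; last by apply: nearW => t _.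
  apply: (@Lfun2_bounded _ _ _ (@lebesgue_measure R) `]0, T[%classic w (b - a)).
  - exact: measurable_itv.
  - exact: itvoo_finite.
  - exact: measurable_cont (is_derive_continuous dw).
  - by move=> t _; have := wab t; rewrite ler_norml; lra.
have ub := bang_bang mu0 a0 b0 cf iu uU.2 u_min.
(* Sign changes are tested at arguments in (0, T) only, where the trace of [phibar] coincides with
   [f]. *)
have SE : S = switching_points T mu (fun z : R * R => f z.2).
  apply/seteqP; split => t [tT ch]; split => //; case: ch => ch; [left|right|left|right] => r r0;
  have [s [s' [sT s'T h1 h2 h3]]] := ch r r0; exists s, s'; split => //;
  move: sT s'T h3; rewrite !in_itv /= => /andP[? ?] /andP[? ?]; rewrite !fE ?ltW//.
have TT : 0 <= T <= T by rewrite lexx ltW.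
rewrite SE fE//; split.
- split.
  + by move=> eps; exact: (switching_finite mu0 cf level).
  + exact: (switching_countable T0 mu0 cf level).
  + exact: (switching_limit T0 mu0 cf level).
  + exact: (switching_gap T0 mu0 cf ub level).
- exact: (final_regular T0 mu0 cf ub level).
- split; first exact: (final_upper T0 mu0 a0 cf ub level).
  exact: (final_lower T0 mu0 b0 cf ub level).
- exact: (no_direct_switch T0 mu0 a0 b0 cf ub level).
Qed.
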